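(* Let $K=\mathbb{Q}(\sqrt d)$ be a real quadratic field with $d>0$ a squarefree integer, whose fundamental unit $\epsilon_K > 1$ has norm $+1$, and let $m$ denote the squarefree part of the positive integer $\mathrm{Norm}_{K/\mathbb{Q}}(\epsilon_K+1)$. Then: (a) $[E_{K,4}\cap E_K^+ : E_K^2] = 2$ (i.e., $\epsilon_K$ is a square mod 4), and so $$E_K^2 \subseteq E_{K,4}\cap E_K^+ = E_K^{\square+\square} = E_K^+ \subseteq E_K$$ where both inclusions are of index 2, if and only if one of the following conditions is satisfied: (i) $d\equiv 1 \bmod 4$ and $m\equiv 1 \bmod 4$; (ii) $d\equiv 3 \bmod 4$ and $m$ is odd; (iii) $d\equiv 2\bmod 4$ and $m\equiv 1\bmod 4$; (iv) $d\equiv 2\bmod 8$ and $m\equiv 2\bmod 8$; or (v) $d\equiv 6\bmod 8$ and $m\equiv 6\bmod 8$. (b) $[E_K^+ : E_K^{\square+\square}] = 2$ (i.e., $\epsilon_K$ is not the sum of two squares in $K$), and so $$E_K^2 = E_{K,4}\cap E_K^+ = E_K^{\square+\square} \subseteq E_K^+ \subseteq E_K$$ where both inclusions are of index 2, if and only if $d\equiv 1\bmod 8$ and $m\equiv 3\bmod 4$. (c) In all other cases $[E_K^{\square+\square} : E_{K,4}\cap E_K^+] = 2$ (i.e., $\epsilon_K$ is the sum of two squares in $K$ but is not a square mod 4), and so $$E_K^2 = E_{K,4}\cap E_K^+ \subseteq E_K^{\square+\square} = E_K^+ \subseteq E_K$$ where both inclusions are of index 2.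
   Context: $\mathcal{O}_K$ is the ring of integers of $K$, $E_K$ its unit group, $E_K^2$ the subgroup of squares of units, and $E_K^+$ the group of totally positive units (units positive in both real embeddings of $K$). The fundamental unit $\epsilon_K$ is normalized so that $\epsilon_K>1$ in the embedding of $K$ with $\sqrt d>0$; since it has norm $+1$ it is totally positive. $E_{K,4}$ denotes the group of units $\epsilon\in E_K$ that are squares mod 4, meaning there exist $\alpha,\beta\in\mathcal{O}_K$ with $\epsilon=\alpha^2+4\beta$. $E_K^{\square+\square}$ denotes the group of units $\epsilon \in E_K$ that can be written $\epsilon=\alpha^2+\beta^2$ with $\alpha,\beta\in K$ (not necessarily integral). The squarefree part of a positive integer $N$ is the unique squarefree positive integer $m$ such that $N/m$ is a perfect square. *)

(* Defs.v *)
From HB Require Import structures.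
From mathcomp Require Import all_boot all_order all_algebra all_field.
From mathcomp Require Import all_classical all_reals.

Set Implicit Arguments.
Unset Strict Implicit.
Unset Printing Implicit Defensive.

Import Order.TTheory GRing.Theory Num.Theory.

Local Open Scope classical_set_scope.
Local Open Scope card_scope.
Local Open Scope ring_scope.

Definition squarefree (n : nat) : Prop :=
  forall k : nat, (k ^ 2 %| n)%N -> k = 1%N.

Definition squarefree_part_of (N m : nat) : Prop :=
  squarefree m /\ (m %| N)%N /\ exists k : nat, (N %/ m = k ^ 2)%N.

Definition ringOfIntegers (K : fieldType) : set K :=
  [set x | integralOver (intr : int -> K) x].

Definition unitGroup (K : fieldType) : set K :=
  [set x | x != 0 /\ ringOfIntegers x /\ ringOfIntegers x^-1].

Definition unitSquares (K : fieldType) : set K :=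
  [set u ^+ 2 | u in @unitGroup K].

Definition totallyPositiveUnits (R : realType) (K : fieldType) : set K :=
  [set x | unitGroup x /\ forall tau : {rmorphism K -> R}, 0 < tau x].

Definition unitsSquareMod4 (K : fieldType) : set K :=
  [set x | unitGroup x /\
    exists a b : K,
      [/\ ringOfIntegers a, ringOfIntegers b & x = a ^+ 2 + 4%:R * b]].

Definition unitsSumTwoSquares (K : fieldType) : set K :=
  [set x | unitGroup x /\ exists a b : K, x = a ^+ 2 + b ^+ 2].

(* [A : B] = n, as the number of cosets x B with x in A. It is meant for
   multiplicative groups B `<=` A; the inclusion is not part of the
   definition. *)
Definition hasIndex (K : fieldType) (A B : set K) (n : nat) : Prop :=
  [set [set x * y | y in B] | x in A] #= `I_n.

(* The units of a real quadratic field are {1, -1} x eps^Z; the embedding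
   sigma selects the generator among eps, eps^-1, - eps, - eps^-1. *)
Definition isFundamentalUnit (R : realType) (K : fieldType)
    (sigma : {rmorphism K -> R}) (eps : K) : Prop :=
  [/\ unitGroup eps,
      forall u : K, unitGroup u ->
        exists n : int, u = eps ^ n \/ u = - eps ^ n
    & 1 < sigma eps].

Definition squareMod4Condition (d m : nat) : Prop :=
     (d = 1 %[mod 4] /\ m = 1 %[mod 4])
  \/ (d = 3 %[mod 4] /\ odd m)
  \/ (d = 2 %[mod 4] /\ m = 1 %[mod 4])
  \/ (d = 2 %[mod 8] /\ m = 2 %[mod 8])
  \/ (d = 6 %[mod 8] /\ m = 6 %[mod 8]).

Definition notSumTwoSquaresCondition (d m : nat) : Prop :=
  d = 1 %[mod 8] /\ m = 3 %[mod 4].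

(* Main.v *)
(* Writing eps + 1 = k alpha with N(eps + 1) = m k^2 gives an integer alpha of norm
   m with alpha^2 = m eps, so eps is a sum of two squares in K iff m is, and both
   questions are governed by the relation d r^2 = m (m k^2 - 4), where
   alpha = (m k + r sqrt d) / 2; in particular every odd prime dividing m divides d.

   That eps is a square modulo 4 is a congruence condition on d, m, k, r.

   If d = 1 mod 8 and m = 3 mod 4, then m (y^2 + z^2) = x^2 + d w^2 has no solution
   2-adically, so m is not a sum of two squares in K.  Otherwise put a = m (or m / 2)
   and d = a b.  Dirichlet's argument, which needs real characters only, yields a
   prime q = 1 mod 4 with prescribed Legendre symbols at the primes dividing d, such
   that a x^2 + b y^2 = c z^2, with c = q or 2 q, satisfies the local conditions of
   Legendre's theorem on ternary forms; the pigeonhole principle solves it.  As d is a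
   square in K, a c z^2 = (a x)^2 + d y^2 is then a sum of two squares, and so is a,
   c being one.

   The nonvanishing of L(1, chi) is Mertens' argument: the sums of
   (1 * chi)(n) / sqrt n tend to infinity, whereas the hyperbola method bounds them
   if L(1, chi) = 0.  Reciprocity is proved with Gauss sums over finite fields. *)

Require Import Defs.
From HB Require Import structures.
From mathcomp Require Import all_boot all_order all_algebra all_field.
From mathcomp Require Import all_fingroup all_solvable.
From mathcomp Require Import all_classical all_reals.
From mathcomp Require Import topology normedtype sequences exp.
From mathcomp Require Import ring lra zify.

Set Implicit Arguments.
Unset Strict Implicit.
Unset Printing Implicit Defensive.

Import Order.TTheory GRing.Theory Num.Theory.

Local Open Scope ring_scope.

(** * Real characters and the nonvanishing of [L(1, chi)] *)

(** The obstacle to Legendre's theorem is its condition at q: - a b must be a square modulo q. As q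
    = 1 mod 4, reciprocity turns the symbol of a b modulo q into a product, over the primes p
    dividing a b, of the symbols of q modulo p, and these are already imposed by the conditions at
    the p. If a b is even, the symbol of 2 modulo q is still free and repairs the product. If a b is
    odd, only the factor c0 of c, 1 or 2, can be chosen, and the product has to be computed. The
    relation, a k^2 - b r^2 = f with f = 2 or 4, gives each symbol up to squares, and the product is
    chi4(a), times chi8(d) when c0 f is not a square. It can be made 1 unless d = 1 mod 8 and m = 3
    mod 4: this is the origin of (b). On the side of the units, the squares have index 2 in the
    totally positive units, which are the powers of eps. Both intermediate sets are stable under
    multiplication by squares of units, so each is determined by whether it contains eps. That eps
    is totally positive is read off alpha^2 = m eps. *)

Lemma abel_sum_bound (R : realDomainType) (c g : nat -> R) (B : R) (a b : nat) :
  (forall n, `|\sum_(a <= i < n) c i| <= B) ->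
  (forall i, (a <= i)%N -> g i.+1 <= g i) ->
  (forall i, (a <= i)%N -> 0 <= g i) ->
  `|\sum_(a <= i < b) c i * g i| <= B * g a.
Proof.
move=> hB hg hg0.
have B0 : 0 <= B by have := hB a; rewrite big_geq // normr0.
have [ba|/ltnW ab] := leqP b a.
  by rewrite big_geq // normr0 mulr_ge0 // hg0.
(* Summation by parts; since [g] decreases, the weights of the partial sums are nonnegative and
   telescope to [g a]. *)
have -> : \sum_(a <= i < b) c i * g i = (\sum_(a <= i < b) c i) * g b +
    \sum_(a <= i < b) (\sum_(a <= j < i.+1) c j) * (g i - g i.+1).
  elim: b ab => [|b IH]; first by rewrite leqn0 => /eqP ->; rewrite !big_geq // mul0r addr0.
  rewrite leq_eqVlt => /predU1P [->|]; first by rewrite !big_geq // mul0r addr0.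
  rewrite ltnS => ab; rewrite [LHS]big_nat_recr // IH //= [in RHS]big_nat_recr //=.
  rewrite [in X in _ = _ + X]big_nat_recr //= [in X in _ = _ + (_ + X)]big_nat_recr //=.
  by ring.
apply: le_trans (ler_normD _ _) _; rewrite normrM (ger0_norm (hg0 _ ab)).
have -> : B * g a = B * g b + \sum_(a <= i < b) B * (g i - g i.+1).
  by rewrite -mulr_sumr -mulrDr (@telescope_sumr_eq _ _ _ (fun i => - g i)) // => *; ring.
apply: lerD; first by rewrite ler_wpM2r // hg0.
apply: le_trans (ler_norm_sum _ _ _) _; rewrite ler_sum_nat // => i /andP [ai _].
rewrite normrM (ger0_norm (x := g i - _)) ?subr_ge0 ?hg //.
by rewrite ler_wpM2r // subr_ge0 hg.
Qed.

(** The principal character is allowed, because products of characters over the empty set occur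
    later; nontriviality is the separate hypothesis [chi_neq1]. *)
Record real_character (R : numDomainType) (M : nat) (chi : nat -> R) : Prop :=
  RealCharacter {
    rchar1 : chi 1 = 1;
    rcharM : forall x y, chi (x * y)%N = chi x * chi y;
    rcharD : forall x, chi (x + M)%N = chi x;
    rchar_val : forall x, coprime x M -> chi x = 1 \/ chi x = -1;
    rchar0 : forall x, ~~ coprime x M -> chi x = 0 }.

Section RealCharacter.
Variables (R : realFieldType) (M : nat) (chi : nat -> R).
Hypotheses (M_gt0 : (0 < M)%N) (chiP : real_character M chi).

Lemma rchar_mod x : chi (x %% M)%N = chi x.
Proof.
rewrite [in RHS](divn_eq x M) addnC; elim: (x %/ M)%N => [|k IH]; first by rewrite addn0.
by rewrite mulSnr addnA (rcharD chiP).
Qed.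

Lemma rchar_norm x : `|chi x| <= 1.
Proof.
have [c|c] := boolP (coprime x M); last by rewrite (rchar0 chiP c) normr0.
by case: (rchar_val chiP c) => ->; rewrite ?normrN normr1.
Qed.

Hypothesis chi_neq1 : exists2 a, coprime a M & chi a = -1.

(** Multiplication by [a] permutes the residues modulo [M], so the sum equals its own opposite. *)
Lemma rchar_sum_period : \sum_(0 <= i < M) chi i = 0.
Proof.
have [a ca chia] := chi_neq1; rewrite big_mkord.
have lt_mod (x : nat) : (x %% M < M)%N by rewrite ltn_mod.
pose h (i : 'I_M) := Ordinal (lt_mod (a * i)%N).
have hinj : injective h.
  move=> i j /(congr1 val) /= /eqP.
  rewrite -(eqn_modDr 0) !addn0 => /eqP hij; apply/val_inj.
  wlog ij : i j hij / (i <= j)%N.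
    by case/orP: (leq_total i j) => ij H; [exact: H|apply/esym; exact: H].
  move/eqP: hij; rewrite eq_sym eqn_mod_dvd ?leq_mul2l ?ij ?orbT // -mulnBr.
  rewrite Gauss_dvdr; last by rewrite coprime_sym.
  have ltM : (j - i < M)%N by rewrite (leq_ltn_trans (leq_subr _ _)).
  case: (posnP (j - i)%N) => [z _|p /(dvdn_leq p)]; last by rewrite leqNgt ltM.
  by apply/eqP; rewrite eqn_leq ij -subn_eq0 z.
have E : chi a * \sum_(i < M) chi i = \sum_(i < M) chi i.
  rewrite [RHS](reindex_inj hinj) mulr_sumr; apply: eq_bigr => i _ /=.
  by rewrite rchar_mod (rcharM chiP).
by move: E; rewrite chia; lra.
Qed.

(** Whole periods contribute nothing, so a sum from 0 is at most [M] in absolute value; a general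
    range is a difference of two such sums. *)
Lemma rchar_sum_bound a b : `|\sum_(a <= i < b) chi i| <= 2 * M%:R.
Proof.
have H n : `|\sum_(0 <= i < n) chi i| <= M%:R.
  have -> : \sum_(0 <= i < n) chi i = \sum_(0 <= i < n %% M) chi i.
    rewrite [in LHS](divn_eq n M); elim: (n %/ M)%N => [|k IH]; first by [].
    rewrite mulSn -addnA (big_cat_nat _ (n := M)) ?leq_addr //= rchar_sum_period add0r.
    rewrite [LHS](big_addn 0 _ M) addKn -IH; apply: eq_bigr => i _.
    exact: (rcharD chiP).
  apply: le_trans (ler_norm_sum _ _ _) _.
  apply: (le_trans (y := \sum_(0 <= i < n %% M) 1)).
    by apply: ler_sum => i _; exact: rchar_norm.
  by rewrite sumr_const_nat subn0 ler_nat ltnW // ltn_mod.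
have [ba|/ltnW ab] := leqP b a; first by rewrite big_geq // normr0 mulr_ge0.
have -> : \sum_(a <= i < b) chi i = \sum_(0 <= i < b) chi i - \sum_(0 <= i < a) chi i.
  by rewrite [in X in X - _](big_cat_nat _ ab) //=; ring.
apply: le_trans (ler_normB _ _) _; have := H a; have := H b; lra.
Qed.

Lemma rchar_tail_bound (g : nat -> R) a b :
  (forall i, (a <= i)%N -> g i.+1 <= g i) -> (forall i, (a <= i)%N -> 0 <= g i) ->
  `|\sum_(a <= i < b) chi i * g i| <= 2 * M%:R * g a.
Proof. by move=> *; apply: abel_sum_bound => // n; exact: rchar_sum_bound. Qed.

End RealCharacter.

Lemma sum_nat_dvdn (V : nmodType) (G : nat -> V) (a X : nat) : (0 < a)%N ->
  \sum_(1 <= n < X.+1 | (a %| n)%N) G n = \sum_(1 <= b < (X %/ a).+1) G (a * b)%N.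
Proof.
move=> a0; elim: X => [|X IH]; first by rewrite div0n !big_geq.
rewrite big_mkcond big_nat_recr //= -big_mkcond IH divnS //.
case: ifP => [aX|_]; last by rewrite addr0.
rewrite [RHS]big_nat_recr //=; congr (_ + G _).
by have := divnS X a0; rewrite aX add1n => <-; rewrite mulnC divnK.
Qed.

Section DivisorSum.
Variables (R : realFieldType) (M : nat) (chi : nat -> R).
Hypothesis (chiP : real_character M chi).

(** The convolution of 1 and [chi]: the coefficients of zeta(s) L(s, chi). *)
Definition divisor_sum (n : nat) : R := \sum_(1 <= a < n.+1 | (a %| n)%N) chi a.

Lemma divisor_sum_wide n b : (0 < n)%N -> (n < b)%N ->
  \sum_(1 <= a < b | (a %| n)%N) chi a = divisor_sum n.
Proof.
move=> n0 nb; rewrite (big_cat_nat _ (n := n.+1)) //= [X in _ + X]big1_seq ?addr0 //.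
move=> i /andP [/dvdn_leq - /(_ n0) ?]; rewrite mem_index_iota => /andP [? _].
by exfalso; lia.
Qed.

(** A divisor of [p ^ k.+1 * n] prime to [p] divides [n]; the others are [p * b] with [b] a divisor
    of [p ^ k * n]. *)
Lemma divisor_sum_recl p k n : prime p -> coprime p n -> (0 < n)%N ->
  divisor_sum (p ^ k.+1 * n) = divisor_sum n + chi p * divisor_sum (p ^ k * n).
Proof.
move=> pp cpn n0; have p0 := prime_gt0 pp.
have N0 : (0 < p ^ k.+1 * n)%N by rewrite muln_gt0 expn_gt0 p0.
have N1 : (0 < p ^ k * n)%N by rewrite muln_gt0 expn_gt0 p0.
rewrite {1}/divisor_sum (bigID (fun a => p %| a)%N) /= addrC; congr (_ + _).
  rewrite -(@divisor_sum_wide n (p ^ k.+1 * n).+1) //; last first.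
    by rewrite ltnS leq_pmull // expn_gt0 p0.
  apply: eq_bigl => a; apply/andP/idP => [[]|aN].
    by rewrite -prime_coprime // => /[swap] ?; rewrite Gauss_dvdr // coprime_sym coprimeXl.
  rewrite dvdn_mull // -prime_coprime //; split=> //.
  by apply: (coprime_dvdr aN).
have -> : \sum_(1 <= a < (p ^ k.+1 * n).+1 | (a %| p ^ k.+1 * n)%N && (p %| a)%N) chi a =
   \sum_(1 <= a < (p ^ k.+1 * n).+1 | (p %| a)%N) (if (a %| p ^ k.+1 * n)%N then chi a else 0).
  by rewrite -big_mkcondl; apply: eq_bigl => a.
rewrite sum_nat_dvdn // expnS -mulnA mulKn // /divisor_sum big_mkcond mulr_sumr [RHS]big_mkcond.
apply: eq_bigr => b _; rewrite dvdn_pmul2l //; case: ifP => // _.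
by rewrite (rcharM chiP).
Qed.

Lemma divisor_sum_pfactor p k n : prime p -> coprime p n -> (0 < n)%N ->
  divisor_sum (p ^ k * n) = (\sum_(j < k.+1) chi p ^+ j) * divisor_sum n.
Proof.
move=> pp cpn n0; elim: k => [|k IH]; first by rewrite mul1n big_ord1 expr0 mul1r.
rewrite divisor_sum_recl // IH mulrA -[X in X + _]mul1r -mulrDl; congr (_ * _).
rewrite [RHS]big_ord_recl expr0 mulr_sumr; congr (_ + _).
by apply: eq_bigr => i _; rewrite -exprS.
Qed.

Lemma rchar_geom_ge0 p k : 0 <= \sum_(j < k) chi p ^+ j.
Proof.
have E : chi p = -1 -> \sum_(j < k) chi p ^+ j = (odd k)%:R.
  move=> ->; elim: k => [|k IH]; first by rewrite big_ord0.
  by rewrite big_ord_recr /= IH -signr_odd; case: (odd k) => /=; lra.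
have [c|c] := boolP (coprime p M); last first.
  by rewrite (rchar0 chiP c); apply: sumr_ge0 => i _; rewrite exprn_ge0.
case: (rchar_val chiP c) => [->|/E ->]; last exact: ler0n.
by apply: sumr_ge0 => i _; rewrite exprn_ge0.
Qed.

Lemma rchar_geom_odd_ge1 p k : coprime p M -> 1 <= \sum_(j < (2 * k).+1) chi p ^+ j.
Proof.
move=> c; elim: k => [|k IH]; first by rewrite big_ord1.
rewrite mulnS !addSn add0n !big_ord_recr /= in IH *.
case: (rchar_val chiP c) IH => ->; first by rewrite !expr1n; lra.
by rewrite !exprS; lra.
Qed.

Lemma divisor_sum_ge0 n : (0 < n)%N -> 0 <= divisor_sum n.
Proof.
elim/ltn_ind: n => n IH n0; have [n1|n1] := leqP n 1.
  have -> : n = 1%N by lia.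
  by rewrite /divisor_sum big_mkcond big_nat1 dvdnn (rchar1 chiP).
have pp := pdiv_prime n1; have [m cpm nE] := pfactor_coprime pp n0.
have m0 : (0 < m)%N by move: n0; rewrite nE; case: m {cpm nE}.
rewrite nE mulnC divisor_sum_pfactor // mulr_ge0 ?rchar_geom_ge0 // IH //.
rewrite [X in (_ < X)%N]nE ltn_Pmulr // -[1%N](expn0 (pdiv n)) ltn_exp2l ?prime_gt1 //.
by rewrite logn_gt0 mem_primes pp n0 pdiv_dvd.
Qed.

(** In a square every exponent is even, so each local factor is a sum of an odd number of powers of
    1 or of -1, hence at least 1. *)
Lemma divisor_sum_sqr_ge1 n : (0 < n)%N -> coprime n M -> 1 <= divisor_sum (n ^ 2).
Proof.
elim/ltn_ind: n => n IH n0 cn; have [n1|n1] := leqP n 1.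
  have -> : n = 1%N by lia.
  by rewrite /divisor_sum big_mkcond big_nat1 dvdnn (rchar1 chiP).
have pp := pdiv_prime n1; have [m cpm nE] := pfactor_coprime pp n0.
have m0 : (0 < m)%N by move: n0; rewrite nE; case: m {cpm nE}.
have ltmn : (m < n)%N.
  rewrite [X in (_ < X)%N]nE ltn_Pmulr // -[1%N](expn0 (pdiv n)) ltn_exp2l ?prime_gt1 //.
  by rewrite logn_gt0 mem_primes pp n0 pdiv_dvd.
have -> : (n ^ 2 = pdiv n ^ (2 * logn (pdiv n) n) * m ^ 2)%N.
  by rewrite {1}nE expnMn -expnM [(_ * 2)%N]mulnC mulnC.
rewrite divisor_sum_pfactor ?coprimeXr ?expn_gt0 ?m0 //.
have cp : coprime (pdiv n) M by apply: coprime_dvdl cn; exact: pdiv_dvd.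
have cm : coprime m M by apply: coprime_dvdl cn; rewrite nE dvdn_mulr.
have := IH m ltmn m0 cm; have := rchar_geom_odd_ge1 (logn (pdiv n) n) cp. nra.
Qed.
End DivisorSum.

(** * Partial sums of inverse square roots *)

Section InverseSqrtSum.
Variable (R : rcfType).
Local Notation sqn n := (Num.sqrt (n%:R : R)).

Lemma sqrt_succ_bounds n (x := sqn n) (y := sqn n.+1) :
  [/\ 0 <= x, x < y, y ^+ 2 = x ^+ 2 + 1 & 1 <= y].
Proof.
rewrite /x /y sqrtr_ge0 ltr_sqrt ?ltr0n // ltr_nat ltnSn !sqr_sqrtr ?ler0n //.
by rewrite -natr1; split=> //; rewrite natr1 -[X in X <= _]sqrtr1 ler_sqrt // ler1n.
Qed.

Definition invsqrt_sum n : R := \sum_(1 <= b < n.+1) (sqn b)^-1.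

Lemma invsqrt_sumS n : invsqrt_sum n.+1 = invsqrt_sum n + (sqn n.+1)^-1.
Proof. by rewrite /invsqrt_sum big_nat_recr. Qed.

(** The gap between the sum and its integral; it tends to -zeta(1/2). Monotonicity and the bounds 0
    and 2 suffice, the former so that it can enter a summation by parts. *)
Definition invsqrt_defect n : R := 2 * sqn n - invsqrt_sum n.

Lemma invsqrt_defect0 : invsqrt_defect 0 = 0.
Proof. by rewrite /invsqrt_defect /invsqrt_sum big_geq // sqrtr0; lra. Qed.

Lemma invsqrt_defect_homo : {homo invsqrt_defect : m n / (m <= n)%N >-> m <= n}.
Proof.
apply: homo_leq => [x //|y x z|n]; first exact: le_trans.
rewrite /invsqrt_defect invsqrt_sumS; have [x0 xy y2 y1] := sqrt_succ_bounds n.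
move: x0 xy y2 y1; set x := sqn n; set y := sqn n.+1 => x0 xy y2 y1.
suff: y^-1 <= 2 * (y - x) by lra.
by rewrite -[y^-1]mul1r ler_pdivrMr; nra.
Qed.

Lemma invsqrt_defect_ge0 n : 0 <= invsqrt_defect n.
Proof. by rewrite -invsqrt_defect0 invsqrt_defect_homo. Qed.

Lemma invsqrt_defect_le2 n : invsqrt_defect n <= 2.
Proof.
rewrite /invsqrt_defect; suff: 2 * sqn n.+1 - 2 <= invsqrt_sum n.
  by have [? ? ? ?] := sqrt_succ_bounds n; lra.
elim: n => [|n IH]; first by rewrite /invsqrt_sum big_geq // sqrtr1; lra.
rewrite invsqrt_sumS; have [x0 xy y2 y1] := sqrt_succ_bounds n.+1.
have [_ _ _] := sqrt_succ_bounds n.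
move: IH x0 xy y2 y1; set x := sqn n.+1; set y := sqn n.+2 => IH x0 xy y2 y1 x1.
suff: 2 * (y - x) <= x^-1 by lra.
by rewrite -[x^-1]mul1r ler_pdivlMr; nra.
Qed.

Lemma invsqrt_sum_le n : invsqrt_sum n <= 2 * sqn n.
Proof. by have := invsqrt_defect_ge0 n; rewrite /invsqrt_defect; lra. Qed.

Lemma invsqrt_ge0 n : 0 <= (sqn n)^-1.
Proof. by rewrite invr_ge0 sqrtr_ge0. Qed.

Lemma invsqrt_nincr n : (0 < n)%N -> (sqn n.+1)^-1 <= (sqn n)^-1.
Proof.
by move=> n0; rewrite lef_pV2 ?posrE ?sqrtr_gt0 ?ltr0n // ler_sqrt // ler_nat.
Qed.

(** With x = N / sqrt a and y the root of the floor of x^2, one has 0 <= x^2 - y^2 <= 1, hence x - y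
    <= 1 / x. *)
Lemma sqrt_divn_approx N a : (0 < a)%N -> (a <= N)%N ->
  0 <= N%:R / sqn a - sqn (N ^ 2 %/ a) <= sqn a / N%:R.
Proof.
move=> a0 aN; set q := (N ^ 2 %/ a)%N.
have a2 : sqn a ^+ 2 = a%:R by rewrite sqr_sqrtr.
have q2 : sqn q ^+ 2 = q%:R by rewrite sqr_sqrtr.
have sa : 0 < sqn a by rewrite sqrtr_gt0 ltr0n.
have sq : 0 <= sqn q by rewrite sqrtr_ge0.
have N0 : 0 < N%:R :> R by rewrite ltr0n; lia.
have h1 : q%:R * a%:R <= N%:R ^+ 2 :> R.
  by rewrite -natrX -natrM ler_nat leq_trunc_div.
have h2 : N%:R ^+ 2 <= (q%:R + 1) * a%:R :> R.
  by rewrite -natrX natr1 -natrM ler_nat ltnW // ltn_ceil.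
rewrite -a2 -q2 in h1 h2; move: h1 h2; move: (sqn a) (sqn q) (N%:R : R) a2 q2 sa sq N0 => x y n _ _ x0 y0 n0 h1 h2.
have h3 : y * x <= n.
  rewrite -(ler_pXn2r (n := 2)) ?nnegrE //; first by rewrite exprMn.
  - by rewrite mulr_ge0 // ltW.
  - exact: ltW.
have -> : 0 <= n / x - y by rewrite subr_ge0 ler_pdivlMr.
rewrite lerBlDr ler_pdivrMr // mulrDl.
have -> : x / n * x = x ^+ 2 / n by field; rewrite gt_eqF.
have z0 : 0 <= y * x by rewrite mulr_ge0 // ltW.
rewrite -lerBlDr ler_pdivlMr //; nra.
Qed.
End InverseSqrtSum.

Lemma sum_squares_le (R : realDomainType) (F : nat -> R) N : (forall n, (0 < n)%N -> 0 <= F n) ->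
  \sum_(1 <= k < N.+1) F (k ^ 2)%N <= \sum_(1 <= n < (N ^ 2).+1) F n.
Proof.
move=> F0; elim: N => [|N IH]; first by rewrite !big_geq.
rewrite big_nat_recr //= [X in _ <= X](big_cat_nat _ (n := (N ^ 2).+1)) //=; last first.
  by rewrite ltnS leq_exp2r.
apply: lerD => //; rewrite big_nat_recr /=; last by rewrite ltn_exp2r.
by rewrite lerDr big_nat_cond sumr_ge0 // => i; rewrite andbT => /andP [? _]; rewrite F0 //; lia.
Qed.

Lemma harmonic_pow2 (R : realFieldType) (k : nat) :
  k%:R / 2 <= \sum_(1 <= j < (2 ^ k).+1) (j%:R)^-1 :> R.
Proof.
elim: k => [|k IH]; first by rewrite big_nat1; lra.
have p2 : (0 < 2 ^ k)%N by rewrite expn_gt0.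
rewrite (big_cat_nat _ (n := (2 ^ k).+1)) //=; last by rewrite expnS; lia.
have : \sum_((2 ^ k).+1 <= j < (2 ^ k.+1).+1) (2 ^ k.+1)%:R^-1 <=
       \sum_((2 ^ k).+1 <= j < (2 ^ k.+1).+1) (j%:R)^-1 :> R.
  apply: ler_sum_nat => j /andP [j1 j2].
  by rewrite lef_pV2 ?posrE ?ltr0n ?ler_nat //; lia.
rewrite sumr_const_nat subSS expnS mul2n -addnn addnK => H.
have E : (2 ^ k + 2 ^ k)%:R^-1 *+ 2 ^ k = 2^-1 :> R.
  rewrite -mulr_natr natrD; field.
  by rewrite gt_eqF // addr_gt0 ?ltr0n.
move: H IH; rewrite E -natr1; lra.
Qed.

(** The integers congruent to 1 modulo [M] already suffice: 1 / (n M + 1) is at least 1 / ((n + 1)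
    M), and the harmonic sums are unbounded. *)
Lemma coprime_harmonic_unbounded (R : archiRealFieldType) (M : nat) (B : R) : (0 < M)%N ->
  exists N : nat, B <= \sum_(1 <= k < N.+1 | coprime k M) (k%:R)^-1.
Proof.
move=> M0; pose H N : R := \sum_(1 <= k < N.+1 | coprime k M) (k%:R)^-1.
have HS n : M%:R^-1 * \sum_(1 <= j < n.+1) (j%:R)^-1 <= H (n * M)%N.
  elim: n => [|n IH]; first by rewrite /H !big_geq // mulr0.
  rewrite big_nat_recr //= mulrDr /H [X in _ <= X](big_cat_nat _ (n := (n * M).+1)) //=; last first.
    by rewrite ltnS; nia.
  apply: lerD => //; rewrite big_mkcond big_ltn; last by nia.
  have -> : coprime (n * M).+1 M.
    by rewrite coprime_sym /coprime -addn1 gcdnMDl gcdn1.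
  apply: ler_wpDr.
    by apply: sumr_ge0 => i _; case: ifP => _ //; rewrite invr_ge0.
  by rewrite -invfM lef_pV2 ?posrE ?ltr0n -?natrM ?ltr0n ?ler_nat //; nia.
have M0' : 0 < M%:R :> R by rewrite ltr0n.
pose k := Num.bound `|2 * M%:R * B|; exists (2 ^ k * M)%N.
apply: le_trans (HS _).
rewrite mulrC ler_pdivlMr // ; apply: le_trans (harmonic_pow2 _ k).
have : `|2 * M%:R * B| < k%:R by rewrite archi_boundP.
by rewrite real_ltr_norml ?num_real // => /andP [_]; lra.
Qed.

(** * Lower bound for L(1, chi) by the hyperbola method *)

Section NonVanishing.
Variables (R : realType) (M : nat) (chi : nat -> R).
Hypotheses (M_gt0 : (0 < M)%N) (chiP : real_character M chi).
Hypothesis chi_neq1 : exists2 a, coprime a M & chi a = -1.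
Local Notation sqn n := (Num.sqrt (n%:R : R)).

Let T X := \sum_(1 <= n < X.+1) divisor_sum chi n * (sqn n)^-1.
Let c a := chi a * (sqn a)^-1.

Lemma divisor_sum_hyperbola X : T X = \sum_(1 <= a < X.+1) c a * invsqrt_sum R (X %/ a).
Proof.
rewrite /T; under eq_big_nat => n /andP [n1 nX].
  rewrite -(divisor_sum_wide chi n1 nX) mulr_suml big_mkcond /=; over.
rewrite exchange_big_nat /=; apply: eq_big_nat => a /andP [a1 aX].
rewrite -big_mkcond sum_nat_dvdn // /invsqrt_sum mulr_sumr; apply: eq_bigr => b _.
by rewrite /c natrM sqrtrM ?ler0n // invfM mulrA.
Qed.

(** All terms are nonnegative, and the term at k^2 is at least 1 / k when [k] is coprime to [M]; the
    other terms are dropped. *)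
Lemma divisor_sum_sqrt_ge N :
  \sum_(1 <= k < N.+1 | coprime k M) (k%:R)^-1 <= T (N ^ 2).
Proof.
rewrite /T; apply: le_trans (sum_squares_le (F := fun n => divisor_sum chi n * (sqn n)^-1) N _); last first.
  by move=> n n0; rewrite mulr_ge0 ?invsqrt_ge0 // (divisor_sum_ge0 chiP).
rewrite big_mkcond; apply: ler_sum_nat => k /andP [k1 _].
rewrite natrX sqrtr_sqr ger0_norm ?ler0n //; case: ifP => ck.
  by rewrite ler_peMl ?invr_ge0 ?ler0n // (divisor_sum_sqr_ge1 chiP).
by rewrite mulr_ge0 ?invr_ge0 ?ler0n // (divisor_sum_ge0 chiP) // expn_gt0 k1.
Qed.

Let tail := rchar_tail_bound M_gt0 chiP chi_neq1.

(** The inner sum is close to 2 sqrt(N^2 / a) = 2 N / sqrt a, which produces 2 N times the partial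
    sum of L(1, chi). Two errors remain: the defect [e] of the inner sum and the rounding [dl] of
    N^2 / a. *)
Lemma hyperbola_low N :
  \sum_(1 <= a < N.+1) c a * invsqrt_sum R (N ^ 2 %/ a) <=
  2 * N%:R * (\sum_(1 <= n < N.+1) chi n / n%:R) + 4 * M%:R + 2.
Proof.
pose e a := invsqrt_defect R (N ^ 2 %/ a).
(* As [a] grows, [N ^ 2 %/ a] and hence [e a] decrease, so cancellation in [chi] applies; [e 1 <= 2]
   then gives 4 M. *)
have E1 : `|\sum_(1 <= a < N.+1) chi a * (e a * (sqn a)^-1)| <= 2 * M%:R * (e 1 * (sqn 1)^-1).
  apply: tail => i i1; last by rewrite mulr_ge0 ?invsqrt_ge0 // invsqrt_defect_ge0.
  apply: ler_pM; rewrite ?invsqrt_ge0 ?invsqrt_defect_ge0 ?invsqrt_nincr //.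
  by apply: invsqrt_defect_homo; exact: leq_div2l.
have {}E1 : `|\sum_(1 <= a < N.+1) chi a * (e a * (sqn a)^-1)| <= 4 * M%:R.
  apply: le_trans E1 _; rewrite sqrtr1 invr1 mulr1.
  have := invsqrt_defect_le2 R (N ^ 2 %/ 1); rewrite -/(e 1).
  by have : 0 <= M%:R :> R by []; nra.
pose dl a := N%:R / sqn a - sqn (N ^ 2 %/ a).
(* No cancellation here: each of the N terms is at most (sqrt a / N) / sqrt a = 1 / N. *)
have E2 : `|\sum_(1 <= a < N.+1) chi a * (dl a * (sqn a)^-1)| <= 1.
  apply: le_trans (ler_norm_sum _ _ _) _.
  apply: (le_trans (y := \sum_(1 <= a < N.+1) N%:R^-1)); last first.
    rewrite sumr_const_nat subn1 /= -[_ *+ N]mulr_natl.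
    by case: (N) => [|n] /=; rewrite ?mul0r // mulfV ?pnatr_eq0.
  apply: ler_sum_nat => a /andP [a1 aN].
  have /andP [d0 d1] := sqrt_divn_approx R a1 aN.
  have sa : 0 < sqn a by rewrite sqrtr_gt0 ltr0n.
  rewrite !normrM; apply: (le_trans (y := 1 * (`|dl a| * `|(sqn a)^-1|))).
    by apply: ler_wpM2r; rewrite ?(rchar_norm chiP) // mulr_ge0.
  rewrite mul1r (ger0_norm d0) ger0_norm ?invsqrt_ge0 //.
  by rewrite ler_pdivrMr // [leRHS]mulrC.
have -> : \sum_(1 <= a < N.+1) c a * invsqrt_sum R (N ^ 2 %/ a) =
  2 * N%:R * (\sum_(1 <= n < N.+1) chi n / n%:R)
   - 2 * (\sum_(1 <= a < N.+1) chi a * (dl a * (sqn a)^-1))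
   - \sum_(1 <= a < N.+1) chi a * (e a * (sqn a)^-1).
  rewrite !mulr_sumr -!sumrB; apply: eq_big_nat => a /andP [a1 _].
  have sa : 0 < sqn a by rewrite sqrtr_gt0 ltr0n.
  have -> : (a%:R : R) = sqn a ^+ 2 by rewrite sqr_sqrtr.
  rewrite sqrtr_sqr (ger0_norm (ltW sa)) /c /dl /e /invsqrt_defect.
  by field; rewrite gt_eqF.
move: E1 E2; rewrite !ler_norml => /andP [? ?] /andP [? ?]; lra.
Qed.

(** For a > N the cofactor b is at most N. Summing over a first, cancellation bounds each inner sum
    by 2 M / sqrt(N + 1), and the sum of the 1 / sqrt b is at most 2 sqrt N. *)
Lemma hyperbola_high N :
  \sum_(N.+1 <= a < (N ^ 2).+1) c a * invsqrt_sum R (N ^ 2 %/ a) <= 4 * M%:R.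
Proof.
have -> : \sum_(N.+1 <= a < (N ^ 2).+1) c a * invsqrt_sum R (N ^ 2 %/ a) =
   \sum_(1 <= b < N.+1) (sqn b)^-1 * \sum_(N.+1 <= a < (N ^ 2 %/ b).+1) c a.
  transitivity (\sum_(N.+1 <= a < (N ^ 2).+1) \sum_(1 <= b < N.+1)
      if (a * b <= N ^ 2)%N then c a * (sqn b)^-1 else 0).
    apply: eq_big_nat => a /andP [Na aN2]; rewrite /invsqrt_sum mulr_sumr.
    have a0 : (0 < a)%N by lia.
    have le : (N ^ 2 %/ a <= N)%N by rewrite -ltnS ltn_divLR //; nia.
    rewrite [RHS](big_cat_nat _ (n := (N ^ 2 %/ a).+1)) //=.
    rewrite [X in _ = _ + X]big1_seq ?addr0 => [|b]; last first.
      rewrite mem_index_iota => /andP [_ /andP [ab _]].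
      by case: ifP => //; rewrite mulnC -leq_divRL //; lia.
    apply: eq_big_nat => b /andP [b1 bq].
    by rewrite mulnC -leq_divRL // -ltnS bq.
  rewrite exchange_big_nat /=; apply: eq_big_nat => b /andP [b1 bN].
  rewrite mulr_sumr.
  have le : (N ^ 2 %/ b <= N ^ 2)%N by exact: leq_div.
  have [lt|lt] := leqP (N ^ 2 %/ b) N.
    rewrite [RHS]big_geq // big1_seq // => a.
    rewrite mem_index_iota => /andP [_ /andP [Na aN]].
    by case: ifP => //; rewrite -leq_divRL //; lia.
  rewrite [LHS](big_cat_nat _ (n := (N ^ 2 %/ b).+1)) //=; last by lia.
  rewrite [X in _ + X]big1_seq ?addr0 => [|a]; last first.
    rewrite mem_index_iota => /andP [_ /andP [Na aN]].
    by case: ifP => //; rewrite -leq_divRL //; lia.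
  apply: eq_big_nat => a /andP [Na aN]; rewrite mulrC.
  by rewrite -leq_divRL // -ltnS aN.
apply: (le_trans (y := \sum_(1 <= b < N.+1) (sqn b)^-1 * (2 * M%:R * (sqn N.+1)^-1))).
  apply: ler_sum_nat => b /andP [b1 bN]; apply: ler_wpM2l; first exact: invsqrt_ge0.
  apply: le_trans (ler_norm _) _; apply: tail => i Ni; first by apply: invsqrt_nincr; lia.
  exact: invsqrt_ge0.
rewrite -mulr_suml -/(invsqrt_sum R N).
have [x0 xy _ _] := sqrt_succ_bounds R N; have y0 := le_lt_trans x0 xy.
have := invsqrt_sum_le R N; move: (invsqrt_sum R N) => S HS.
rewrite mulrCA; have m0 : 0 <= M%:R :> R by [].
have : S * (sqn N.+1)^-1 <= 2 by rewrite ler_pdivrMr //; lra.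
by nra.
Qed.

(* [2 N L(1, chi)] dominates a sum of inverses of the integers coprime to [M],
   up to a bounded error, because [divisor_sum] is at least 1 at squares. *)
Lemma rchar_L1_lower_bound : exists N : nat, exists2 c0 : R, 0 < c0 &
  forall X, (N <= X)%N -> c0 <= \sum_(1 <= n < X.+1) chi n * n%:R^-1.
Proof.
(* The two hyperbola bounds cost 8 M + 2, the tail of the series beyond N costs 4 M after
   multiplication by 2 N; the remaining 1 gives the constant 1 / (2 N). *)
have [N HN] := coprime_harmonic_unbounded (12 * M%:R + 3 : R) M_gt0.
have N0 : (0 < N)%N.
  by rewrite lt0n; apply/eqP => z; move: HN; rewrite z big_geq //; have : 0 <= M%:R :> R by []; lra.
have n0 : 0 < N%:R :> R by rewrite ltr0n.
exists N, ((2 * N%:R)^-1); first by rewrite invr_gt0 mulr_gt0.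
move=> X NX; rewrite (big_cat_nat _ (n := N.+1)) //=.
have := divisor_sum_sqrt_ge N; rewrite divisor_sum_hyperbola [X in _ <= X](big_cat_nat _ (n := N.+1)) //=; last first.
  by rewrite ltnS; nia.
have := hyperbola_low N; have := hyperbola_high N.
have : `|\sum_(N.+1 <= i < X.+1) chi i * i%:R^-1| <= 2 * M%:R * N.+1%:R^-1.
  by apply: tail => i Ni; rewrite ?invr_ge0 ?ler0n // lef_pV2 ?posrE ?ltr0n ?ler_nat //; lia.
rewrite ler_norml => /andP [h1 _] h2 h3 h4.
have h5 : 2 * M%:R * N.+1%:R^-1 <= 2 * M%:R * N%:R^-1 :> R.
  by rewrite ler_wpM2l ?mulr_ge0 ?ler0n // lef_pV2 ?posrE ?ltr0n ?ler_nat.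
have h6 : (4 * M%:R + 1) / (2 * N%:R) <= \sum_(1 <= n < N.+1) chi n * n%:R^-1.
  by rewrite ler_pdivrMr ?mulr_gt0 //; lra.
have e : (4 * M%:R + 1) / (2 * N%:R) = 2 * M%:R * N%:R^-1 + (2 * N%:R)^-1 :> R.
  by field; rewrite gt_eqF.
rewrite e in h6; move: h1 h5 h6.
set u := _ / N.+1%:R; set v := _ / N%:R; set w := (2 * _)^-1; lra.
Qed.
End NonVanishing.

(** * Primes with prescribed signs *)

Section Dirichlet.
Import numFieldNormedType.Exports.
Local Open Scope classical_set_scope.

Section DirichletWeight.
Variables (R : realType) (dlt : R).
Hypothesis dlt_gt0 : 0 < dlt.

(** The series are taken at the real point 1 + [dlt]. The value at 0 is 0, so they may start at
    index 0. *)
Definition dweight (n : nat) : R := n%:R `^ (- (1 + dlt)).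

Lemma dweight0 : dweight 0 = 0.
Proof. by rewrite /dweight powR0 // oppr_eq0 gt_eqF // addr_gt0. Qed.

Lemma dweight1 : dweight 1 = 1.
Proof. by rewrite /dweight powR1. Qed.

Lemma dweightM m n : dweight (m * n)%N = dweight m * dweight n.
Proof. by rewrite /dweight natrM powRM ?ler0n. Qed.

Lemma dweight_ge0 n : 0 <= dweight n.
Proof. exact: powR_ge0. Qed.

Lemma dweightE n : (0 < n)%N -> dweight n = n%:R^-1 * expR (- (dlt * ln n%:R)).
Proof.
move=> n0; have n0' : n%:R != 0 :> R by rewrite pnatr_eq0 -lt0n.
rewrite /dweight opprD powRD ?n0' ?implybT // powR_inv1 ?ler0n // /powR (negbTE n0').
by rewrite mulNr.
Qed.

Lemma ln_nat_ge0 n : 0 <= ln n%:R :> R.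
Proof. by case: n => [|n]; [rewrite ln0 | rewrite ln_ge0 // ler1n]. Qed.

Lemma dweight_le n : (0 < n)%N -> dweight n <= n%:R^-1.
Proof.
move=> n0; rewrite dweightE // ler_piMr ?invr_ge0 ?ler0n // expR_le1 oppr_le0.
by rewrite mulr_ge0 ?ln_nat_ge0 // ltW.
Qed.

(** From exp(-x) >= 1 - x and ln n < n. The error does not depend on [n], so finite sums at the
    point 1 carry over to nearby points. *)
Lemma dweight_ge n : (0 < n)%N -> n%:R^-1 - dlt <= dweight n.
Proof.
move=> n0; rewrite dweightE //; have n0' : 0 < n%:R :> R by rewrite ltr0n.

apply: (le_trans (y := n%:R^-1 * (1 - dlt * ln n%:R))); last first.
  by rewrite ler_wpM2l ?invr_ge0 ?ler0n // expR_ge1Dx.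
rewrite mulrBr mulr1 lerD2l lerN2 mulrCA ler_piMr ?ltW //.
by rewrite mulrC ltr_pdivrMr // mul1r ln_sublinear.
Qed.

Lemma dweight_nincr n : (0 < n)%N -> dweight n.+1 <= dweight n.
Proof.
move=> n0; rewrite !dweightE //; apply: ler_pM; rewrite ?invr_ge0 ?expR_ge0 //.
  by rewrite lef_pV2 ?posrE ?ltr0n // ler_nat.
rewrite ler_expR lerN2 ler_wpM2l ?(ltW dlt_gt0) // ler_ln ?posrE ?ltr0n // ler_nat //.
Qed.

(** This is n^(-dlt), whose derivative is - dlt n^(-1-dlt): it plays the integral in the integral
    test. *)
Definition dweight_primitive (n : nat) : R := expR (- (dlt * ln n%:R)).

Lemma dweight_telescope n : (0 < n)%N ->
  dlt * dweight n.+1 <= dweight_primitive n - dweight_primitive n.+1.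
Proof.
move=> n0; rewrite dweightE // -/(dweight_primitive n.+1).
have E : dweight_primitive n = dweight_primitive n.+1 * expR (dlt * (ln n.+1%:R - ln n%:R)).
  by rewrite /dweight_primitive -expRD; congr expR; ring.
have h : n.+1%:R^-1 <= ln n.+1%:R - ln n%:R :> R.
  have n1 : 0 < n%:R :> R by rewrite ltr0n.
  have n2 : n.+1%:R = n%:R + 1 :> R by rewrite natr1.
  have h1 : -1 < - n.+1%:R^-1 :> R.
    by rewrite ltrN2 invf_lt1 ?ltr0n // ltr1n.
  have := le_ln1Dx h1.
  have -> : 1 + - n.+1%:R^-1 = n%:R / n.+1%:R :> R by rewrite -[n%:R](addrK 1) -n2 mulrBl mulfV ?pnatr_eq0 // mul1r.
  by rewrite ln_div ?posrE ?ltr0n // -lerN2 opprK opprB.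
rewrite E; set P := dweight_primitive _; set u := dlt * (_ - _).
rewrite -[X in _ - X]mulr1 -mulrBr mulrA [leLHS]mulrC ler_wpM2l ?expR_ge0 //.
apply: (le_trans (y := u)); first by rewrite ler_wpM2l ?(ltW dlt_gt0).
by rewrite lerBrDl expR_ge1Dx.
Qed.

Lemma dweight_tail a b : (0 < a)%N ->
  \sum_(a.+1 <= n < b) dweight n <= dlt^-1 * dweight_primitive a.
Proof.
move=> a0; have P0 n : 0 <= dweight_primitive n by exact: expR_ge0.
have [ba|ab] := leqP b a.+1.
  by rewrite big_geq // mulr_ge0 ?invr_ge0 // ltW.
rewrite mulrC ler_pdivlMr //.
have -> : b = b.-1.+1 by lia.
rewrite -[a.+1]addn1 -[b.-1.+1]addn1 big_addn addnK mulr_suml.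
apply: (le_trans (y := \sum_(a <= n < b.-1) (dweight_primitive n - dweight_primitive n.+1))).
  apply: ler_sum_nat => n /andP [an _]; rewrite mulrC addn1 dweight_telescope //; lia.
rewrite (@telescope_sumr_eq _ _ _ (fun i => - dweight_primitive i)); last 2 first.
- by lia.
- by move=> k _; ring.
by have := P0 b.-1; lra.
Qed.

Lemma dweight_primitive_cvg0 : dweight_primitive @ \oo --> (0 : R).
Proof.
apply/cvgrPdist_le => e e0.
exists (Num.bound (expR (- (ln e / dlt)))) => // n /= hn.
have n0 : (0 < n)%N.
  apply: leq_trans hn; rewrite -(ltr0n R); apply: le_lt_trans (archi_boundP _); last exact: expR_ge0.
  exact: expR_ge0.
rewrite sub0r normrN ger0_norm ?expR_ge0 // /dweight_primitive.
rewrite -[leRHS]lnK ?posrE // ler_expR lerNl.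
have : - (ln e / dlt) <= ln n%:R.
  rewrite -ler_expR lnK ?posrE ?ltr0n //.
  by apply: le_trans (ltW (archi_boundP (expR_ge0 _))) _; rewrite ler_nat.
by rewrite -mulNr ler_pdivrMr // mulrC.
Qed.
End DirichletWeight.

(** * Euler products by sieving *)

Section EulerProduct.
Variables (R : realType) (dlt : R) (f : nat -> R).
Hypothesis dlt_gt0 : 0 < dlt.
Hypothesis f1 : f 1 = 1.
Hypothesis fM : forall m n, f (m * n)%N = f m * f n.
Hypothesis f_le : forall n, `|f n| <= dweight dlt n.

Let f0 : f 0 = 0.
Proof. by apply/eqP; rewrite -normr_le0 -(dweight0 dlt_gt0). Qed.

Lemma dirichlet_series_cvg : cvgn (series f).
Proof.
apply: normed_cvg; apply: (@series_le_cvg _ _ (dweight dlt)) => [n|n|n|] /=; rewrite ?dweight_ge0 ?f_le //.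
apply: nondecreasing_is_cvgn.
  apply/nondecreasing_seqP => n; rewrite /series /= big_nat_recr //= lerDl.
  exact: dweight_ge0.
exists (dweight dlt 1 + dlt^-1 * dweight_primitive dlt 1) => _ [n _ <-] /=.
rewrite /series /=.
have [n2|n2] := leqP n 2.
  apply: (le_trans (y := \sum_(0 <= k < 2) dweight dlt k)).
    rewrite [X in _ <= X](big_cat_nat _ (n := n)) //= lerDl sumr_ge0 // => i _.
    exact: dweight_ge0.
  rewrite big_nat_recr //= big_nat1 dweight0 // add0r lerDl.
  by rewrite mulr_ge0 ?invr_ge0 ?(ltW dlt_gt0) // expR_ge0.
rewrite (big_cat_nat _ (n := 2)) //=; last exact: ltnW.
apply: lerD; last exact: dweight_tail.
by rewrite big_nat_recr //= big_nat1 dweight0 // add0r.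
Qed.

Let L := limn (series f).

Let primorial (y : nat) : nat := \prod_(1 <= p < y.+1 | prime p) p.
Let rough_sum y X := \sum_(1 <= n < X.+1 | coprime n (primorial y)) f n.

(** Removing the multiples of a new prime p multiplies the limit by 1 - f p: by complete
    multiplicativity they contribute f p times the previous sum taken up to X / p. *)
Lemma rough_sum_cvg y :
  rough_sum y X @[X --> \oo] --> L * \prod_(1 <= p < y.+1 | prime p) (1 - f p).
Proof.
elim: y => [|y IH].
  have -> : rough_sum 0 = fun X => series f X.+1.
    apply/funext => X; rewrite /rough_sum /primorial big_geq //= /series /=.
    rewrite [RHS]big_ltn // f0 add0r; apply: eq_bigl => n; exact: coprimen1.
  by rewrite big_geq // mulr1 (cvg_shiftS (series f)); exact: dirichlet_series_cvg.
rewrite big_mkcond big_nat_recr //= -big_mkcond /=.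
have primS : primorial y.+1 = (primorial y * if prime y.+1 then y.+1 else 1)%N.
  by rewrite /primorial big_mkcond big_nat_recr //= -big_mkcond.
case: ifP primS => py primS; last first.
  have -> : rough_sum y.+1 = rough_sum y; last by rewrite mulr1.
  by apply/funext => X; rewrite /rough_sum primS muln1.
have p0 : (0 < y.+1)%N by [].
have -> : rough_sum y.+1 = fun X => rough_sum y X - f y.+1 * rough_sum y (X %/ y.+1)%N.
  apply/funext => X; rewrite /rough_sum.
  rewrite [X in _ = X - _](bigID (fun n => y.+1 %| n)%N) /=.
  have -> : \sum_(1 <= n < X.+1 | coprime n (primorial y) && (y.+1 %| n)%N) f n =
     f y.+1 * \sum_(1 <= n < (X %/ y.+1).+1 | coprime n (primorial y)) f n.
    rewrite big_mkcondl /= sum_nat_dvdn // mulr_sumr [RHS]big_mkcond.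
    apply: eq_bigr => n _; rewrite coprimeMl.
    have -> : coprime y.+1 (primorial y).
      rewrite coprime_sym /primorial big_nat_cond; apply: (big_ind (fun m => coprime m y.+1)).
      - exact: coprime1n.
      - by move=> a b; rewrite coprimeMl => -> ->.
      move=> p /andP [/andP [p1 py1] pp]; rewrite prime_coprime // dvdn_prime2 //.
      by rewrite ltn_eqF.
    by rewrite /=; case: ifP => _; rewrite ?fM.
  rewrite addrAC subrr add0r; apply: eq_bigl => n.
  by rewrite primS coprimeMr [coprime n y.+1]coprime_sym (prime_coprime _ py).
rewrite mulrA mulrBr mulr1 [_ * f y.+1]mulrC; apply: cvgB => //.
apply: cvgM; first exact: cvg_cst.
apply: cvg_comp IH => A [n _ nA]; exists (n * y.+1)%N => // X /= nX; apply: nA => /=.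
by rewrite leq_divRL.
Qed.

(** An integer n > 1 coprime to all primes up to y exceeds y, so besides the term 1 only a tail of
    the series is left. *)
Lemma rough_sum_near1 y X : (0 < y)%N -> (0 < X)%N ->
  `|rough_sum y X - 1| <= dlt^-1 * dweight_primitive dlt y.
Proof.
move=> y0 X0; rewrite /rough_sum big_mkcond big_ltn // coprime1n f1 addrC addKr.
have small n : (1 < n)%N -> (n < y.+1)%N -> coprime n (primorial y) = false.
  move=> n1 ny; apply/negbTE/negP => c.
  have pp := pdiv_prime n1; have := pdiv_dvd n; have : (pdiv n %| primorial y)%N.
    rewrite /primorial big_mkcond (bigD1_seq (pdiv n)) ?iota_uniq /= ?pp ?dvdn_mulr //.
    rewrite mem_index_iota pdiv_gt0 /=; apply: leq_ltn_trans ny; exact: pdiv_leq (ltnW n1).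
  move=> d1 d2; have := dvdn_gcd (pdiv n) n (primorial y).
  by rewrite d1 d2 (eqP c) dvdn1 => /eqP e; move: pp; rewrite e.
have [Xy|yX] := leqP X y.
  rewrite big1_seq ?normr0 ?mulr_ge0 ?invr_ge0 ?(ltW dlt_gt0) ?expR_ge0 // => n.
  by rewrite mem_index_iota => /andP [_ /andP [n1 nX]]; rewrite small // (leq_trans nX).
rewrite (big_cat_nat _ (n := y.+1)) //=; last exact: ltnW.
rewrite [X in X + _]big1_seq ?add0r => [|n]; last first.
  by rewrite mem_index_iota => /andP [_ /andP [n1 nX]]; rewrite small.
apply: le_trans (ler_norm_sum _ _ _) _; apply: le_trans (dweight_tail dlt_gt0 X.+1 y0).
by apply: ler_sum => n _; case: ifP => _; rewrite ?f_le // normr0 dweight_ge0.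
Qed.

(** Stated without inverses, so that the limits for several characters can simply be multiplied. *)
Lemma euler_product_cvg :
  L * \prod_(1 <= p < y.+1 | prime p) (1 - f p) @[y --> \oo] --> (1 : R).
Proof.
have H0 : dlt^-1 * dweight_primitive dlt y @[y --> \oo] --> (0 : R).
  rewrite -[X in _ --> X](mulr0 dlt^-1); apply: cvgM; first exact: cvg_cst.
  exact: dweight_primitive_cvg0.
have H1 y : (0 < y)%N ->
    `|L * \prod_(1 <= p < y.+1 | prime p) (1 - f p) - 1| <= dlt^-1 * dweight_primitive dlt y.
  move=> y0; have H : `|rough_sum y X - 1| @[X --> \oo] -->
      `|L * \prod_(1 <= p < y.+1 | prime p) (1 - f p) - 1|.
    by apply: cvg_norm; apply: cvgB; [exact: rough_sum_cvg|exact: cvg_cst].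
  rewrite -(cvg_lim _ H) //; apply: limr_le; first by apply/cvg_ex; eexists; exact: H.
  by exists 1%N => // X /= X1; exact: rough_sum_near1.
apply/cvgrPdist_le => e e0; move/cvgrPdist_le: H0 => /(_ e e0) [n _ Hn].
exists n.+1 => // y /= ny; rewrite distrC; apply: le_trans (H1 y _) _; first by lia.
by have := Hn y (ltnW ny); rewrite sub0r normrN; apply: le_trans; exact: ler_norm.
Qed.
End EulerProduct.

Section DirichletL.
Variables (R : realType) (M : nat) (chi : nat -> R).
Hypotheses (M_gt0 : (0 < M)%N) (chiP : real_character M chi).

Definition dirichletL (dlt : R) : R := limn (series (fun n => chi n * dweight dlt n)).

Lemma dirichletL_term_le dlt n : `|chi n * dweight dlt n| <= dweight dlt n.
Proof.
rewrite normrM (ger0_norm (dweight_ge0 _ _)) ler_piMl ?dweight_ge0 //.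
exact: (rchar_norm chiP).
Qed.

Lemma dirichletL_cvg dlt : 0 < dlt -> cvgn (series (fun n => chi n * dweight dlt n)).
Proof. by move=> d0; apply: dirichlet_series_cvg d0 _; exact: dirichletL_term_le. Qed.

Lemma dirichletL_ge dlt (N : nat) (B : R) : 0 < dlt ->
  (forall X, (N <= X)%N -> B <= \sum_(1 <= n < X.+1) chi n * dweight dlt n) ->
  B <= dirichletL dlt.
Proof.
move=> d0 H; apply: limr_ge; first exact: dirichletL_cvg.
exists N.+1 => // -[//|X] /= NX; rewrite /series /= big_ltn // dweight0 // mulr0 add0r.
exact: H.
Qed.

Lemma dirichletL_le dlt (B : R) : 0 < dlt ->
  (forall X, \sum_(1 <= n < X.+1) chi n * dweight dlt n <= B) ->
  dirichletL dlt <= B.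
Proof.
move=> d0 H; apply: limr_le; first exact: dirichletL_cvg.
exists 1%N => // -[//|X] /= NX; rewrite /series /= big_ltn // dweight0 // mulr0 add0r.
exact: H.
Qed.

Lemma dirichletL_euler dlt : 0 < dlt ->
  dirichletL dlt * \prod_(1 <= p < y.+1 | prime p) (1 - chi p * dweight dlt p)
    @[y --> \oo] --> (1 : R).
Proof.
move=> d0; apply: euler_product_cvg d0 _ _ _.
- by rewrite (rchar1 chiP) dweight1 mul1r.
- by move=> m n; rewrite (rcharM chiP) dweightM; ring.
- exact: dirichletL_term_le.
Qed.

Lemma dirichletL_principal B : (forall n, chi n = (coprime n M)%:R) ->
  exists2 eta : R, 0 < eta & forall dlt, 0 < dlt -> dlt <= eta -> B <= dirichletL dlt.
Proof.
move=> chi1; have [N HN] := coprime_harmonic_unbounded (B + 1) M_gt0.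
(* Replacing 1 / k by [dweight dlt k] costs at most [dlt] for each k <= N, so at most 1 in all;
   hence the choice of [B + 1] above. *)
exists (N.+1%:R^-1); first by rewrite invr_gt0.
move=> dlt d0 dN; apply: (@dirichletL_ge dlt N) => // X NX.
rewrite (big_cat_nat _ (n := N.+1)) //=.
apply: ler_wpDr.
  by apply: sumr_ge0 => n _; rewrite chi1 mulr_ge0 ?dweight_ge0.
apply: (le_trans (y := \sum_(1 <= k < N.+1 | coprime k M) k%:R^-1 - \sum_(1 <= k < N.+1) dlt)).
  rewrite sumr_const_nat subn1 /= -mulr_natr.
  have : dlt * N%:R <= 1; last by lra.
  move: dN; rewrite -[N.+1%:R^-1]mul1r ler_pdivlMr // -natr1 mulrDr => ?.
  by lra.
rewrite big_mkcond -sumrB; apply: ler_sum_nat => k /andP [k1 _].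
rewrite chi1; case: (coprime k M); last by rewrite mul0r; lra.
by rewrite mul1r dweight_ge.
Qed.

Hypothesis chi_neq1 : exists2 a, coprime a M & chi a = -1.

Lemma dirichletL_upper dlt : 0 < dlt -> dirichletL dlt <= 2 * M%:R.
Proof.
move=> d0; apply: dirichletL_le => // X; apply: le_trans (ler_norm _) _.
have -> : 2 * M%:R = 2 * M%:R * dweight dlt 1 by rewrite dweight1 mulr1.
by apply: (rchar_tail_bound M_gt0 chiP chi_neq1) => i i1; rewrite ?dweight_ge0 ?dweight_nincr.
Qed.

(** Let c bound the partial sums of L(1, chi) from below. The tail beyond N' costs c / 4, as N' >= 8
    M / c, and the passage from 1 to 1 + [dlt] up to N' costs another c / 4; c / 2 is left. *)
Lemma dirichletL_lower : exists2 c : R, 0 < c &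
  exists2 eta : R, 0 < eta & forall dlt, 0 < dlt -> dlt <= eta -> c <= dirichletL dlt.
Proof.
have [N [c c0 Hc]] := rchar_L1_lower_bound M_gt0 chiP chi_neq1.
have m0 : 0 <= M%:R :> R by exact: ler0n.
pose N' := maxn N (Num.bound (8 * M%:R / c)).
exists (c / 2); first by rewrite divr_gt0.
exists (c / 4 / N'.+1%:R); first by rewrite !divr_gt0.
move=> dlt d0 dN; apply: (@dirichletL_ge dlt N') => // X NX.
rewrite (big_cat_nat _ (n := N'.+1)) //=.
have T : `|\sum_(N'.+1 <= n < X.+1) chi n * dweight dlt n| <= 2 * M%:R * dweight dlt N'.+1.
  by apply: (rchar_tail_bound M_gt0 chiP chi_neq1) => i i1; rewrite ?dweight_ge0 ?dweight_nincr //; lia.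
have T2 : 2 * M%:R * dweight dlt N'.+1 <= c / 4.
  apply: (le_trans (y := 2 * M%:R * N'.+1%:R^-1)).
    by rewrite ler_wpM2l ?dweight_le // mulr_ge0.
  rewrite ler_pdivrMr //; have : 8 * M%:R / c <= N'.+1%:R.
    apply: le_trans (ltW (archi_boundP _)) _; first by rewrite !mulr_ge0 // invr_ge0 ltW.
    by rewrite ler_nat; lia.
  by rewrite ler_pdivrMr //; lra.
have D : \sum_(1 <= n < N'.+1) chi n * n%:R^-1 - c / 4 <= \sum_(1 <= n < N'.+1) chi n * dweight dlt n.
  rewrite lerBlDr -lerBlDl -sumrB.
  apply: (le_trans (y := \sum_(1 <= n < N'.+1) dlt)).
    apply: ler_sum_nat => n /andP [n1 _]; rewrite -mulrBr; apply: le_trans (ler_norm _) _.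
    rewrite normrM; have h1 := dweight_le d0 n1; have h2 := dweight_ge d0 n1.
    rewrite [X in _ * X]ger0_norm ?subr_ge0 //.
    apply: (le_trans (y := 1 * (n%:R^-1 - dweight dlt n))); last by rewrite mul1r lerBlDr -lerBlDl.
    by rewrite ler_wpM2r ?subr_ge0 ?(rchar_norm chiP).
  rewrite sumr_const_nat subn1 /= -mulr_natr.
  move: dN; rewrite ler_pdivlMr // -natr1 mulrDr; lra.
have := Hc N' (leq_maxl _ _); move: T; rewrite ler_norml => /andP [? _]; lra.
Qed.
End DirichletL.

(** Symmetric difference with {i}. A subset indexes the product of its characters, and toggling [i]
    multiplies that product by the i-th character. *)
Definition toggle (I : finType) (i : I) (S : {set I}) : {set I} :=
  if i \in S then S :\ i else i |: S.

Lemma in_toggle (I : finType) (i x : I) (S : {set I}) :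
  (x \in toggle i S) = (x == i) (+) (x \in S).
Proof.
by rewrite /toggle; case: ifP => iS; rewrite !inE; have [->|] := eqVneq x i; rewrite ?iS.
Qed.

Lemma toggleK (I : finType) (i : I) : involutive (toggle i).
Proof. by move=> S; apply/finset.setP => x; rewrite !in_toggle addKb. Qed.

Lemma prod_toggle (I : finType) (i : I) (v : I -> int) (S : {set I}) : v i * v i = 1 ->
  \prod_(j in toggle i S) v j = v i * \prod_(j in S) v j.
Proof.
move=> vi; rewrite /toggle; case: (boolP (i \in S)) => iS.
  by rewrite [in RHS](big_setD1 i iS) /= mulrA vi mul1r.
by rewrite big_setU1.
Qed.

Lemma prod_sign (I : finType) (v : I -> int) (S : {set I}) :
  (forall i, v i = 1 \/ v i = -1) -> \prod_(j in S) v j = 1 \/ \prod_(j in S) v j = -1.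
Proof.
move=> vS; apply: (big_ind (fun x : int => x = 1 \/ x = -1)) => //; first by left.
by move=> x y [->|->] [->|->]; [left|right|right|left].
Qed.

(* A toggling that flips the sign of [e] and preserves that of [v] matches the
   factors on both sides. *)
Lemma prod_sign_balance (R : comRingType) (I : finType) (v e : I -> int) (F : int -> R) :
  (forall i, v i = 1 \/ v i = -1) -> (forall i, e i = 1 \/ e i = -1) ->
  (exists i, e i = -1) -> (exists i, v i <> e i) ->
  \prod_(S : {set I} | \prod_(j in S) e j == 1) F (\prod_(j in S) v j) =
  \prod_(S : {set I} | \prod_(j in S) e j != 1) F (\prod_(j in S) v j).
Proof.
move=> vS eS [i1 e1] [i0 ve].
have sq (u : I -> int) i : (forall i, u i = 1 \/ u i = -1) -> u i * u i = 1.
  by move=> /(_ i) [->|->].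
have [h hinv hve] : exists2 h : {set I} -> {set I}, involutive h & forall S,
    \prod_(j in h S) v j = \prod_(j in S) v j /\ \prod_(j in h S) e j = - \prod_(j in S) e j.
  have [v1|v1] := vS i1.
    exists (toggle i1); first exact: toggleK.
    by move=> S; rewrite !prod_toggle ?sq // v1 e1 mul1r mulN1r.
  have [[v0|v0] [e0|e0]] := (vS i0, eS i0); try by case: ve; rewrite v0 e0.
    exists (toggle i0); first exact: toggleK.
    by move=> S; rewrite !prod_toggle ?sq // v0 e0 mul1r mulN1r.
  have i01 : i0 != i1 by apply/eqP => E; move: e0; rewrite E e1.
  (* Here [v] is -1 at both indices while [e] is -1 at [i1] only: toggling both keeps the sign of
     [v] and flips that of [e]. *)
  exists (toggle i0 \o toggle i1) => [S|S] /=.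
    have comm A : toggle i0 (toggle i1 A) = toggle i1 (toggle i0 A).
      by apply/finset.setP => x; rewrite !in_toggle addbCA.
    by rewrite comm !toggleK.
  by rewrite !prod_toggle ?sq // v0 v1 e0 e1 !mulN1r opprK mul1r.
rewrite (reindex_inj (inv_inj hinv)); apply: eq_big => S; last by have [-> _] := hve S.
by have [_ ->] := hve S; have [->|->] := prod_sign S eS.
Qed.

Lemma cvgn_prod (R : realType) (J : finType) (P : pred J) (F : J -> nat -> R) :
  (forall j, P j -> F j y @[y --> \oo] --> (1 : R)) ->
  \prod_(j | P j) F j y @[y --> \oo] --> (1 : R).
Proof.
move=> H.
have -> : (fun y => \prod_(j | P j) F j y) = \big[(fun f g : nat -> R => f \* g)/(fun=> 1)]_(j | P j) F j.
  apply/funext => y.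
  by elim/big_rec2: _ => // j f g Pj ->.
elim/big_rec: _ => [|j f Pj cf]; first exact: cvg_cst.
by rewrite -[X in _ --> X](mulr1 1); apply: cvgM => //; exact: H.
Qed.

Lemma cvgn_unique (R : realType) (u : nat -> R) (a b : R) :
  u @ \oo --> a -> u @ \oo --> b -> a = b.
Proof. by move=> ua ub; rewrite -(cvg_lim _ ua) // -(cvg_lim _ ub). Qed.

Lemma finite_common_bound (R : realDomainType) (J : finType) (P : J -> R -> Prop) :
  (forall j, exists2 eta : R, 0 < eta & forall x, 0 < x -> x <= eta -> P j x) ->
  exists2 eta : R, 0 < eta & forall j, P j eta.
Proof.
move=> H; have [eta Heta] := choice (fun j => let: ex_intro2 x a b := H j in ex_intro _ x (conj a b)).
pose m := \big[Order.min/1]_j eta j.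
have m0 : 0 < m.
  by rewrite /m; elim/big_rec: _ => // j x _ x0; rewrite lt_min x0 andbT; case: (Heta j).
exists m => // j; have [_] := Heta j; apply => //.
by rewrite /m (bigD1 j) //= ge_min lexx.
Qed.

Section PrimesWithSigns.
Variables (R : realType) (I : finType) (M : nat) (psi : I -> nat -> int) (e : I -> int).
Hypothesis M_gt0 : (0 < M)%N.
Hypothesis psi1 : forall i, psi i 1 = 1.
Hypothesis psiM : forall i x y, psi i (x * y)%N = psi i x * psi i y.
Hypothesis psiD : forall i x, psi i (x + M)%N = psi i x.
Hypothesis psi_val : forall i x, coprime x M -> psi i x = 1 \/ psi i x = -1.
Hypothesis psi_indep : forall i, exists a,
  [/\ coprime a M, psi i a = -1 & forall j, j != i -> psi j a = 1].
Hypothesis e_val : forall i, e i = 1 \/ e i = -1.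
Hypothesis e_neg : exists i, e i = -1.

Let chi (S : {set I}) (n : nat) : R :=
  if coprime n M then (\prod_(i in S) psi i n)%:~R else 0.

Let chiP S : real_character M (chi S).
Proof.
split.
- by rewrite /chi coprime1n big1.
- move=> x y; rewrite /chi coprimeMl; case: (coprime x M); last by rewrite mul0r.
  case: (coprime y M); last by rewrite mulr0.
  by rewrite -intrM -big_split; under eq_bigr do rewrite psiM.
- move=> x; rewrite /chi; have -> : coprime (x + M) M = coprime x M.
    by rewrite /coprime gcdnC -{2}[M]mul1n addnC gcdnMDl gcdnC.
  by under eq_bigr do rewrite psiD.
- move=> x cx; rewrite /chi cx.
  have [->|->] := prod_sign S (fun i => @psi_val i x cx); first by left.
  by right; rewrite mulrN1z.
- by move=> x /negbTE cx; rewrite /chi cx.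
Qed.

(** Independence gives a residue at which exactly one factor of the product is -1. *)
Let chi_neq1 S : S != finset.set0 -> exists2 a, coprime a M & chi S a = -1.
Proof.
move=> /finset.set0Pn [i iS]; have [a [ca pa pj]] := psi_indep i.
exists a => //; rewrite /chi ca (big_setD1 i iS) /= pa big1 => [|j]; first by rewrite mulr1 mulrN1z.
by rewrite !inE => /andP [ji _]; exact: pj.
Qed.

(* Otherwise the Euler factors of the [L]-functions balance at every prime, and so
   the two products of [L]-functions below are equal; but as the exponent tends to
   1 the left one, which contains the principal character, is unbounded. *)
Theorem prime_with_signs : exists q, [/\ prime q, coprime q M & forall i, psi i q = e i].
Proof.
apply: contrapT => none.
pose eS (S : {set I}) := \prod_(j in S) e j.
pose L S dlt := dirichletL (chi S) dlt.
have bal dlt : 0 < dlt -> \prod_(S | eS S == 1) L S dlt = \prod_(S | eS S != 1) L S dlt.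
  move=> d0; pose E S y := \prod_(1 <= p < y.+1 | prime p) (1 - chi S p * dweight dlt p).
  have cv (P : pred {set I}) : (\prod_(S | P S) L S dlt) * (\prod_(S | P S) E S y) @[y --> \oo] --> (1 : R).
    under eq_fun do rewrite -big_split.
    by apply: cvgn_prod => S _; exact: dirichletL_euler (chiP S) _ d0.
  have EE y : \prod_(S | eS S == 1) E S y = \prod_(S | eS S != 1) E S y.
    rewrite /E exchange_big [RHS]exchange_big; apply: eq_bigr => p pp.
    have [cp|cp] := boolP (coprime p M); last first.
      by rewrite !big1 // => S _; rewrite /chi (negbTE cp) mul0r subr0.
    under eq_bigr do rewrite /chi cp; under [RHS]eq_bigr do rewrite /chi cp.
    apply: (@prod_sign_balance R I (psi ^~ p) e (fun z => 1 - z%:~R * dweight dlt p)) => //.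
      by move=> i; exact: psi_val.
    apply: contrapT => H; apply: none; exists p; split=> // i.
    by apply: contrapT => ne; apply: H; exists i.
  (* If F is the common product of the Euler factors up to y, then P F and Q F tend to 1, so P Q F
     tends both to P and to Q. *)
  set P := \prod_(S | eS S == 1) _; set Q := \prod_(S | eS S != 1) _.
  have := cvgM (cv (fun S => eS S == 1)) (cvg_cst Q).
  have := cvgM (cv (fun S => eS S != 1)) (cvg_cst P).
  rewrite !mul1r => /(_ _ _) h1 /(_ _ _) h2; apply: (cvgn_unique h1).
  apply: cvg_trans h2; apply: near_eq_cvg; near=> y.
  by rewrite /= -EE -/P -/Q; ring.
have low S : S != finset.set0 -> exists2 c : R, 0 < c &
    exists2 eta : R, 0 < eta & forall dlt, 0 < dlt -> dlt <= eta -> c <= L S dlt.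
  by move=> S0; exact: dirichletL_lower M_gt0 (chiP S) (chi_neq1 S0).
pose lowP (S : {set I}) (c : R) := 0 < c /\ (S != finset.set0 ->
    exists2 eta : R, 0 < eta & forall dlt, 0 < dlt -> dlt <= eta -> c <= L S dlt).
have /choice [c Hc] : forall S, exists c, lowP S c.
  move=> S; have [->|S0] := eqVneq S finset.set0; first by exists 1; split; rewrite ?eqxx.
  by have [x x0 Hx] := low S S0; exists x.
pose K := \prod_(S : {set I} | (eS S == 1) && (S != finset.set0)) c S.
have K0 : 0 < K by apply: prodr_gt0 => S _; case: (Hc S).
pose B := \prod_(S : {set I} | eS S != 1) (2 * M%:R : R).
(* [B] bounds the right product from above and [K] the nonprincipal factors of the left one from
   below; with the principal factor at least (B + 1) / K the left product exceeds [B]. *)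
pose Bd (S : {set I}) := if S == finset.set0 then (B + 1) / K else c S.
have [dlt d0 Hd] : exists2 dlt : R, 0 < dlt & forall S, 0 < dlt -> Bd S <= L S dlt.
  apply: (@finite_common_bound R _ (fun S x => 0 < x -> Bd S <= L S x)) => S; rewrite /Bd.
  have [->|S0] := eqVneq S finset.set0.
    have [n|eta e0 He] := @dirichletL_principal _ _ _ M_gt0 (chiP finset.set0) ((B + 1) / K).
      by rewrite /chi big_set0; case: (coprime n M).
    by exists eta => // x x0 xe _; exact: He.
  have [_ /(_ S0) [eta e0 He]] := Hc S; exists eta => // x x0 xe _; exact: He.
have := bal dlt d0; apply/eqP; rewrite gt_eqF //.
apply: (@le_lt_trans _ _ B).
  apply: ler_prod => S eS1; have S0 : S != finset.set0.
    by apply: contra eS1 => /eqP ->; rewrite /eS big_set0.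
  have := Hd S d0; rewrite /Bd (negbTE S0) => HS; have [cS _] := Hc S.
  rewrite (le_trans (ltW cS) HS) /=.
  exact: dirichletL_upper M_gt0 (chiP S) (chi_neq1 S0) _ d0.
apply: (@lt_le_trans _ _ (B + 1)); first by rewrite ltrDl.
rewrite (bigD1 finset.set0) /=; last by rewrite /eS big_set0.
have H0 := Hd finset.set0 d0; rewrite /Bd eqxx in H0.
have HK : K <= \prod_(S : {set I} | (eS S == 1) && (S != finset.set0)) L S dlt.
  apply: ler_prod => S /andP [_ S0]; have [cS _] := Hc S; rewrite (ltW cS) /=.
  by have := Hd S d0; rewrite /Bd (negbTE S0).
have B0 : 0 <= B by apply: prodr_ge0 => S _; rewrite mulr_ge0.
have L0 : 0 <= L finset.set0 dlt by apply: le_trans H0; rewrite divr_ge0 ?addr_ge0 // ltW.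
by rewrite ler_pdivrMr // in H0; apply: le_trans H0 _; exact: ler_wpM2l.
Unshelve. all: by end_near.
Qed.
End PrimesWithSigns.

End Dirichlet.

(** * Legendre symbols and reciprocity *)

(** Euler's criterion taken as the definition, which makes multiplicativity immediate;
    [legendre_sqrt] recovers the square root. *)
Definition legendre (p : nat) (n : int) : int :=
  let x := n%:~R : 'F_p in if x == 0 then 0 else if x ^+ p.-1./2 == 1 then 1 else -1.

Lemma finField_generator (F : finFieldType) : exists g : F, (#|F|.-1).-primitive_root g.
Proof.
have F1 := finNzRing_gt1 F.
have : has (#|F|.-1).-primitive_root [seq x <- enum F | x != 0].
  apply: has_prim_root; first by rewrite -subn1 subn_gt0.
  - apply/allP => x; rewrite mem_filter => /andP [x0 _]; apply/unity_rootP.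
    by apply: (mulfI x0); rewrite -exprS prednK ?(ltn_trans _ F1) // mulr1 expf_card.
  - exact/filter_uniq/enum_uniq.
  - rewrite size_filter -(leq_add2l (count (pred1 (0 : F)) (enum F))).
    rewrite count_predC -cardE count_uniq_mem ?enum_uniq // mem_enum /=.
    by rewrite add1n prednK // (ltn_trans _ F1).
by case/hasP => g _ gp; exists g.
Qed.

Lemma intr_pchar_eq0 (F : fieldType) (p : nat) (n : int) : p \in [pchar F] ->
  (n%:~R == 0 :> F) = (p %| n)%Z.
Proof.
move=> pF; case: n => n; first by rewrite -pmulrn -(dvdn_pcharf pF).
by rewrite NegzE mulrNz oppr_eq0 -pmulrn -(dvdn_pcharf pF) dvdzE abszN.
Qed.

Definition sign0 (z : int) := z \in [:: 0; 1; -1].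

(** Two such values differ by at most 2, less than p. Identities between symbols can thus be checked
    in any field of characteristic p. *)
Lemma sign0_inj (F : fieldType) (p : nat) (z t : int) : p \in [pchar F] -> odd p ->
  sign0 z -> sign0 t -> z%:~R = t%:~R :> F -> z = t.
Proof.
move=> pF p_odd; have p_prime := pcharf_prime pF.
have p2 : (2 < p)%N by have := prime_gt1 p_prime; move: p_odd; case: (p) => [|[|[|]]].
move=> sz st /eqP; rewrite -subr_eq0 -intrB (intr_pchar_eq0 _ pF) dvdzE /= => d.
apply/eqP; rewrite -subr_eq0 -absz_eq0; move: d; apply: contraTT; rewrite -lt0n => n0.
rewrite gtnNdvd //; apply: leq_trans p2; rewrite ltnS.
by move: sz st; rewrite /sign0 !inE => /or3P [] /eqP -> /or3P [] /eqP ->.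
Qed.

Section Legendre.
Variables (p : nat).
Hypotheses (p_prime : prime p) (p_odd : odd p).

Let F_card : #|'F_p| = p. Proof. by rewrite card_Fp. Qed.

Lemma half_pred_double : (p.-1./2 + p.-1./2 = p.-1)%N.
Proof. by have := odd_double_half p.-1; have := prime_gt0 p_prime; move: p_odd; lia. Qed.

Lemma Fp_fermat (x : 'F_p) : x != 0 -> x ^+ p.-1 = 1.
Proof.
move=> x0; apply: (mulfI x0); rewrite -exprS prednK ?prime_gt0 // mulr1.
by have := expf_card x; rewrite F_card.
Qed.

Lemma Fp_half_expr (x : 'F_p) : x != 0 -> x ^+ p.-1./2 = 1 \/ x ^+ p.-1./2 = -1.
Proof.
move=> /Fp_fermat H; have : (x ^+ p.-1./2) ^+ 2 == 1.
  by rewrite -exprM muln2 -addnn half_pred_double H.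
rewrite sqrf_eq1; by case/orP => /eqP; [left|right].
Qed.

Lemma intr_Fp_eq0 (n : int) : (n%:~R == 0 :> 'F_p) = (p %| n)%Z.
Proof. exact: intr_pchar_eq0 (pchar_Fp p_prime). Qed.

Lemma legendreE (n : int) : ((legendre p n)%:~R : 'F_p) = n%:~R ^+ p.-1./2.
Proof.
rewrite /legendre; have h0 : (0 < p.-1./2)%N.
  by have := half_pred_double; have := prime_gt1 p_prime; lia.
have [->|n0] := eqVneq (n%:~R : 'F_p) 0; first by rewrite expr0n gtn_eqF.
by case: eqP => [->//|ne]; have [|->] := Fp_half_expr n0.
Qed.

Lemma legendre_sign0 n : sign0 (legendre p n).
Proof. by rewrite /legendre; case: ifP => // _; case: ifP. Qed.

Lemma legendre_eq0 n : (legendre p n == 0) = (p %| n)%Z.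
Proof. by rewrite /legendre intr_Fp_eq0; case: ifP => // _; case: ifP. Qed.

Lemma legendreM m n : legendre p (m * n) = legendre p m * legendre p n.
Proof.
apply: (sign0_inj (pchar_Fp p_prime) p_odd); first exact: legendre_sign0.
  have := legendre_sign0 m; have := legendre_sign0 n; rewrite /sign0 !inE.
  by do 2![case/or3P => /eqP ->].
by rewrite intrM !legendreE intrM exprMn.
Qed.

Lemma legendre1 : legendre p 1 = 1.
Proof. by rewrite /legendre oner_eq0 expr1n eqxx. Qed.

Lemma legendre_eqmod (m n : int) : (p %| m - n)%Z -> legendre p m = legendre p n.
Proof. by rewrite -intr_Fp_eq0 intrB subr_eq0 /legendre => /eqP ->. Qed.

Lemma legendre_val n : ~~ (p %| n)%Z -> legendre p n = 1 \/ legendre p n = -1.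
Proof.
rewrite -legendre_eq0; have := legendre_sign0 n; rewrite /sign0 !inE.
by case/or3P => /eqP ->; [|left|right].
Qed.

Lemma legendre_sqr n : ~~ (p %| n)%Z -> legendre p (n ^+ 2) = 1.
Proof. by move=> /legendre_val; rewrite expr2 legendreM => -[->|->]. Qed.

Lemma Fp_generator : exists g : 'F_p, (p.-1).-primitive_root g.
Proof. by have := finField_generator 'F_p; rewrite F_card. Qed.

(** Write n = g^i for a generator g: since n^((p-1)/2) = 1, the exponent i is even. *)
Lemma legendre_sqrt n : legendre p n = 1 -> exists t : int, (p %| t ^+ 2 - n)%Z.
Proof.
move=> l1; have [g gp] := Fp_generator.
have n0 : n%:~R != 0 :> 'F_p by rewrite intr_Fp_eq0 -legendre_eq0 l1.
have nh : n%:~R ^+ p.-1./2 = 1 :> 'F_p by rewrite -legendreE l1.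
have [i iE] := prim_rootP gp (Fp_fermat n0).
have h0 : (0 < p.-1./2)%N.
  by have := half_pred_double; have := prime_gt1 p_prime; lia.
have /dvdnP [k kE] : (2 %| i)%N.
  move/eqP: nh; rewrite iE -exprM -(prim_order_dvd gp) -{1}half_pred_double addnn -mul2n.
  by rewrite dvdn_pmul2r.
exists (nat_of_ord (g ^+ k)); rewrite -intr_Fp_eq0 intrB subr_eq0 iE kE exprM rmorphXn /=.
by rewrite -pmulrn natr_Zp.
Qed.

Lemma legendre_nonresidue : exists n : nat, legendre p n = -1.
Proof.
have [g gp] := Fp_generator; exists (nat_of_ord g).
have gE : (nat_of_ord g)%:~R = g by rewrite -pmulrn natr_Zp.
have h0 : (0 < p.-1./2)%N.
  by have := half_pred_double; have := prime_gt1 p_prime; lia.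
rewrite /legendre gE; have [g0|_] := eqVneq g 0.
  have := prim_expr_order gp; rewrite g0 expr0n; have := prime_gt1 p_prime.
  by case: (p) => [|[|q]] //= _ /eqP; rewrite eq_sym oner_eq0.
by rewrite -(prim_order_dvd gp) gtnNdvd //; have := half_pred_double; lia.
Qed.

Lemma legendreN1 : legendre p (-1) = (-1) ^+ p.-1./2.
Proof.
apply: (sign0_inj (pchar_Fp p_prime) p_odd); first exact: legendre_sign0.
  by rewrite -signr_odd; case: odd.
by rewrite legendreE rmorphXn.
Qed.
End Legendre.

(** In the field with p^totient(n) elements, Euler's theorem makes n divide the order of the cyclic
    multiplicative group. *)
Lemma exists_prim_root_pchar (p n : nat) : prime p -> (1 < n)%N -> coprime p n ->
  exists F : finFieldType, p \in [pchar F] /\ exists z : F, n.-primitive_root z.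
Proof.
move=> pp n1 cpn; have t0 : (0 < totient n)%N by rewrite totient_gt0 ltnW.
have [F pF cF] := PrimePowerField pp t0.
exists F; split=> //; have [g] := finField_generator F; rewrite cF => gp.
exists (g ^+ ((p ^ totient n).-1 %/ n)); apply: (dvdn_prim_root gp).
have := Euler_exp_totient cpn => /eqP.
by rewrite eqn_mod_dvd ?subn1 // expn_gt0 prime_gt0.
Qed.

Lemma pFrobenius_sum (F : fieldType) (p : nat) (J : finType) (f : J -> F) : p \in [pchar F] ->
  (\sum_j f j) ^+ p = \sum_j f j ^+ p.
Proof.
move=> pF; rewrite -(pFrobenius_autE pF).
by rewrite (rmorph_sum (pFrobenius_aut pF)).
Qed.

(** * Quadratic Gauss sums in characteristic p *)

Section GaussSum.
Variables (p q : nat) (F : fieldType) (z : F).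
Hypotheses (q_prime : prime q) (q_odd : odd q) (pF : p \in [pchar F]) (p_odd : odd p).
Hypothesis z_prim : q.-primitive_root z.
Hypothesis pq : p != q.

Let p_prime : prime p := pcharf_prime pF.
Let chi (a : 'F_q) : int := legendre q (nat_of_ord a)%:Z.
Let zeta (a : 'F_q) : F := z ^+ (nat_of_ord a).

Let val_Fq (n : nat) : nat_of_ord (n%:R : 'F_q) = (n %% q)%N.
Proof. by rewrite val_Fp_nat. Qed.

Let legendre_modn (n : nat) : legendre q (n %% q)%N%:Z = legendre q n%:Z.
Proof.
by apply: legendre_eqmod => //; rewrite -(intr_Fp_eq0 q_prime) intrB -!pmulrn Fp_nat_mod ?subrr.
Qed.

Let chi_nat (n : nat) : chi n%:R = legendre q n%:Z.
Proof. by rewrite /chi val_Fq legendre_modn. Qed.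

Let chiM a b : chi (a * b) = chi a * chi b.
Proof. by rewrite -(natr_Zp a) -(natr_Zp b) -natrM !chi_nat PoszM legendreM. Qed.

Let zeta_nat (n : nat) : zeta n%:R = z ^+ n.
Proof. by rewrite /zeta val_Fq (prim_expr_mod z_prim). Qed.

Let zeta0 : zeta 0 = 1.
Proof. by rewrite /zeta expr0. Qed.

Let zetaD a b : zeta (a + b) = zeta a * zeta b.
Proof. by rewrite -(natr_Zp a) -(natr_Zp b) -natrD !zeta_nat exprD. Qed.

Let chi0 : chi 0 = 0.
Proof. by apply/eqP; rewrite /chi legendre_eq0. Qed.

Let chi_sqr a : a != 0 -> chi a * chi a = 1.
Proof.
move=> a0; rewrite /chi; have [|->|->] // := @legendre_val q q_prime (nat_of_ord a)%:Z.
by rewrite -(intr_Fp_eq0 q_prime) -pmulrn natr_Zp.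
Qed.

Let sum_chi : \sum_(a : 'F_q) chi a = 0.
Proof.
have [n ln] := legendre_nonresidue q_prime q_odd.
have n0 : (n%:R : 'F_q) != 0.
  by apply/eqP => e; have := chi_nat n; rewrite e ln chi0.
have : \sum_a chi a = - \sum_a chi a.
  rewrite {1}(reindex_inj (mulfI n0)) -mulN1r mulr_sumr; apply: eq_bigr => a _.
  by rewrite chiM chi_nat ln.
move: (\sum_a _) => x; lia.
Qed.

Let sum_zeta c : \sum_(a : 'F_q) zeta (a * c) = (q * (c == 0))%:R.
Proof.
have [->|c0] := eqVneq c 0.
  under eq_bigr do rewrite mulr0 zeta0.
  by rewrite sumr_const card_Fp // muln1.
rewrite muln0; have -> : \sum_a zeta (a * c) = \sum_a zeta a by rewrite [RHS](reindex_inj (mulIf c0)).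
have z1 : z - 1 != 0.
  rewrite subr_eq0 -[z]expr1 -(prim_order_dvd z_prim) dvdn1.
  by rewrite gtn_eqF // prime_gt1.
apply: (mulfI z1); rewrite mulr0 mulrBl mul1r; apply/eqP; rewrite subr_eq0; apply/eqP.
rewrite [RHS](reindex_inj (@addrI _ 1)) mulr_sumr; apply: eq_bigr => a _.
by rewrite zetaD -[X in zeta X * _]/(1%:R) zeta_nat expr1.
Qed.

Let G := \sum_(a : 'F_q) (chi a)%:~R * zeta a.

(** Substituting b -> a b in the double sum, the sum over a != 0 becomes q - 1 for b = -1 and -1
    otherwise; the -1 disappear because the symbols add up to 0. *)
Lemma gauss_sum_sqr : G ^+ 2 = (legendre q (-1))%:~R * q%:R.
Proof.
transitivity (\sum_(b : 'F_q) (chi b)%:~R * \sum_(a : 'F_q | a != 0) zeta (a * (1 + b))).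
  rewrite expr2 {1}/G (bigD1 0) //= chi0 mulr0z mul0r add0r mulr_suml.
  under [RHS]eq_bigr do rewrite mulr_sumr.
  rewrite [RHS]exchange_big; apply: eq_bigr => a a0 /=.
  rewrite /G (reindex_inj (mulfI a0)) mulr_sumr; apply: eq_bigr => b _.
  rewrite mulrDr mulr1 zetaD chiM intrM.
  have cc : (chi a)%:~R * (chi a)%:~R = 1 :> F.
    by rewrite -intrM chi_sqr.
  rewrite -[RHS]mul1r -[X in _ = X * _]cc; ring.
under eq_bigr => b _.
  have -> : \sum_(a : 'F_q | a != 0) zeta (a * (1 + b)) = (q * (1 + b == 0))%:R - 1.
    by rewrite -sum_zeta [in RHS](bigD1 0) //= mul0r zeta0 addrAC subrr add0r.
  rewrite mulrBr mulr1; over.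
rewrite sumrB -(raddf_sum (intmul (1 : F))) /= sum_chi subr0.
rewrite (bigD1 (-1)) //= subrr eqxx muln1 big1 ?addr0 => [|b b1]; last first.
  by rewrite addrC addr_eq0 (negbTE b1) muln0 mulr0.
congr (_%:~R * _); rewrite /chi; apply: legendre_eqmod => //.
by rewrite -(intr_Fp_eq0 q_prime) intrB -pmulrn natr_Zp subrr.
Qed.

(** Frobenius fixes the symbols and turns zeta(a) into zeta(p a); reindexing by p brings out the
    symbol of p. *)
Lemma gauss_sum_frobenius : G ^+ p = (legendre q p%:Z)%:~R * G.
Proof.
have p0 : (p%:R : 'F_q) != 0.
  by rewrite -(dvdn_pcharf (pchar_Fp q_prime)) dvdn_prime2 // eq_sym.
have cc := chi_sqr p0.
rewrite [in LHS]/G pFrobenius_sum // /G [in RHS](reindex_inj (mulfI p0)) mulr_sumr.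
apply: eq_bigr => a _; rewrite exprMn -chi_nat chiM.
have -> : zeta a ^+ p = zeta (p%:R * a).
  by rewrite -{2}(natr_Zp a) -natrM zeta_nat mulnC exprM.
have -> : (chi a)%:~R ^+ p = (chi a)%:~R :> F.
  have := legendre_sign0 q (nat_of_ord a)%:Z; rewrite -/(chi a) /sign0 !inE.
  case/or3P => /eqP ->; rewrite ?mulr1z ?expr1n ?mulrN1z //.
    by rewrite mulr0z expr0n gtn_eqF // prime_gt0.
  by rewrite -signr_odd p_odd.
by rewrite intrM mulrA mulrA -intrM cc mul1r.
Qed.

(** For q = 1 mod 4 the sum G is a square root of q, so G^p = q^((p-1)/2) G, to be compared with
    Frobenius. *)
Lemma quadratic_reciprocity_pchar : (q %% 4 = 1)%N -> legendre p q%:Z = legendre q p%:Z.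
Proof.
move=> q4; apply: (sign0_inj pF p_odd); try exact: legendre_sign0.
have q0 : q%:R != 0 :> F by rewrite -(dvdn_pcharf pF) dvdn_prime2.
have GG : G ^+ 2 = q%:R.
  rewrite gauss_sum_sqr legendreN1 // -signr_odd.
  have -> : odd q.-1./2 = false by lia.
  by rewrite expr0 mul1r.
have G0 : G != 0 by apply: contraNneq q0 => G0; rewrite -GG G0 expr0n.
have E : (legendre p q%:Z)%:~R = q%:R ^+ p.-1./2 :> F.
  have : (legendre p q%:Z - q%:Z ^+ p.-1./2)%:~R == 0 :> 'F_p.
    by rewrite intrB subr_eq0 legendreE // rmorphXn.
  rewrite (intr_Fp_eq0 p_prime) -(intr_pchar_eq0 _ pF) intrB subr_eq0 => /eqP ->.
  by rewrite rmorphXn /= -pmulrn.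
apply: (mulIf G0); rewrite -gauss_sum_frobenius E -GG -exprM mul2n -addnn half_pred_double //.
by rewrite -exprSr prednK // prime_gt0.
Qed.
End GaussSum.

Theorem quadratic_reciprocity_1mod4 (p q : nat) : prime p -> prime q -> odd p -> p != q ->
  (q %% 4 = 1)%N -> legendre p q%:Z = legendre q p%:Z.
Proof.
move=> pp pq op npq q4; have oq : odd q by lia.
have cpq : coprime p q by rewrite prime_coprime // dvdn_prime2.
have [F [pF [z zp]]] := exists_prim_root_pchar pp (prime_gt1 pq) cpq.
exact: (@quadratic_reciprocity_pchar p q F z).
Qed.

Definition chi8 (n : nat) : int :=
  if ~~ odd n then 0 else if (n %% 8 \in [:: 1; 7])%N then 1 else -1.

(** The same argument with G = z + z^-1 for a primitive eighth root of unity z, a square root of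
    2. *)
Theorem legendre2 (p : nat) : prime p -> odd p -> legendre p 2 = chi8 p.
Proof.
move=> pp op; have cp8 : coprime p 8 by rewrite coprime_sym (@coprimeXl 3 2) // coprime2n.
have [F [pF [z zp]]] := exists_prim_root_pchar pp (isT : 1 < 8)%N cp8.
apply: (sign0_inj pF op); first exact: legendre_sign0.
  by rewrite /chi8 op /=; case: ifP.
have z4 : z ^+ 4 = -1.
  have := prim_expr_order zp; rewrite -[8%N]/(4 * 2)%N exprM => /eqP.
  rewrite sqrf_eq1 => /orP [|/eqP //].
  by rewrite -(prim_order_dvd zp).
have z8 := prim_expr_order zp.
have z0 : z != 0 by apply: contra_eq_neq z4 => ->; rewrite expr0n eq_sym oppr_eq0 oner_eq0.
pose G := z + z ^+ 7.
have GG : G ^+ 2 = 2%:R.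
  have -> : G ^+ 2 = z ^+ 2 + 2 * z ^+ 8 + z ^+ 8 * z ^+ 4 * z ^+ 2 by rewrite /G; ring.
  by rewrite z8 z4; ring.
have n2 : 2%:R != 0 :> F.
  by rewrite -(dvdn_pcharf pF) dvdn_prime2 //; apply: contraL op => /eqP ->.
have G0 : G != 0 by apply: contraNneq n2 => G0; rewrite -GG G0 expr0n.
have Gp : G ^+ p = (chi8 p)%:~R * G.
  rewrite /G -(pFrobenius_autE pF) rmorphD /= !pFrobenius_autE -exprM mulnC exprM.
  have -> : z ^+ p = z ^+ (p %% 8) by rewrite (prim_expr_mod zp).
  rewrite /chi8 op /=; have := ltn_pmod p (isT : 0 < 8)%N.
  have : odd (p %% 8) by lia.
  case: (p %% 8)%N => [|[|[|[|[|[|[|[|//]]]]]]]] //= _ _; rewrite ?mulr1z ?mulrN1z ?mul1r ?mulN1r.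
  - by [].
  - have -> : (z ^+ 3) ^+ 7 = z ^+ 8 * z ^+ 8 * z ^+ 4 * z by ring.
    have -> : z ^+ 7 = z ^+ 4 * z ^+ 3 by ring.
    rewrite z8 z4; ring.
  - have -> : (z ^+ 5) ^+ 7 = z ^+ 8 * z ^+ 8 * z ^+ 8 * z ^+ 8 * z ^+ 3 by ring.
    have -> : z ^+ 7 = z ^+ 4 * z ^+ 3 by ring.
    have -> : z ^+ 5 = z ^+ 4 * z by ring.
    rewrite z8 z4; ring.
  - have -> : (z ^+ 7) ^+ 7 = z ^+ 8 * z ^+ 8 * z ^+ 8 * z ^+ 8 * z ^+ 8 * z ^+ 8 * z by ring.
    rewrite z8; ring.
have E : (legendre p 2)%:~R = 2%:R ^+ p.-1./2 :> F.
  have : (legendre p 2 - 2 ^+ p.-1./2)%:~R == 0 :> 'F_p.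
    by rewrite intrB subr_eq0 legendreE // rmorphXn.
  rewrite (intr_Fp_eq0 pp) -(intr_pchar_eq0 _ pF) intrB subr_eq0 => /eqP ->.
  by rewrite rmorphXn.
apply: (mulIf G0); rewrite -Gp E -GG -exprM mul2n -addnn half_pred_double //.
by rewrite -exprSr prednK // prime_gt0.
Qed.

Definition chi4 (n : nat) : int := if ~~ odd n then 0 else if (n %% 4 == 1)%N then 1 else -1.

Lemma chi4_mod n : chi4 (n %% 8) = chi4 n.
Proof.
rewrite /chi4; have -> : odd (n %% 8) = odd n by lia.
by have -> : ((n %% 8) %% 4 = n %% 4)%N by lia.
Qed.

Lemma chi8_mod n : chi8 (n %% 8) = chi8 n.
Proof. by rewrite /chi8 modn_mod; have -> : odd (n %% 8) = odd n by lia. Qed.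

Lemma mod8_morph (f : nat -> int) : (forall n, f (n %% 8)%N = f n) ->
  all (fun i => all (fun j => f (i * j)%N == f i * f j) (iota 0 8)) (iota 0 8) ->
  forall m n, f (m * n)%N = f m * f n.
Proof.
move=> fmod /allP H m n; rewrite -(fmod m) -(fmod n) -(fmod (m * n)%N) -modnMm fmod.
have lt8 k : (k %% 8)%N \in iota 0 8 by rewrite mem_iota ltn_pmod.
by have /allP/(_ _ (lt8 n))/eqP := H _ (lt8 m).
Qed.

Lemma chi4M m n : chi4 (m * n)%N = chi4 m * chi4 n.
Proof. by apply: mod8_morph; [exact: chi4_mod|vm_compute]. Qed.

Lemma chi8M m n : chi8 (m * n)%N = chi8 m * chi8 n.
Proof. by apply: mod8_morph; [exact: chi8_mod|vm_compute]. Qed.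

Lemma chi4_val n : odd n -> chi4 n = 1 \/ chi4 n = -1.
Proof. by move=> n1; rewrite /chi4 n1; case: ifP; [left|right]. Qed.

Lemma chi8_val n : odd n -> chi8 n = 1 \/ chi8 n = -1.
Proof. by move=> n1; rewrite /chi8 n1; case: ifP; [left|right]. Qed.

(* The index 4 or 8 stands for a character modulo 8, an odd prime for its
   Legendre symbol. *)
Definition qchar (k n : nat) : int :=
  if k == 4%N then chi4 n else if k == 8%N then chi8 n else legendre k n.

Lemma exists_odd_prime_notin (ps : seq nat) : exists l, [/\ prime l, odd l & l \notin ps].
Proof.
have [l ll pl] := prime_above (\sum_(p <- ps) p).+2.
exists l; split => //; first by case: (even_prime pl) ll => // ->.
by apply/negP => lps; move: ll; rewrite (big_rem l lps) /=; lia.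
Qed.

Lemma coprime_mod1 a m : a = 1 %[mod m] -> coprime a m.
Proof. by move=> h; rewrite -coprime_modl h coprime_modl coprime1n. Qed.

Lemma modn_dvd a b m k : (k %| m)%N -> a = b %[mod m] -> a = b %[mod k].
Proof. by move=> km h; rewrite -(modn_dvdm a km) h modn_dvdm. Qed.

Lemma legendre_modnat p a b : prime p -> a = b %[mod p] -> legendre p a%:Z = legendre p b%:Z.
Proof.
move=> pp ab; apply: legendre_eqmod => //.
by rewrite -(intr_Fp_eq0 pp) intrB -!pmulrn -(Fp_nat_mod pp a) ab Fp_nat_mod // subrr.
Qed.

Section PrescribedPrimes.
Variables (qs : seq nat).
Hypotheses (qs_uniq : uniq qs) (qsP : forall p, p \in qs -> prime p /\ odd p).
Let P := \prod_(p <- qs) p.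
Let M := (8 * P)%N.

Lemma prod_odd_primes_odd : odd P.
Proof.
rewrite /P big_seq; apply: (big_ind (fun m => odd m)) => //.
  by move=> a b oa ob; rewrite oddM oa.
by move=> p /qsP [].
Qed.

Lemma prod_odd_primes_gt0 : (0 < P)%N.
Proof. by have := prod_odd_primes_odd; case: P. Qed.

Let dvd_P p : p \in qs -> (p %| P)%N.
Proof. by move=> pq; rewrite /P (big_rem p pq) dvdn_mulr. Qed.

Let oddM x : coprime x M -> odd x.
Proof. by rewrite coprimeMr -[8%N]/(2 ^ 3)%N coprime_pexpr // coprimen2 => /andP []. Qed.

Let mem_qchar k : k \in qs -> forall n, qchar k n = legendre k n.
Proof.
move=> /qsP [pk ok] n; rewrite /qchar.
by have [e|_] := eqVneq k 4%N; [move: ok; rewrite e|have [e|//] := eqVneq k 8%N; move: ok; rewrite e].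
Qed.

Let ms := [:: 4, 8 & qs]%N.

Let ms_case (T : nat -> Prop) : T 4%N -> T 8%N -> (forall k, k \in qs -> T k) ->
  forall k, k \in ms -> T k.
Proof. by move=> ? ? H k; rewrite !inE => /or3P [/eqP->|/eqP->|/H]. Qed.

Let qchar_1 k : k \in ms -> qchar k 1 = 1.
Proof. by move: k; apply: ms_case => // k kq; rewrite mem_qchar // legendre1. Qed.

Let qchar_M k : k \in ms -> forall m n, qchar k (m * n)%N = qchar k m * qchar k n.
Proof.
move: k; apply: ms_case; [exact: chi4M|exact: chi8M|move=> k kq m n].
by have [pk ok] := qsP kq; rewrite !mem_qchar // PoszM legendreM.
Qed.

Let qchar_mod8 k : k \in [:: 4; 8]%N -> forall m n, m = n %[mod 8] -> qchar k m = qchar k n.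
Proof.
rewrite !inE => /orP [] /eqP -> m n e; rewrite /qchar /=.
  by rewrite -chi4_mod e chi4_mod.
by rewrite -chi8_mod e chi8_mod.
Qed.

Let qchar_modq k : k \in qs -> forall m n, m = n %[mod k] -> qchar k m = qchar k n.
Proof.
by move=> kq m n e; have [pk _] := qsP kq; rewrite !mem_qchar // (legendre_modnat pk e).
Qed.

Let qchar_D k : k \in ms -> forall n, qchar k (n + M)%N = qchar k n.
Proof.
have eD m n : (m %| M)%N -> (n + M)%N = n %[mod m].
  by case/dvdnP => j ->; rewrite addnC modnMDl.
have e8 n : (n + M)%N = n %[mod 8] by apply: eD; exact: dvdn_mulr.
move: k; apply: ms_case => [n|n|k kq n]; try exact: qchar_mod8.
by apply: qchar_modq => //; apply: eD; apply: dvdn_mull; exact: dvd_P.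
Qed.

Let qchar_val k : k \in ms -> forall n, coprime n M -> qchar k n = 1 \/ qchar k n = -1.
Proof.
move: k; apply: ms_case => [n /oddM|n /oddM|k kq n]; [exact: chi4_val|exact: chi8_val|].
rewrite mem_qchar // coprimeMr => /andP [_ cnP]; have [pk _] := qsP kq.
apply: legendre_val => //; rewrite dvdzE /= -prime_coprime // coprime_sym.
by apply: (coprime_dvdr (dvd_P kq)).
Qed.

(** By Chinese remainders: 7 mod 8 changes the sign of [chi4] alone, 5 mod 8 that of [chi8] alone,
    and for an odd prime [k] a nonresidue modulo [k] is made 1 modulo the rest. *)
Let qchar_indep k : k \in ms -> exists a,
  [/\ coprime a M, qchar k a = -1 & forall j, j \in ms -> j != k -> qchar j a = 1].
Proof.
have c8P : coprime 8 P by rewrite -[8%N]/(2 ^ 3)%N coprime_pexpl // coprime2n prod_odd_primes_odd.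
have eq1 a p : p \in qs -> a = 1 %[mod P] -> qchar p a = 1.
  move=> pq h; rewrite (@qchar_modq _ pq _ 1) ?qchar_1 ?inE ?pq ?orbT //.
  exact: modn_dvd (dvd_P pq) h.
move: k; apply: ms_case => [||k kq].
- exists (chinese 8 P 7 1); have h8 := chinese_modl c8P 7 1; have hP := chinese_modr c8P 7 1.
  split.
  + by rewrite coprimeMr (coprime_mod1 hP) -coprime_modl h8.
  + by rewrite (@qchar_mod8 4 _ _ 7).
  + apply: ms_case => // [_|j jq _]; first by rewrite (@qchar_mod8 8 _ _ 7).
    exact: eq1.
- exists (chinese 8 P 5 1); have h8 := chinese_modl c8P 5 1; have hP := chinese_modr c8P 5 1.
  split.
  + by rewrite coprimeMr (coprime_mod1 hP) -coprime_modl h8.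
  + by rewrite (@qchar_mod8 8 _ _ 5).
  + apply: ms_case => // [_|j jq _]; first by rewrite (@qchar_mod8 4 _ _ 5).
    exact: eq1.
have [pk ok] := qsP kq; have [n ln] := legendre_nonresidue pk ok.
pose P' := (\prod_(p <- rem k qs) p)%N.
have PE : P = (k * P')%N by rewrite /P (big_rem k kq).
have ckP' : coprime k P'.
  rewrite /P' big_seq; apply: (big_ind (fun m => coprime k m)); first exact: coprimen1.
    by move=> a b ca cb; rewrite coprimeMr ca.
  move=> p; rewrite mem_rem_uniq // inE => /andP [pk' pq].
  by have [pp _] := qsP pq; rewrite prime_coprime // dvdn_prime2 // eq_sym.
have ck : coprime k (8 * P').
  by rewrite coprimeMr ckP' -[8%N]/(2 ^ 3)%N coprime_pexpr // coprimen2 ok.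
exists (chinese k (8 * P') n 1); set a := chinese _ _ _ _.
have hk : a = n %[mod k] := chinese_modl ck n 1.
have h1 : a = 1 %[mod 8 * P'] := chinese_modr ck n 1.
have h8 : a = 1 %[mod 8] by apply: modn_dvd h1; exact: dvdn_mulr.
have la : qchar k a = -1 by rewrite (qchar_modq kq hk) mem_qchar.
split=> //.
  rewrite /M PE mulnCA coprimeMr (coprime_mod1 h1) andbT coprime_sym prime_coprime //.
  apply/negP => ka; move: la; rewrite mem_qchar //.
  by have /eqP -> : legendre k a == 0 by rewrite legendre_eq0.
apply: ms_case => [_|_|j jq jk]; try by rewrite (@qchar_mod8 _ _ _ 1).
rewrite (@qchar_modq _ jq _ 1) ?qchar_1 ?inE ?jq ?orbT //.
apply: modn_dvd h1; apply: dvdn_mull; rewrite /P' (big_rem j) ?dvdn_mulr //=.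
by rewrite mem_rem_uniq // inE jk.
Qed.

Lemma prime_with_qchars (R : realType) (E : nat -> int) :
  (forall k, k \in ms -> E k = 1 \/ E k = -1) -> (exists2 k, k \in ms & E k = -1) ->
  exists q, prime q /\ forall k, k \in ms -> qchar k q = E k.
Proof.
move=> HE [k0 k0m Ek0]; pose I := 'I_(size ms); pose m_ (i : I) := nth 0%N ms i.
have m_mem i : m_ i \in ms by apply: mem_nth.
have ms_uniq : uniq ms.
  rewrite /ms !cons_uniq qs_uniq !inE andbT; apply/andP; split; apply/negP => /qsP [].
  - by [].
  - by [].
have idx k : k \in ms -> exists i, m_ i = k.
  move=> km; have lt : (index k ms < size ms)%N by rewrite index_mem.
  by exists (Ordinal lt); rewrite /m_ /= nth_index.
have M_gt0 : (0 < M)%N by rewrite muln_gt0 prod_odd_primes_gt0.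
have [|||||||q [pq _ Hq]] := @prime_with_signs R I M (fun i => qchar (m_ i)) (fun i => E (m_ i)) M_gt0.
- by move=> i; exact: qchar_1.
- by move=> i x y; exact: qchar_M.
- by move=> i x; exact: qchar_D.
- by move=> i x; exact: qchar_val.
- move=> i; have [a [ca ai aj]] := qchar_indep (m_mem i); exists a; split=> // j ji.
  by apply: aj => //; rewrite /m_ nth_uniq.
- by move=> i; exact: HE.
- by have [i e] := idx _ k0m; exists i; rewrite e.
by exists q; split=> // k /idx [i <-].
Qed.
End PrescribedPrimes.

Theorem prime_with_legendre (R : realType) (ps : seq nat) (E : nat -> int) (e8 : int) :
  (forall p, p \in ps -> prime p /\ odd p) -> (forall p, p \in ps -> E p = 1 \/ E p = -1) ->
  e8 = 1 \/ e8 = -1 ->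
  exists q, [/\ prime q, (q %% 4 = 1)%N, chi8 q = e8 & forall p, p \in ps -> legendre p q = E p].
Proof.
(* The auxiliary prime [l] is given the sign -1, because sign patterns are realized only if some
   sign is negative. *)
move=> psP HE He8; have [l [pl ol lps]] := exists_odd_prime_notin ps.
pose qs := l :: undup ps.
have qs_uniq : uniq qs by rewrite /= undup_uniq mem_undup lps.
have qsP p : p \in qs -> prime p /\ odd p.
  by rewrite inE mem_undup => /orP [/eqP -> //|/psP].
have nl k : k \in [:: 4; 8]%N -> k == l = false.
  by rewrite !inE => /orP [] /eqP ->; apply/eqP => e; move: ol; rewrite -e.
pose E' k := if k == l then -1 else if k == 4%N then 1 else if k == 8%N then e8 else E k.
have E'E p : p \in ps -> E' p = E p.
  move=> pp; have [_ op] := psP p pp; rewrite /E'.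
  have -> : (p == l) = false by apply/eqP => e; move: lps; rewrite -e pp.
  by case: eqP op => [->//|_]; case: eqP => [->//|_].
have [k||q [pq Hq]] := @prime_with_qchars qs qs_uniq qsP R E'.
- rewrite !inE mem_undup => /or4P [/eqP->|/eqP->|/eqP->|kp].
  + by rewrite /E' nl //; left.
  + by rewrite /E' nl.
  + by rewrite /E' eqxx; right.
  + by rewrite E'E //; exact: HE.
- by exists l; rewrite ?/E' ?eqxx // !inE eqxx !orbT.
exists q; split=> //.
- have := Hq 4%N; rewrite /E' nl // /qchar /= /chi4 => /(_ isT).
  by case: ifP => // _; case: eqP.
- by have := Hq 8%N; rewrite /E' nl // /qchar /=; apply.
move=> p pp; rewrite -E'E // -Hq; last by rewrite !inE mem_undup pp !orbT.
have [_ op] := psP p pp; rewrite /qchar.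
by case: eqP op => [->//|_]; case: eqP => [->//|_].
Qed.

(** * Ternary forms and sums of two squares *)

Lemma nat_sqrt_exists (n : nat) : exists s, (s ^ 2 <= n < s.+1 ^ 2)%N.
Proof.
elim: n => [|n [s /andP [h1 h2]]]; first by exists 0%N.
have [e|ne] := eqVneq n.+1 (s.+1 ^ 2)%N; first by exists s.+1; rewrite e leqnn ltn_exp2r /=.
by exists s; rewrite (leq_trans h1) //= ltn_neqAle ne.
Qed.

Lemma dvdz_pigeonhole (T : finType) (a b c : nat) (f g h : T -> int) :
  (0 < a)%N -> (0 < b)%N -> (0 < c)%N -> (a * b * c < #|T|)%N ->
  exists i j, [/\ i != j, (a %| f i - f j)%Z, (b %| g i - g j)%Z & (c %| h i - h j)%Z].
Proof.
case: a b c => // a [//|b] [//|c] _ _ _ lt.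
pose r (m : nat) (n : int) : 'I_m.+1 := inord `|(n %% m.+1)%Z|%N.
have rE m n n' : r m n = r m n' -> (m.+1 %| n - n')%Z.
  have rv k : nat_of_ord (r m k) = `|(k %% m.+1)%Z|%N.
    by rewrite inordK // -ltz_nat gez0_abs ?modz_ge0 // ltz_pmod.
  move=> /(congr1 (@nat_of_ord _)); rewrite !rv => /(congr1 Posz).
  by rewrite !gez0_abs ?modz_ge0 // => /eqP; rewrite eqz_mod_dvd.
pose F i := (r a (f i), r b (g i), r c (h i)).
have /injectivePn [i [j ij Fij]] : ~~ injectiveb F.
  apply/negP => /injectiveP /leq_card; rewrite !card_prod !card_ord.
  by rewrite leqNgt lt.
by exists i, j; case: Fij => /rE ? /rE ? /rE ?; split.
Qed.

Lemma sqr_ord_sub_lt (n k : nat) (p q : 'I_n.+1) : (n ^ 2 < k)%N -> (p%:Z - q%:Z) ^+ 2 < k%:Z.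
Proof.
move=> nk; apply: (@le_lt_trans _ _ (n ^ 2)%N%:Z); last by rewrite ltz_nat.
move: (ltn_ord p) (ltn_ord q); rewrite !ltnS -subr_ge0 PoszM => {nk}.
have -> : n%:Z * n%:Z - (p%:Z - q%:Z) ^+ 2 = (n%:Z - (p%:Z - q%:Z)) * (n%:Z + (p%:Z - q%:Z)) by ring.
by move=> pn qn; apply: mulr_ge0; lia.
Qed.

(** Two points of a box with sides about sqrt(b c), sqrt(a c), sqrt(a b) agree modulo a, b, c in
    three linear forms; their difference makes the ternary form divisible by a b c, and its size
    leaves two values. *)
Lemma legendre_ternary (a b c : nat) (t u v : int) :
  (0 < a)%N -> (0 < b)%N -> (0 < c)%N ->
  coprime a b -> coprime a c -> coprime b c ->
  (a %| b%:Z * t ^+ 2 - c%:Z)%Z -> (b %| a%:Z * u ^+ 2 - c%:Z)%Z -> (c %| a%:Z * v ^+ 2 + b%:Z)%Z ->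
  (forall n, n ^ 2 != b * c)%N ->
  exists x y z : int, z != 0 /\ a%:Z * x ^+ 2 + b%:Z * y ^+ 2 = c%:Z * z ^+ 2.
Proof.
move=> a0 b0 c0 cab cac cbc ht hu hv nsq.
have ceil n : (0 < n)%N -> exists s, (s ^ 2 < n <= s.+1 ^ 2)%N.
  by case: n => // n _; have [s] := nat_sqrt_exists n; exists s; lia.
(* As b c is not a square, it lies strictly between X^2 and (X+1)^2: the upper inequality makes the
   box larger than a b c, the lower one gives x^2 < b c. *)
have [X /andP [X1 X2]] := nat_sqrt_exists (b * c).
have {}X1 : (X ^ 2 < b * c)%N by rewrite ltn_neqAle nsq X1.
have [Y /andP [Y1 Y2]] := ceil (a * c)%N ltac:(by rewrite muln_gt0 a0).
have [Z /andP [Z1 Z2]] := ceil (a * b)%N ltac:(by rewrite muln_gt0 a0).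
have card : (a * b * c < #|{: 'I_X.+1 * 'I_Y.+1 * 'I_Z.+1}|)%N.
  rewrite !card_prod !card_ord -(ltn_exp2r _ _ (isT : 0 < 2)%N) !expnMn.
  have h : (a * c * (a * b) <= Y.+1 ^ 2 * Z.+1 ^ 2)%N by exact: leq_mul.
  apply: (@leq_trans (X.+1 ^ 2 * (a * c * (a * b)))%N); last by rewrite -[X in (_ <= X)%N]mulnA leq_mul2l h orbT.
  have -> : (a ^ 2 * b ^ 2 * c ^ 2 = b * c * (a * c * (a * b)))%N by ring.
  by rewrite ltn_mul2r X2 !muln_gt0 a0 b0 c0.
pose ix (w : 'I_X.+1 * 'I_Y.+1 * 'I_Z.+1) := (nat_of_ord w.1.1)%:Z.
pose iy (w : 'I_X.+1 * 'I_Y.+1 * 'I_Z.+1) := (nat_of_ord w.1.2)%:Z.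
pose iz (w : 'I_X.+1 * 'I_Y.+1 * 'I_Z.+1) := (nat_of_ord w.2)%:Z.
have [i [j [ij Ha Hb Hc]]] := dvdz_pigeonhole (fun w => iy w - t * iz w)
  (fun w => ix w - u * iz w) (fun w => ix w - v * iy w) a0 b0 c0 card.
pose x := ix i - ix j; pose y := iy i - iy j; pose z := iz i - iz j.
have {}Ha : (a %| y - t * z)%Z.
  by have -> : y - t * z = iy i - t * iz i - (iy j - t * iz j) by rewrite /x /y /z; ring.
have {}Hb : (b %| x - u * z)%Z.
  by have -> : x - u * z = ix i - u * iz i - (ix j - u * iz j) by rewrite /x /y /z; ring.
have {}Hc : (c %| x - v * y)%Z.
  by have -> : x - v * y = ix i - v * iy i - (ix j - v * iy j) by rewrite /x /y /z; ring.
have nz : [|| x != 0, y != 0 | z != 0].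
  apply: contraNT ij; rewrite !negb_or !negbK !subr_eq0 /ix /iy /iz => /and3P [e1 e2 e3].
  case: i j e1 e2 e3 {Ha Hb Hc x y z} => [[i1 i2] i3] [[j1 j2] j3] /= e1 e2 e3.
  move: e1 e2 e3; rewrite !eqz_nat => /eqP/val_inj -> /eqP/val_inj -> /eqP/val_inj ->.
  exact: eqxx.
have bx : x ^+ 2 < (b * c)%N%:Z by exact: sqr_ord_sub_lt.
have by' : y ^+ 2 < (a * c)%N%:Z by exact: sqr_ord_sub_lt.
have bz : z ^+ 2 < (a * b)%N%:Z by exact: sqr_ord_sub_lt.
pose f := a%:Z * x ^+ 2 + b%:Z * y ^+ 2 - c%:Z * z ^+ 2.
have Fa : (a %| f)%Z.
  have -> : f = a%:Z * x ^+ 2 + (b%:Z * t ^+ 2 - c%:Z) * z ^+ 2 + b%:Z * (y + t * z) * (y - t * z).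
    by rewrite /f; ring.
  apply: rpredD; last exact: dvdz_mull.
  by apply: rpredD; [exact: dvdz_mulr|exact: dvdz_mulr].
have Fb : (b %| f)%Z.
  have -> : f = b%:Z * y ^+ 2 + (a%:Z * u ^+ 2 - c%:Z) * z ^+ 2 + a%:Z * (x + u * z) * (x - u * z).
    by rewrite /f; ring.
  apply: rpredD; last exact: dvdz_mull.
  by apply: rpredD; [exact: dvdz_mulr|exact: dvdz_mulr].
have Fc : (c %| f)%Z.
  have -> : f = (a%:Z * v ^+ 2 + b%:Z) * y ^+ 2 + a%:Z * (x + v * y) * (x - v * y) - c%:Z * z ^+ 2.
    by rewrite /f; ring.
  apply: rpredB; last exact: dvdz_mulr.
  by apply: rpredD; [exact: dvdz_mulr|exact: dvdz_mull].
have /dvdzP [k fk] : ((a * b * c)%N %| f)%Z.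
  move: Fa Fb Fc; rewrite !dvdzE /= => Fa Fb Fc.
  by rewrite Gauss_dvd ?coprimeMl ?cac ?cbc // Fc Gauss_dvd // Fa Fb.
(* Each of a x^2, b y^2, c z^2 is less than a b c, so f lies strictly between - a b c and 2 a b
   c. *)
have k01 : k = 0 \/ k = 1.
  have abc0 : 0 < (a * b * c)%N%:Z by rewrite ltz_nat !muln_gt0 a0 b0 c0.
  have f1 : f < 2 * (a * b * c)%N%:Z.
    have : 0 <= c%:Z * z ^+ 2 by rewrite mulr_ge0 ?sqr_ge0.
    have : a%:Z * x ^+ 2 < (a * b * c)%N%:Z by rewrite -mulnA PoszM ltr_pM2l.
    have : b%:Z * y ^+ 2 < (a * b * c)%N%:Z.
      by rewrite [(a * b)%N]mulnC -mulnA PoszM ltr_pM2l.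
    by rewrite /f; lra.
  have f2 : - (a * b * c)%N%:Z < f.
    have : 0 <= a%:Z * x ^+ 2 by rewrite mulr_ge0 ?sqr_ge0.
    have : 0 <= b%:Z * y ^+ 2 by rewrite mulr_ge0 ?sqr_ge0.
    have : c%:Z * z ^+ 2 < (a * b * c)%N%:Z by rewrite mulnC PoszM ltr_pM2l.
    by rewrite /f; lra.
  rewrite fk in f1 f2.
  have k2 : k < 2 by rewrite -(ltr_pM2r abc0).
  have k1 : -1 < k by rewrite -(ltr_pM2r abc0) mulN1r.
  by clear -k1 k2; lia.
case: k01 => kE; rewrite kE in fk.
  exists x, y, z; move: fk; rewrite /f mul0r => /eqP; rewrite subr_eq0 => /eqP e; split=> //.
  apply/eqP => z0; move: nz; rewrite z0 eqxx orbF.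
  have a1 : 0 < a%:Z by []. have b1 : 0 < b%:Z by [].
  move: e; rewrite z0 expr0n mulr0 => e.
  have /eqP -> : x == 0 by rewrite -sqrf_eq0; have := sqr_ge0 x; have := sqr_ge0 y; nra.
  have /eqP -> : y == 0 by rewrite -sqrf_eq0; have := sqr_ge0 x; have := sqr_ge0 y; nra.
  by rewrite eqxx.
(* If f = a b c, then a x^2 + b y^2 = c (z^2 + a b); multiplying by z^2 + a b, a norm from Q(sqrt(-
   a b)), keeps the shape of the left side and makes the right one c times a square. *)
exists (x * z + b%:Z * y), (y * z - a%:Z * x), (z ^+ 2 + a%:Z * b%:Z); split.
  by rewrite gt_eqF // ltr_wpDl ?sqr_ge0 // mulr_gt0.
move: fk; rewrite /f mul1r !PoszM => fk.
have -> : a%:Z * (x * z + b%:Z * y) ^+ 2 + b%:Z * (y * z - a%:Z * x) ^+ 2 =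
  (z ^+ 2 + a%:Z * b%:Z) * (a%:Z * x ^+ 2 + b%:Z * y ^+ 2) by ring.
have -> : a%:Z * x ^+ 2 + b%:Z * y ^+ 2 = a%:Z * b%:Z * c%:Z + c%:Z * z ^+ 2 by rewrite -fk; ring.
by ring.
Qed.

Lemma squarefree_gt0 n : squarefree n -> (0 < n)%N.
Proof. by case: n => // /(_ 2%N); rewrite dvdn0 => /(_ isT). Qed.

Lemma squarefree_dvd m n : (m %| n)%N -> squarefree n -> squarefree m.
Proof. by move=> mn sn k km; apply: sn; apply: dvdn_trans mn. Qed.

Lemma squarefree_coprime a b : squarefree (a * b) -> coprime a b.
Proof.
move=> s; apply/eqP/s; rewrite -mulnn; apply: dvdn_mul; [exact: dvdn_gcdl|exact: dvdn_gcdr].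
Qed.

Lemma squarefree_logn n p : squarefree n -> p \in primes n -> logn p n = 1%N.
Proof.
move=> sn pn; have l0 : (0 < logn p n)%N by rewrite logn_gt0.
have /and3P [pp n0 _] : [&& prime p, 0 < n & p %| n]%N by rewrite -mem_primes.
apply/eqP; rewrite eqn_leq l0 andbT leqNgt; apply/negP => l2.
have : (p ^ 2 %| n)%N by rewrite pfactor_dvdn.
by move/sn => p1; move: pp; rewrite p1.
Qed.

Lemma squarefree_prod_primes n : squarefree n -> n = (\prod_(p <- primes n) p)%N.
Proof.
move=> sn; rewrite {1}(prod_prime_decomp (squarefree_gt0 sn)) prime_decompE big_map /=.
by apply: eq_big_seq => p pn; rewrite squarefree_logn.
Qed.

Lemma squarefree_morph (g : nat -> int) n : squarefree n -> g 1%N = 1 ->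
  (forall x y, g (x * y)%N = g x * g y) -> g n = \prod_(p <- primes n) g p.
Proof.
by move=> sn g1 gM; rewrite {1}(squarefree_prod_primes sn) (big_morph g gM g1).
Qed.

Lemma squarefree_prime q : prime q -> squarefree q.
Proof.
move=> pq k kq; have kq1 : (k %| q)%N by apply: dvdn_trans kq; rewrite -mulnn dvdn_mulr.
have /primeP [q1 H] := pq; move/H: kq1 => /orP [/eqP //|/eqP kE].
by move: kq; rewrite kE => /dvdn_leq; move: q1; clear; nia.
Qed.

Lemma squarefree_double q : odd q -> squarefree q -> squarefree (2 * q).
Proof.
move=> oq sq k; have [ok|ek] := boolP (odd k).
  by rewrite Gauss_dvdr; [exact: sq|rewrite coprimen2 oddX ok].
have /dvdnP [j ->] : (2 %| k)%N by rewrite dvdn2.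
rewrite expnMn -mulnn [(j ^ 2 * _)%N]mulnC -mulnA dvdn_pmul2l // => /(dvdn_trans (dvdn_mulr _ (dvdnn _))).
by rewrite dvdn2 oq.
Qed.

Lemma odd_half_pred_1mod4 q : (q %% 4 = 1)%N -> odd q.-1./2 = false.
Proof. lia. Qed.

Lemma squarefree_dvdP m n : squarefree m -> (forall p, prime p -> (p %| m)%N -> (p %| n)%N) -> (m %| n)%N.
Proof.
elim/ltn_ind: m => m IH sm H; have m0 := squarefree_gt0 sm.
have [m1|m1] := leqP m 1; first by have -> : m = 1%N by lia.
have pp := pdiv_prime m1; have /dvdnP [k mE] := pdiv_dvd m.
have ck : coprime k (pdiv m) by apply: squarefree_coprime; rewrite -mE.
rewrite mE Gauss_dvd // (H _ pp) ?pdiv_dvd // andbT.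
have km : (k %| m)%N by rewrite [X in (_ %| X)%N]mE dvdn_mulr.
apply: IH; last by move=> p prp pk; apply: H => //; exact: dvdn_trans km.
  by rewrite [X in (_ < X)%N]mE ltn_Pmulr ?prime_gt1 //; case: (k) mE m0 => // ->.
exact: squarefree_dvd sm.
Qed.

Lemma root_mod_squarefree (n : nat) (a b : int) : squarefree n ->
  (forall p, prime p -> (p %| n)%N -> exists t : int, (p %| a * t ^+ 2 - b)%Z) ->
  exists t : int, (n %| a * t ^+ 2 - b)%Z.
Proof.
elim/ltn_ind: n => n IH sn H; have n0 := squarefree_gt0 sn.
have [n1|n1] := leqP n 1; first by exists 0; have -> : n = 1%N by lia.
have pp := pdiv_prime n1; have /dvdnP [k nE] := pdiv_dvd n.
have ck : coprime k (pdiv n) by apply: squarefree_coprime; rewrite -nE.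
have kn : (k %| n)%N by rewrite [X in (_ %| X)%N]nE dvdn_mulr.
have [|||t1 Ht1] := IH k.
- by rewrite [X in (_ < X)%N]nE ltn_Pmulr ?prime_gt1 //; case: (k) nE n0 => // ->.
- exact: squarefree_dvd sn.
- by move=> p prp pk; apply: H => //; exact: dvdn_trans kn.
have [t2 Ht2] := H _ pp (pdiv_dvd n).
have cz : coprimez k (pdiv n) by rewrite coprimezE.
pose t := zchinese k (pdiv n) t1 t2; exists t.
have tr (m : nat) t' : (t = t' %[mod m])%Z -> (m %| a * t' ^+ 2 - b)%Z -> (m %| a * t ^+ 2 - b)%Z.
  move=> /eqP; rewrite eqz_mod_dvd => d1 d2.
  have -> : a * t ^+ 2 - b = a * (t + t') * (t - t') + (a * t' ^+ 2 - b) by ring.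
  by apply: rpredD => //; exact: dvdz_mull.
have D1 := tr _ _ (zchinese_modl cz t1 t2) Ht1.
have D2 := tr _ _ (zchinese_modr cz t1 t2) Ht2.
by move: D1 D2; rewrite [in X in _ -> _ -> X]nE !dvdzE /= => D1 D2; rewrite Gauss_dvd // D1.
Qed.

(** If w^2 = a b and u inverts a modulo p, then t = u w. *)
Lemma legendre_root p (a b : int) : prime p -> odd p -> ~~ (p %| a)%Z ->
  legendre p (a * b) = 1 -> exists t : int, (p %| a * t ^+ 2 - b)%Z.
Proof.
move=> pp op pa lab; have [w hw] := legendre_sqrt pp op lab.
have cz : coprimez a p by rewrite coprimezE coprime_sym prime_coprime // -dvdzE.
have [[u v] /= uv] := coprimezP _ _ cz.
exists (u * w).
have -> : a * (u * w) ^+ 2 - b = a * u ^+ 2 * (w ^+ 2 - a * b) + b * ((a * u - 1) * (a * u + 1)) by ring.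
have -> : a * u - 1 = - v * p by rewrite -uv; ring.
apply: rpredD; first exact: dvdz_mull.
by rewrite dvdz_mull // dvdz_mulr // dvdz_mull.
Qed.

Section SumTwoSquares.
Variable (K : fieldType).
Definition sum2sq (x : K) := exists a b : K, x = a ^+ 2 + b ^+ 2.

Lemma sum2sqM x y : sum2sq x -> sum2sq y -> sum2sq (x * y).
Proof.
by case=> a [b ->] [c [e ->]]; exists (a * c - b * e), (a * e + b * c); ring.
Qed.

Lemma sum2sq_sqr x : sum2sq (x ^+ 2).
Proof. by exists x, 0; rewrite expr0n addr0. Qed.

Lemma sum2sqV x : sum2sq x -> sum2sq x^-1.
Proof.
move=> sx; have [->|x0] := eqVneq x 0; first by rewrite invr0; exists 0, 0; rewrite expr0n addr0.
have -> : x^-1 = x * x^-1 ^+ 2 by rewrite expr2 mulrA mulfV // mul1r.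
exact: sum2sqM (sum2sq_sqr _).
Qed.

Lemma sum2sq2 : sum2sq 2.
Proof. by exists 1, 1; rewrite expr1n; ring. Qed.

Hypothesis K_char0 : [pchar K] =i pred0.

Lemma char0_intr_eq0 (z : int) : (z%:~R == 0 :> K) = (z == 0).
Proof.
have c0 := (pcharf0P K).1 K_char0; case: z => n; first by rewrite -pmulrn c0.
by rewrite NegzE mulrNz !oppr_eq0 -pmulrn c0.
Qed.

(** The ternary equation x^2 + y^2 = q z^2 is solvable since -1 is a square modulo q; dividing by z
    is harmless in a field. *)
Lemma sum2sq_prime q : prime q -> (q %% 4 = 1)%N -> sum2sq (q%:R : K).
Proof.
move=> pq q4; have oq : odd q by lia.
have [|v hv] := @legendre_sqrt q pq oq (-1).
  by rewrite legendreN1 // -signr_odd; rewrite odd_half_pred_1mod4.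
have [|||||||x [y [z [z0 E]]]] := @legendre_ternary 1 1 q 0 0 v isT isT (prime_gt0 pq); rewrite ?coprime1n ?dvd1z //.
- by rewrite mul1r -[1%:Z]opprK.
- move=> n; rewrite mul1n; apply/eqP => e; have : (q %| n ^ 2)%N by rewrite e.
  rewrite Euclid_dvdX // => /andP [/dvdnP [k kE] _]; move: e; rewrite kE expnMn.
  have := prime_gt1 pq; nia.
have z0' : z%:~R != 0 :> K by rewrite char0_intr_eq0.
exists (x%:~R / z%:~R), (y%:~R / z%:~R).
rewrite !expr_div_n -mulrDl; apply: (mulIf (expf_neq0 2 z0')); rewrite divfK ?expf_neq0 //.
have /(congr1 (fun t : int => t%:~R : K)) := E.
by rewrite !mul1r !expr2 intrD !intrM -[q%:~R]pmulrn => ->.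
Qed.
End SumTwoSquares.

Section SumTwoSquaresCore.
Variables (R : realType) (K : fieldType) (s : K) (a b c0 : nat).
Hypothesis K_char0 : [pchar K] =i pred0.
Hypothesis ab_sqf : squarefree (a * b).
Hypothesis s_sqr : s ^+ 2 = (a * b)%:R.
Hypothesis c0_val : c0 = 1%N \/ (c0 = 2%N /\ odd (a * b)).

Let cof p := if (p %| a)%N then b else a.
(** The symbol of q modulo p for which [cof p] t^2 = c0 q is solvable modulo p. *)
Let E p := legendre p (c0 * cof p)%N%:Z.
Hypothesis E_prod : odd (a * b) -> \prod_(p <- primes (a * b)) E p = 1.

Let cab : coprime a b := squarefree_coprime ab_sqf.
Let ab0 : (0 < a * b)%N := squarefree_gt0 ab_sqf.

Let cof_coprime p : prime p -> (p %| a * b)%N -> coprime p (cof p).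
Proof.
move=> pp; rewrite Euclid_dvdM // /cof; case: ifP => [pa _|_ /= pb].
  exact: (coprime_dvdl pa).
by rewrite coprime_sym; apply: (coprime_dvdr pb).
Qed.

Let c0_ndvd p : prime p -> odd p -> ~~ (p %| c0)%N.
Proof. by move=> pp op; case: c0_val => [->|[-> _]]; [rewrite Euclid_dvd1|rewrite dvdn_prime2 //; case: eqP op => // ->]. Qed.

Let E_val p : prime p -> odd p -> (p %| a * b)%N -> E p = 1 \/ E p = -1.
Proof.
move=> pp op pab; apply: legendre_val => //.
rewrite dvdzE /= Euclid_dvdM // negb_or c0_ndvd //= -prime_coprime //.
exact: cof_coprime.
Qed.

Theorem sum2sq_cofactor : sum2sq (a%:R : K).
Proof.
(* [e8] is prescribed for the symbol of 2 modulo q: when a b is even, it multiplies the product over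
   the odd primes, also [e8], to 1. *)
pose ps := [seq p <- primes (a * b) | odd p]; pose e8 := \prod_(p <- ps) E p.
have psP p : p \in ps -> [/\ prime p, odd p & (p %| a * b)%N].
  by rewrite mem_filter mem_primes => /and4P [].
have e8_val : e8 = 1 \/ e8 = -1.
  rewrite /e8 big_seq; apply: (big_ind (fun x : int => x = 1 \/ x = -1)); first by left.
    by move=> x y [->|->] [->|->]; [left|right|right|left].
  by move=> p /psP [pp op pab]; exact: E_val.
have [|||q [pq q4 q8 Hq]] := @prime_with_legendre R ps E e8 => //.
- by move=> p /psP [].
- by move=> p /psP [pp op pab]; exact: E_val.
have oq : odd q by clear -q4; lia.
have lq p : prime p -> odd p -> (p %| a * b)%N -> legendre p q = E p.
  by move=> pp op pab; apply: Hq; rewrite mem_filter op mem_primes pp ab0 pab.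
have nqp p : prime p -> odd p -> (p %| a * b)%N -> p != q.
  move=> pp op pab; apply/eqP => e; have := E_val pp op pab; rewrite -lq // e.
  have /eqP -> : legendre q q == 0 by rewrite legendre_eq0.
  by case.
have qab : ~~ (q %| a * b)%N by apply/negP => d; have := nqp q pq oq d; rewrite eqxx.
have lqab : legendre q (a * b)%N%:Z = 1.
  rewrite (@squarefree_morph (fun n => legendre q n%:Z) _ ab_sqf); last 2 first.
  - exact: legendre1.
  - by move=> x y; rewrite PoszM legendreM.
  rewrite (bigID odd) /= -big_filter -/ps.
  have -> : \prod_(p <- ps) legendre q p = e8.
    apply: eq_big_seq => p /psP [pp op pab].
    by rewrite -quadratic_reciprocity_1mod4 ?lq // nqp.
  have even_prod : \prod_(p <- primes (a * b) | ~~ odd p) legendre q p =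
      if odd (a * b) then 1 else e8.
    rewrite big_seq_cond; case: ifP => oab.
      rewrite big1 // => p /andP []; rewrite mem_primes => /and3P [pp _ /dvdnP [k kE]] op.
      by move: oab; rewrite kE oddM (negbTE op) andbF.
    rewrite -big_seq_cond big_mkcond (bigD1_seq 2%N) ?primes_uniq //=; last first.
      by rewrite mem_primes ab0 /= dvdn2 oab.
    rewrite legendre2 // q8 big_seq_cond big1 ?mulr1 // => p /andP [].
    by rewrite mem_primes => /andP [/even_prime [->//|->]].
  rewrite even_prod; case: ifP => oab.
    rewrite mulr1 /e8 big_filter -[RHS](E_prod oab) big_mkcond [RHS]big_seq [LHS]big_seq.
    apply: eq_bigr => p; rewrite mem_primes => /and3P [pp _ /dvdnP [k kE]].
    by move: oab; rewrite kE oddM => /andP [_ ->].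
  by case: e8_val => ->.
pose c := (c0 * q)%N.
have q0 := prime_gt0 pq; have c00 : (0 < c0)%N by case: c0_val => [->|[-> _]].
have c_gt0 : (0 < c)%N by rewrite muln_gt0 c00.
have a0 : (0 < a)%N by move: ab0; rewrite muln_gt0 => /andP [].
have b0 : (0 < b)%N by move: ab0; rewrite muln_gt0 => /andP [].
have cabc : coprime (a * b) c.
  rewrite /c coprimeMr [coprime _ q]coprime_sym (prime_coprime _ pq) qab andbT.
  by case: c0_val => [->|[-> ?]]; rewrite ?coprimen1 // coprimen2.
have root p (x : nat) : prime p -> (p %| a * b)%N -> cof p = x ->
    exists t : int, (p %| x%:Z * t ^+ 2 - c%:Z)%Z.
  move=> pp pab <-; have [op|] := boolP (odd p); last first.
    (* If 2 divides a b, then c0 = 1, so c = q and the cofactor are both odd. *)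
    case: (even_prime pp) => [p2 _|-> //]; exists 1.
    have c01 : c0 = 1%N.
      case: c0_val => // -[_]; move: pab; rewrite p2 dvdn2 => /negbTE -> //.
    have : coprime p (cof p) by exact: cof_coprime.
    rewrite p2 coprime2n /c c01 mul1n => ox; rewrite expr1n mulr1.
    by rewrite dvdzE /= dvdn2; move: oq ox; move: (cof 2) => y; clear; lia.
  apply: legendre_root => //.
    by rewrite dvdzE /= -prime_coprime // cof_coprime.
  rewrite -PoszM /c mulnA [(cof p * _)%N]mulnC PoszM legendreM // lq // -/(E p).
  by case: (E_val pp op pab) => ->.
have [t ht] : exists t : int, (a %| b%:Z * t ^+ 2 - c%:Z)%Z.
  apply: root_mod_squarefree (squarefree_dvd (dvdn_mulr b (dvdnn a)) ab_sqf) _ => p pp pa.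
  by apply: root; rewrite ?dvdn_mulr // /cof pa.
have [u hu] : exists u : int, (b %| a%:Z * u ^+ 2 - c%:Z)%Z.
  apply: root_mod_squarefree (squarefree_dvd (dvdn_mull a (dvdnn b)) ab_sqf) _ => p pp pb.
  apply: root; rewrite ?dvdn_mull // /cof ifN // -prime_coprime // coprime_sym.
  exact: (coprime_dvdr pb).
have c_sqf : squarefree c.
  have sq := squarefree_prime pq.
  by rewrite /c; case: c0_val => [->|[-> _]]; rewrite ?mul1n //; exact: squarefree_double.
(* Modulo q this asks that - a b be a square, which is [lqab] with q = 1 mod 4; modulo 2, when c0 =
   2, both a and b are odd. *)
have [v hv] : exists v : int, (c %| a%:Z * v ^+ 2 + b%:Z)%Z.
  rewrite -[b%:Z]opprK; apply: root_mod_squarefree c_sqf _ => p pp.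
  rewrite /c Euclid_dvdM // => /orP [pc0|]; last first.
    rewrite dvdn_prime2 // => /eqP ->; apply: legendre_root => //.
      by rewrite dvdzE /=; apply: contra qab => ?; rewrite dvdn_mulr.
    rewrite mulrN -mulN1r legendreM // -PoszM lqab mulr1 legendreN1 // -signr_odd.
    by rewrite odd_half_pred_1mod4.
  case: c0_val pc0 => [->|[-> oab]]; first by rewrite Euclid_dvd1.
  rewrite dvdn_prime2 // => /eqP ->; exists 1; rewrite expr1n mulr1 opprK dvdzE /= dvdn2.
  by move: oab; rewrite oddM oddD => /andP [-> ->].
have [||n|x [y [z [z0 Exyz]]]] := legendre_ternary a0 b0 c_gt0 cab _ _ ht hu hv.
- by apply: coprime_dvdl cabc; rewrite dvdn_mulr.
- by apply: coprime_dvdl cabc; rewrite dvdn_mull.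
(* b c is not a square because q divides it exactly once. *)
- apply/eqP => e; have : (q %| n ^ 2)%N by rewrite e !dvdn_mull.
  rewrite Euclid_dvdX // => /andP [/dvdnP [k kE] _].
  have : (q %| b * c0)%N.
    have : (n ^ 2 = q * (k ^ 2 * q))%N by rewrite kE; ring.
    rewrite e /c mulnA [(_ * q)%N]mulnC => /eqP; rewrite eqn_pmul2l // => /eqP ->.
    exact: dvdn_mull.
  rewrite Euclid_dvdM // (negbTE (c0_ndvd pq oq)) orbF => qb.
  by move: qab; rewrite dvdn_mull.
have z0' : z%:~R != 0 :> K by rewrite char0_intr_eq0.
have c0' : c%:R != 0 :> K by rewrite ((pcharf0P K).1 K_char0) -lt0n.
have c_sum : sum2sq (c%:R : K).
  rewrite /c natrM; apply: sum2sqM; last exact: sum2sq_prime.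
  by case: c0_val => [->|[-> _]]; [rewrite -[1%:R](expr1n _ 2); exact: sum2sq_sqr|exact: sum2sq2].
have -> : a%:R = ((a%:R * x%:~R) ^+ 2 + (s * y%:~R) ^+ 2) * (c%:R * z%:~R ^+ 2)^-1 :> K.
  have EK : a%:R * x%:~R ^+ 2 + b%:R * y%:~R ^+ 2 = c%:R * z%:~R ^+ 2 :> K.
    have /(congr1 (fun t : int => t%:~R : K)) := Exyz.
    by rewrite !expr2 intrD !intrM -!pmulrn.
  rewrite -EK !exprMn s_sqr natrM.
  have n0 : a%:R * x%:~R ^+ 2 + b%:R * y%:~R ^+ 2 != 0 :> K.
    by rewrite EK mulf_neq0 // expf_neq0.
  by field.
apply: sum2sqM; first by exists (a%:R * x%:~R), (s * y%:~R).
by apply: sum2sqV; apply: sum2sqM => //; exact: sum2sq_sqr.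
Qed.
End SumTwoSquaresCore.

Lemma legendreN1_chi4 p : prime p -> odd p -> legendre p (-1) = chi4 p.
Proof.
move=> pp op; rewrite legendreN1 // /chi4 op -signr_odd.
by case: eqP => h; [have -> : odd p.-1./2 = false by lia|have -> : odd p.-1./2 = true by lia].
Qed.

Section SumTwoSquaresOdd.
Variables (R : realType) (K : fieldType) (s : K) (a b f : nat) (k r : int).
Hypothesis K_char0 : [pchar K] =i pred0.
Hypothesis ab_sqf : squarefree (a * b).
Hypothesis s_sqr : s ^+ 2 = (a * b)%:R.
Hypothesis f_val : f = 2%N \/ f = 4%N.
Hypothesis rel : a%:Z * k ^+ 2 - b%:Z * r ^+ 2 = f%:Z.

Let f_ndvd p : prime p -> odd p -> ~~ (p %| f)%N.
Proof.
move=> pp op; have n2 : ~~ (p %| 2)%N by rewrite dvdn_prime2 //; case: eqP op => // ->.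
by case: f_val => -> //; rewrite (@Euclid_dvdM 2 2) // negb_or n2.
Qed.

Let legendre_sqr_factor p (x y : int) : prime p -> odd p -> (p %| x * y ^+ 2 - f%:Z)%Z ->
  legendre p x = legendre p f.
Proof.
move=> pp op pxy; rewrite -(legendre_eqmod pp pxy) legendreM //.
have [py|py] := boolP (p %| y)%Z; last by rewrite legendre_sqr ?mulr1.
case/negP: (f_ndvd pp op); rewrite -[(p %| f)%N]/(p %| f%:Z)%Z.
have -> : f%:Z = x * y ^+ 2 - (x * y ^+ 2 - f%:Z) by ring.
by apply: rpredB pxy; rewrite expr2 !dvdz_mull.
Qed.

(** Modulo a prime dividing b the relation reads a k^2 = f, modulo one dividing a it reads - b r^2 =
    f; the sign accounts for [chi4 p]. *)
Let legendre_cof p : prime p -> odd p -> (p %| a * b)%N ->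
  legendre p (if (p %| a)%N then b else a)%:Z =
  legendre p f * (if (p %| a)%N then chi4 p else 1).
Proof.
move=> pp op; rewrite Euclid_dvdM //; case: ifP => [pa _|_ /= pb].
  have pN1 : ~~ (p %| -1)%Z by rewrite dvdzE /= Euclid_dvd1.
  have -> : legendre p b = legendre p (- b%:Z) * legendre p (-1).
    by rewrite -legendreM //; congr legendre; ring.
  rewrite legendreN1_chi4 // (@legendre_sqr_factor p (- b%:Z) r) //.
  have -> : - b%:Z * r ^+ 2 - f%:Z = - (a%:Z * k ^+ 2) by rewrite -rel; ring.
  by rewrite rpredN dvdz_mulr // dvdzE.
rewrite mulr1 (@legendre_sqr_factor p a k) //.
have -> : a%:Z * k ^+ 2 - f%:Z = b%:Z * r ^+ 2 by rewrite -rel; ring.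
by rewrite dvdz_mulr // dvdzE.
Qed.

Let prod_chi4_dvd : odd (a * b) ->
  \prod_(p <- primes (a * b)) (if (p %| a)%N then chi4 p else 1) = chi4 a.
Proof.
move=> oab; have a_sqf : squarefree a := squarefree_dvd (dvdn_mulr b (dvdnn a)) ab_sqf.
rewrite -big_mkcond (squarefree_morph a_sqf (g := chi4)) //; last exact: chi4M.
rewrite -big_filter; apply: perm_big; apply: uniq_perm; rewrite ?filter_uniq ?primes_uniq //.
move=> p; rewrite mem_filter !mem_primes squarefree_gt0 // squarefree_gt0 //.
by case: (prime p); rewrite ?andbF //=; case: (boolP (p %| a)%N) => //= pa; rewrite dvdn_mulr.
Qed.

(** The left side of the hypothesis is the product of the prescribed symbols: c0 f is the square 4,
    or it is 2 or 8, whose symbol at p is [chi8 p]. *)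
Lemma sum2sq_odd_relation (c0 : nat) : odd (a * b) -> c0 = 1%N \/ c0 = 2%N ->
  (if (c0 * f == 4)%N then 1 else chi8 (a * b)) * chi4 a = 1 -> sum2sq (a%:R : K).
Proof.
move=> oab c0v H; apply: (@sum2sq_cofactor R K s a b c0 K_char0 ab_sqf s_sqr).
  by case: c0v => ->; [left|right].
move=> _; rewrite -[RHS]H -(prod_chi4_dvd oab).
have -> : (if (c0 * f == 4)%N then 1 else chi8 (a * b)) =
    \prod_(p <- primes (a * b)) (if (c0 * f == 4)%N then 1 else chi8 p).
  case: ifP => _; first by rewrite big1.
  exact: squarefree_morph ab_sqf _ chi8M.
rewrite -big_split; apply: eq_big_seq => p; rewrite mem_primes => /and3P [pp _ pab] /=.
have op : odd p by case/dvdnP: pab oab => j ->; rewrite oddM => /andP [].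
rewrite PoszM legendreM // legendre_cof // mulrA -legendreM // -PoszM; congr (_ * _).
have p2 : ~~ (p %| 2)%Z by rewrite dvdzE /= dvdn_prime2 //; case: eqP op => // ->.
case: ifP => [/eqP ->|].
  by rewrite -[4%:Z]/(2 ^+ 2 : int) legendre_sqr.
case: c0v f_val => -> [] -> //= _; rewrite -legendre2 //.
by rewrite -[(2 * 4)%N%:Z]/(2 * 2 ^+ 2 : int) legendreM // legendre_sqr // mulr1.
Qed.
End SumTwoSquaresOdd.

Lemma sqrn_mod16 (k : nat) : (k ^ 2 %% 16 \in [:: 0; 1; 4; 9])%N.
Proof.
rewrite -modnXm; have := ltn_pmod k (isT : 0 < 16)%N; move: (k %% 16)%N => j.
by do 16![case: j => [//|j]].
Qed.

Lemma all_mod16_relation :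
  (all (fun K => all (fun L => all (fun m => all (fun n =>
     [==> odd m, odd n, (m * K) %% 16 == (n * L + 4) %% 16, m %% 4 == 3 => ((n %% 4) * (m %% 4)) %% 4 == 1])
    (iota 0 16)) (iota 0 16)) [:: 0; 1; 4; 9]) [:: 0; 1; 4; 9])%N.
Proof. by vm_compute. Qed.

Lemma mod16_relation m n k r : odd m -> odd n -> (m * k ^ 2 = n * r ^ 2 + 4)%N ->
  (m %% 4 = 3 -> ((n %% 4) * (m %% 4)) %% 4 = 1)%N.
Proof.
move=> om on h h3.
have mem16 j : (j %% 16)%N \in iota 0 16 by rewrite mem_iota ltn_pmod.
have := all_mod16_relation => /allP/(_ _ (sqrn_mod16 k))/allP/(_ _ (sqrn_mod16 r)).
move=> /allP/(_ _ (mem16 m))/allP/(_ _ (mem16 n)).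
have e : ((m %% 16) * (k ^ 2 %% 16) = (n %% 16) * (r ^ 2 %% 16) + 4 %[mod 16])%N.
  by rewrite modnMm h -[RHS]modnDml modnMm modnDml.
rewrite e eqxx !modn_dvdm // h3 eqxx.
have -> : odd (m %% 16) by lia. have -> : odd (n %% 16) by lia.
by move=> /eqP.
Qed.

Lemma all_mod8_relation :
  (all (fun K => all (fun L => all (fun m => all (fun n =>
     [==> odd m, odd n, (m * K) %% 16 == (n * L + 2) %% 16 =>
      (((m * n) %% 8 == 3) && (m %% 4 == 3)) || (((m * n) %% 8 == 7) && (m %% 4 == 1))])
    (iota 0 16)) (iota 0 16)) [:: 0; 1; 4; 9]) [:: 0; 1; 4; 9])%N.
Proof. by vm_compute. Qed.

Lemma mod8_relation m n k r : odd m -> odd n -> (m * k ^ 2 = n * r ^ 2 + 2)%N ->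
  ((m * n %% 8 = 3 /\ m %% 4 = 3) \/ (m * n %% 8 = 7 /\ m %% 4 = 1))%N.
Proof.
move=> om on h.
have mem16 j : (j %% 16)%N \in iota 0 16 by rewrite mem_iota ltn_pmod.
have := all_mod8_relation => /allP/(_ _ (sqrn_mod16 k))/allP/(_ _ (sqrn_mod16 r)).
move=> /allP/(_ _ (mem16 m))/allP/(_ _ (mem16 n)).
have e : ((m %% 16) * (k ^ 2 %% 16) = (n %% 16) * (r ^ 2 %% 16) + 2 %[mod 16])%N.
  by rewrite modnMm h -[RHS]modnDml modnMm modnDml.
rewrite e eqxx.
have -> : (((m %% 16) * (n %% 16)) %% 8 = m * n %% 8)%N by rewrite -modnMm !modn_dvdm // modnMm.
rewrite !modn_dvdm //.
have -> : odd (m %% 16) by lia. have -> : odd (n %% 16) by lia.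
by move=> /orP [] /andP [/eqP -> /eqP ->]; [left|right].
Qed.

(** * Consequences of the relation between d, m, k and r *)

Section PellTypeRelation.
Variables (d m k r : nat).
Hypothesis d_sqf : squarefree d.
Hypothesis m_sqf : squarefree m.
Hypothesis rel : (d * r ^ 2 + 4 * m = m ^ 2 * k ^ 2)%N.

(** Otherwise p divides r, and then p^2 divides 4 m, against the squarefreeness of m. *)
Lemma odd_prime_dvd_disc p : prime p -> odd p -> (p %| m)%N -> (p %| d)%N.
Proof.
move=> pp op pm; have m0 := squarefree_gt0 m_sqf.
have : (p %| d * r ^ 2)%N.
  by rewrite -(dvdn_addl _ (dvdn_mull 4 pm)) rel -mulnn -mulnA dvdn_mulr.
rewrite Euclid_dvdM // => /orP [//|]; rewrite Euclid_dvdX // => /andP [pr _].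
have : (p ^ 2 %| 4 * m)%N.
  rewrite -(dvdn_addr _ (dvdn_mull d (dvdn_exp2r 2 pr))) rel dvdn_mulr //.
  exact: dvdn_exp2r.
have cp4 : coprime (p ^ 2) 4.
  by rewrite coprimeXl // -[4%N]/(2 ^ 2)%N coprimeXr // coprimen2.
by rewrite Gauss_dvdr // => /m_sqf p1; move: pp; rewrite p1.
Qed.

Lemma squarefree_part_dvd_disc : odd m || ~~ odd d -> (m %| d)%N.
Proof.
move=> od; apply: squarefree_dvdP => // p pp pm.
have [p2|op] := even_prime pp; last exact: odd_prime_dvd_disc.
by move: od pm; rewrite p2 !dvdn2; case: (odd m).
Qed.

Lemma relation_cofactor n : d = (m * n)%N -> (m * k ^ 2 = n * r ^ 2 + 4)%N.
Proof.
move=> dE; have m0 := squarefree_gt0 m_sqf; apply/eqP; rewrite -(eqn_pmul2l m0).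
by move: rel; rewrite dE => h; apply/eqP; nia.
Qed.

Lemma relation_odd_odd : odd d -> odd m -> (m %% 4 = 3 -> d %% 4 = 1)%N.
Proof.
move=> od om; have /dvdnP [n dE] : (m %| d)%N by apply: squarefree_part_dvd_disc; rewrite om.
have on : odd n by move: od; rewrite dE oddM => /andP [].
have := relation_cofactor (etrans dE (mulnC _ _)); move/(mod16_relation om on).
by rewrite dE; move=> H /H e; rewrite -modnMm e.
Qed.

Lemma relation_odd_even m' n : odd n -> odd m' -> d = (m' * n)%N -> m = (2 * m')%N ->
  exists r', r = (2 * r')%N /\ (m' * k ^ 2 = n * r' ^ 2 + 2)%N.
Proof.
move=> on om dE mE; have m0 : (0 < m')%N by move: om; case: (m').
have h : (n * r ^ 2 + 8 = 4 * m' * k ^ 2)%N.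
  by apply/eqP; rewrite -(eqn_pmul2l m0); apply/eqP; move: rel; rewrite dE mE; nia.
have er : ~~ odd r.
  by apply/negP => orr; have /(congr1 odd) := h; rewrite oddD !oddM on orr.
have /dvdnP [r' rE] : (2 %| r)%N by rewrite dvdn2.
by exists r'; rewrite rE mulnC; split=> //; move: h; rewrite rE; nia.
Qed.
End PellTypeRelation.

Lemma sum2sq_squarefree_part (R : realType) (K : fieldType) (s : K) (d m k r : nat) :
  [pchar K] =i pred0 -> squarefree d -> squarefree m -> s ^+ 2 = d%:R ->
  (d * r ^ 2 + 4 * m = m ^ 2 * k ^ 2)%N -> ~ (d %% 8 = 1 /\ m %% 4 = 3)%N ->
  sum2sq (m%:R : K).
Proof.
move=> K0 sd sm ssq rel ncond.
have [od|ed] := boolP (odd d); last first.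
  have /dvdnP [n dE] : (m %| d)%N by apply: (squarefree_part_dvd_disc sm rel); rewrite ed orbT.
  rewrite mulnC in dE; rewrite dE in sd ssq ed.
  apply: (@sum2sq_cofactor R K s m n 1 K0 sd ssq); first by left.
  by move=> o; rewrite o in ed.
have [om|em] := boolP (odd m).
  have /dvdnP [n dE] : (m %| d)%N by apply: (squarefree_part_dvd_disc sm rel); rewrite om.
  rewrite mulnC in dE; have relZ : m%:Z * k%:Z ^+ 2 - n%:Z * r%:Z ^+ 2 = 4%N%:Z.
    by have := relation_cofactor sm rel dE; clear; lia.
  have h3 := relation_odd_odd sm rel od om.
  rewrite dE in sd ssq od.
  have [m1|m1] := eqVneq (m %% 4)%N 1%N.
    apply: (@sum2sq_odd_relation R K s m n 4 k%:Z r%:Z K0 sd ssq _ relZ 1) => //; try by [left|right].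
    by rewrite /chi4 om m1.
  have m3 : (m %% 4 = 3)%N by clear -m1 om; lia.
  have d8 : (d %% 8 = 5)%N by clear -h3 m3 ncond; lia.
  (* With c0 = 2 the factor [chi8 d] = -1 enters and compensates [chi4 m] = -1; for d = 1 mod 8 it
     could not. *)
  apply: (@sum2sq_odd_relation R K s m n 4 k%:Z r%:Z K0 sd ssq _ relZ 2) => //; try by right.
  by rewrite /= /chi8 /chi4 od om -dE d8 m3.
have /dvdnP [m' mE] : (2 %| m)%N by rewrite dvdn2.
rewrite mulnC in mE.
have m'_sqf : squarefree m' by apply: squarefree_dvd sm; rewrite mE dvdn_mull.
have om' : odd m'.
  apply/negPn/negP => e; have : (2 ^ 2 %| m)%N by rewrite mE dvdn_pmul2l // dvdn2.
  by move/sm.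
have /dvdnP [n dE] : (m' %| d)%N.
  apply: squarefree_dvdP => // p pp pm'; apply: (odd_prime_dvd_disc sm rel pp).
    by case/dvdnP: pm' om' => j ->; rewrite oddM => /andP [].
  by rewrite mE dvdn_mull.
rewrite mulnC in dE.
have on : odd n by move: od; rewrite dE oddM => /andP [].
have [r' [_ rel']] := relation_odd_even rel on om' dE mE.
have relZ : m'%:Z * k%:Z ^+ 2 - n%:Z * r'%:Z ^+ 2 = 2%N%:Z by move: rel'; clear; lia.
(* Here f = 2. If d = 3 mod 8, take c0 = 1: [chi8 d] and [chi4 m'] are both -1. If d = 7 mod 8, take
   c0 = 2: c0 f is a square and [chi4 m'] is 1. *)
have M8 := mod8_relation om' on rel'.
rewrite mE natrM; apply: sum2sqM; first exact: sum2sq2.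
rewrite dE in sd ssq od.
case: M8 => -[d8 m4].
  apply: (@sum2sq_odd_relation R K s m' n 2 k%:Z r'%:Z K0 sd ssq _ relZ 1) => //; try by left.
  by rewrite /= /chi8 /chi4 od om' d8 m4.
apply: (@sum2sq_odd_relation R K s m' n 2 k%:Z r'%:Z K0 sd ssq _ relZ 2) => //; try by [left|right].
by rewrite /= /chi4 om' m4.
Qed.

Lemma all_mod16_two_forms :
  (all (fun X => all (fun W => all (fun Y => all (fun Z =>
    all (fun m => all (fun d => [==> m %% 4 == 3, m * (Y + Z) == X + d * W %[mod 16] =>
       ~~ odd (X + W) && ~~ odd X && ~~ odd Y && ~~ odd Z])
    [:: 1; 9]) [:: 3; 7; 11; 15]) [:: 0; 1; 4; 9]) [:: 0; 1; 4; 9]) [:: 0; 1; 4; 9]) [:: 0; 1; 4; 9])%N.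
Proof. by vm_compute. Qed.

(** Infinite descent: modulo 16 the equation forces x, w, y, z to be even. *)
Lemma two_forms_anisotropic (d m x w y z : nat) : (d %% 8 = 1)%N -> (m %% 4 = 3)%N ->
  (m * (y ^ 2 + z ^ 2) = x ^ 2 + d * w ^ 2)%N -> (x = 0 /\ w = 0)%N.
Proof.
move=> d8 m4; have [n le] := ubnP (x + w)%N; elim: n => // n IH in x w y z le *.
move=> h; have [xw0|xw0] := posnP (x + w)%N.
  by move/eqP: xw0; rewrite addn_eq0 => /andP [/eqP -> /eqP ->].
have m16 : (m %% 16 \in [:: 3; 7; 11; 15])%N by rewrite !inE; clear -m4; lia.
have d16 : (d %% 16 \in [:: 1; 9])%N by rewrite !inE; clear -d8; lia.
have := all_mod16_two_forms => /allP/(_ _ (sqrn_mod16 x))/allP/(_ _ (sqrn_mod16 w)).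
move=> /allP/(_ _ (sqrn_mod16 y))/allP/(_ _ (sqrn_mod16 z))/allP/(_ _ m16)/allP/(_ _ d16).
have e : ((m %% 16) * (y ^ 2 %% 16 + z ^ 2 %% 16) = x ^ 2 %% 16 + (d %% 16) * (w ^ 2 %% 16) %[mod 16])%N.
  by rewrite -modnMmr modnDm modnMm h -[RHS]modnDmr modnMm modnDm.
rewrite modn_dvdm // m4 e !eqxx /=.
have oddsq j : odd (j ^ 2 %% 16) = odd j.
  have -> : odd (j ^ 2 %% 16) = odd (j ^ 2) by clear; move: (j ^ 2)%N => i; lia.
  exact: (oddX j 2).
rewrite oddD !oddsq => /andP [/andP [/andP [ow ox] oy] oz].
rewrite (negbTE ox) addFb in ow.
have [x' xE] : exists x', x = (2 * x')%N by exists x./2; clear -ox; lia.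
have [w' wE] : exists w', w = (2 * w')%N by exists w./2; clear -ow; lia.
have [y' yE] : exists y', y = (2 * y')%N by exists y./2; clear -oy; lia.
have [z' zE] : exists z', z = (2 * z')%N by exists z./2; clear -oz; lia.
have [x0 w0] : (x' = 0 /\ w' = 0)%N.
  apply: (IH x' w' y' z'); first by clear -le xE wE xw0; lia.
  by move: h; rewrite xE wE yE zE; clear; nia.
by rewrite xE wE x0 w0.
Qed.

(** * Squares modulo 4 *)

Lemma int_parity (n : int) : (exists a, n = 2 * a) \/ (exists a, n = 2 * a + 1).
Proof.
have h := divz_eq n 2; have [e|e] : (n %% 2)%Z = 0 \/ (n %% 2)%Z = 1 by lia.
  by left; exists (n %/ 2)%Z; lia.
by right; exists (n %/ 2)%Z; lia.
Qed.

Lemma sqr_odd_mod8 (a : int) : exists b, (2 * a + 1) ^+ 2 = 8 * b + 1.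
Proof.
have [[b ->]|[b ->]] := int_parity a; first by exists (2 * b ^+ 2 + b); ring.
by exists (2 * b ^+ 2 + 3 * b + 1); ring.
Qed.

(** The two equations are the coordinates of eps = a^2 + 4 b with a = (x + y sqrt d) / 2 and b = (z
    + w sqrt d) / 2; the last two hypotheses say that a and b have integral norm. As d = 1 mod 4,
    the latter make x, y of equal parity, and likewise z, w. *)
Lemma unit_square_1mod4 (d m k r x y z w : int) : (exists e, d = 4 * e + 1) -> (exists f, m = 4 * f + 3) ->
  d * r ^+ 2 = m * (m * k ^+ 2 - 4) ->
  2 * (m * k ^+ 2 - 2) = x ^+ 2 + d * y ^+ 2 + 8 * z -> k * r = x * y + 4 * w ->
  (exists g, x ^+ 2 - d * y ^+ 2 = 4 * g) -> (exists h, z ^+ 2 - d * w ^+ 2 = 4 * h) -> False.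
Proof.
move=> [e dE] [f mE] H3 H1 H2 [g G] [h H].
have zw : exists j, z = w + 2 * j.
  have [[z1 zE]|[z1 zE]] := int_parity z; have [[w1 wE]|[w1 wE]] := int_parity w.
  - by exists (z1 - w1); rewrite zE wE; ring.
  - have [b B] := sqr_odd_mod8 w1; move: H; rewrite wE zE B dE => H; clear -H; lia.
  - have [b B] := sqr_odd_mod8 z1; move: H; rewrite wE zE B dE => H; clear -H; lia.
  - by exists (z1 - w1); rewrite zE wE; ring.
have [[x1 xE]|[x1 xE]] := int_parity x; have [[y1 yE]|[y1 yE]] := int_parity y.
- have [[k1 kE]|[k1 kE]] := int_parity k; last first.
    have [a A] := sqr_odd_mod8 k1; move: H1; rewrite kE A xE yE mE => H1; clear -H1; lia.
  have [[r1 rE]|[r1 rE]] := int_parity r; last first.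
    have [b B] := sqr_odd_mod8 r1; move: H3; rewrite rE B kE dE => H3; clear -H3; lia.
  have H1' : 2 * m * k1 ^+ 2 - 1 = x1 ^+ 2 + d * y1 ^+ 2 + 2 * z.
    by move: H1; rewrite kE xE yE => H1; clear -H1; lia.
  have H3' : d * r1 ^+ 2 = m * (m * k1 ^+ 2 - 1).
    by move: H3; rewrite rE kE => H3; clear -H3; lia.
  have H2' : k1 * r1 = x1 * y1 + w by move: H2; rewrite kE rE xE yE => H2; clear -H2; lia.
  have [j jE] := zw; clear zw H1 H2 H3 G H.
  have [c cE] : exists c, x1 * y1 = 2 * c /\ exists l, x1 ^+ 2 + d * y1 ^+ 2 = 4 * l + 1.
    have [[x2 x2E]|[x2 x2E]] := int_parity x1; have [[y2 y2E]|[y2 y2E]] := int_parity y1.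
    + by exfalso; move: H1'; rewrite x2E y2E => H1; clear -H1; lia.
    + exists (x2 * y1); split; first by rewrite x2E; ring.
      have [b B] := sqr_odd_mod8 y2; exists (x2 ^+ 2 + 2 * d * b + e); rewrite y2E B x2E dE; ring.
    + exists (x1 * y2); split; first by rewrite y2E; ring.
      have [b B] := sqr_odd_mod8 x2; exists (2 * b + d * y2 ^+ 2); rewrite x2E B y2E; ring.
    + have [b B] := sqr_odd_mod8 x2; have [b' B'] := sqr_odd_mod8 y2; exfalso.
      by move: H1'; rewrite x2E y2E B B' dE => H1; clear -H1; lia.
  case: cE => cE [l lE].
  have [[k2 kE2]|[k2 kE2]] := int_parity k1.
    by move: H2' H1'; rewrite cE lE kE2 jE => H2 H1; clear -H2 H1; lia.
  have [a A] := sqr_odd_mod8 k2.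
  have [[r2 rE2]|[r2 rE2]] := int_parity r1.
    by move: H3'; rewrite kE2 A rE2 mE => H3; clear -H3; lia.
  by move: H2' H1'; rewrite cE lE kE2 A jE rE2 mE => H2 H1; clear -H2 H1; lia.
- have [b B] := sqr_odd_mod8 y1.
  by move: G; rewrite yE B xE dE => G; clear -G; lia.
- have [b B] := sqr_odd_mod8 x1.
  by move: G; rewrite xE B yE dE => G; clear -G; lia.
have [b B] := sqr_odd_mod8 x1; have [b' B'] := sqr_odd_mod8 y1.
have [[k1 kE]|[k1 kE]] := int_parity k; first by move: H2; rewrite xE yE kE => H2; clear -H2; lia.
have [[r1 rE]|[r1 rE]] := int_parity r; first by move: H2; rewrite xE yE rE => H2; clear -H2; lia.
have [a A] := sqr_odd_mod8 k1; have [a' A'] := sqr_odd_mod8 r1.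
move: H1 H3; rewrite xE yE kE rE A A' B B' dE mE => H1 H3; clear -H1 H3.
have [[u uE]|[u uE]] := int_parity e; rewrite uE in H1 H3; first by clear -H3; lia.
by clear -H1; lia.
Qed.

(* For [d = 3 mod 4] and [m] even the coefficient [k r / 2] of the unit is odd,
   while it is even for a square modulo 4. *)
Lemma unit_square_3mod4 (d m' k r x y w : int) : (exists e, d = 4 * e + 3) -> (exists f, m' = 2 * f + 1) ->
  d * r ^+ 2 = 2 * m' * (2 * m' * k ^+ 2 - 4) -> k * r = x * y + 4 * w ->
  (exists g, x ^+ 2 - d * y ^+ 2 = 4 * g) -> False.
Proof.
move=> [e dE] [f mE] H3 H2 [g G].
have [[x1 xE]|[x1 xE]] := int_parity x; have [[y1 yE]|[y1 yE]] := int_parity y.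
- have [[r1 rE]|[r1 rE]] := int_parity r; last first.
    have [b B] := sqr_odd_mod8 r1; move: H3; rewrite rE B dE => H3; clear -H3; lia.
  have H3' : d * r1 ^+ 2 = m' * (m' * k ^+ 2 - 2) by move: H3; rewrite rE => H3; clear -H3; lia.
  clear H3; have [[k1 kE]|[k1 kE]] := int_parity k.
    have [[r2 rE2]|[r2 rE2]] := int_parity r1.
      by move: H3'; rewrite kE rE2 mE => H3; clear -H3; lia.
    by have [b B] := sqr_odd_mod8 r2; move: H3'; rewrite kE rE2 B mE dE => H3; clear -H3; lia.
  have [a A] := sqr_odd_mod8 k1; have [[r2 rE2]|[r2 rE2]] := int_parity r1.
    by move: H3'; rewrite kE A rE2 mE => H3; clear -H3; lia.
  by move: H2; rewrite kE rE rE2 xE yE => H2; clear -H2; lia.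
- by have [b B] := sqr_odd_mod8 y1; move: G; rewrite yE B xE dE => G; clear -G; lia.
- by have [b B] := sqr_odd_mod8 x1; move: G; rewrite xE B yE dE => G; clear -G; lia.
have [b B] := sqr_odd_mod8 x1; have [b' B'] := sqr_odd_mod8 y1.
by move: G; rewrite xE yE B B' dE => G; clear -G; lia.
Qed.

Lemma even_of_norm_2mod4 (d x y g : int) : (exists e, d = 4 * e + 2) -> x ^+ 2 - d * y ^+ 2 = 4 * g ->
  (exists x1, x = 2 * x1) /\ (exists y1, y = 2 * y1).
Proof.
move=> [e dE] G; have [[x1 xE]|[x1 xE]] := int_parity x; last first.
  by have [b B] := sqr_odd_mod8 x1; move: G; rewrite xE B dE => G; clear -G; lia.
have [[y1 yE]|[y1 yE]] := int_parity y; last first.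
  by have [b B] := sqr_odd_mod8 y1; move: G; rewrite xE yE B dE => G; clear -G; lia.
by split; [exists x1|exists y1].
Qed.

(** The equations force k = 2 k1 with k1 odd and r divisible by 4, so 4 divides m k1^2 - 1. *)
Lemma unit_square_2mod4_odd (d m k r x y z w : int) : (exists e, d = 4 * e + 2) -> (exists f, m = 2 * f + 1) ->
  d * r ^+ 2 = m * (m * k ^+ 2 - 4) ->
  2 * (m * k ^+ 2 - 2) = x ^+ 2 + d * y ^+ 2 + 8 * z -> k * r = x * y + 4 * w ->
  (exists g, x ^+ 2 - d * y ^+ 2 = 4 * g) -> (exists h, z ^+ 2 - d * w ^+ 2 = 4 * h) ->
  exists f, m = 4 * f + 1.
Proof.
move=> dE [f mE] H3 H1 H2 [g G] [h H].
have [[x1 xE] [y1 yE]] := even_of_norm_2mod4 dE G.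
have [[z1 zE] [w1 wE]] := even_of_norm_2mod4 dE H.
case: dE => e dE; clear g G h H.
have [[k1 kE]|[k1 kE]] := int_parity k; last first.
  by have [b B] := sqr_odd_mod8 k1; move: H1; rewrite kE B xE yE zE mE => H1; clear -H1; lia.
have [[r1 rE]|[r1 rE]] := int_parity r; last first.
  by have [b B] := sqr_odd_mod8 r1; move: H3; rewrite rE B dE kE => H3; clear -H3; lia.
have H3' : d * r1 ^+ 2 = m * (m * k1 ^+ 2 - 1) by move: H3; rewrite rE kE => H3; clear -H3; lia.
have [[k2 kE2]|[k2 kE2]] := int_parity k1.
  by move: H3'; rewrite kE2 mE dE => H3'; clear -H3'; lia.
have [a A] := sqr_odd_mod8 k2; rewrite kE2 in kE H3'; rewrite A in H3'.
have {}H1 : 2 * m * (8 * a + 1) - 1 = x1 ^+ 2 + d * y1 ^+ 2 + 4 * z1.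
  by move: H1; rewrite kE -A xE yE zE => H1; clear -H1; lia.
have {}H2 : (2 * k2 + 1) * r1 = x1 * y1 + 2 * w1.
  by move: H2; rewrite kE rE xE yE wE => H2; clear -H2; lia.
have [[x2 xE2]|[x2 xE2]] := int_parity x1.
  by move: H1; rewrite xE2 dE => H1; clear -H1; lia.
have [b B] := sqr_odd_mod8 x2.
have [[y2 yE2]|[y2 yE2]] := int_parity y1; last first.
  have [b' B'] := sqr_odd_mod8 y2.
  by move: H1; rewrite xE2 B yE2 B' dE mE => H1; clear -H1; lia.
have [[r2 rE2]|[r2 rE2]] := int_parity r1; last first.
  by move: H2; rewrite rE2 yE2 => H2; clear -H2; lia.
have [[f1 fE]|[f1 fE]] := int_parity f; first by exists f1; rewrite mE fE; ring.
by move: H3'; rewrite rE2 mE fE => H3'; clear -H3'; lia.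
Qed.

(* With [d] and [m] both even the relation reads
   [d' r1^2 = m' (2 m' k1^2 - 1)], where [d = 2 d'], [m = 2 m'], [k = 2 k1], [r = 2 r1]. *)
Lemma relation_even_even (d' m' k r : int) : (exists e, d' = 2 * e + 1) -> (exists f, m' = 2 * f + 1) ->
  2 * d' * r ^+ 2 = 2 * m' * (2 * m' * k ^+ 2 - 4) ->
  exists k1 r1, [/\ k = 2 * k1, r = 2 * (2 * r1 + 1) & d' * (2 * r1 + 1) ^+ 2 = m' * (2 * m' * k1 ^+ 2 - 1)].
Proof.
move=> [e dE] [f mE] H.
have [[r1 rE]|[r1 rE]] := int_parity r; last first.
  by have [b B] := sqr_odd_mod8 r1; move: H; rewrite rE B dE mE => H; clear -H; lia.
have [[k1 kE]|[k1 kE]] := int_parity k; last first.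
  by have [b B] := sqr_odd_mod8 k1; move: H; rewrite rE kE B mE => H; clear -H; lia.
have {}H : d' * r1 ^+ 2 = m' * (2 * m' * k1 ^+ 2 - 1) by move: H; rewrite rE kE => H; clear -H; lia.
have [[r2 rE2]|[r2 rE2]] := int_parity r1.
  by move: H; rewrite rE2 mE => H; clear -H; lia.
by exists k1, r2; rewrite -rE2.
Qed.

(** Odd squares being 1 modulo 8, the relation reads d' + m' = 2 k1^2 modulo 8. Conditions (iv) and
    (v) together thus say that k1 is odd. *)
Lemma relation_even_even_mod8 (d' m' k1 r1 : int) : (exists f, m' = 2 * f + 1) ->
  d' * (2 * r1 + 1) ^+ 2 = m' * (2 * m' * k1 ^+ 2 - 1) ->
  ((exists k2, k1 = 2 * k2 + 1) -> exists j, d' + m' = 8 * j + 2) /\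
  ((exists k2, k1 = 2 * k2) -> exists j, d' + m' = 8 * j).
Proof.
move=> [f mE]; have [b ->] := sqr_odd_mod8 r1; have [c C] := sqr_odd_mod8 f.
have m2 : m' ^+ 2 = 8 * c + 1 by rewrite mE.
have -> : m' * (2 * m' * k1 ^+ 2 - 1) = 2 * m' ^+ 2 * k1 ^+ 2 - m' by ring.
rewrite m2 => H; split=> -[k2 kE]; rewrite kE in H.
  have [a A] := sqr_odd_mod8 k2; rewrite A in H.
  exists (16 * c * a + 2 * c + 2 * a - d' * b); clear -H; lia.
by exists (8 * c * k2 ^+ 2 + k2 ^+ 2 - d' * b); clear -H; lia.
Qed.

Lemma unit_square_2mod4_even (d' m' k1 r1 x y z w : int) :
  (exists e, d' = 2 * e + 1) -> (exists f, m' = 2 * f + 1) ->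
  d' * (2 * r1 + 1) ^+ 2 = m' * (2 * m' * k1 ^+ 2 - 1) ->
  2 * (2 * m' * (2 * k1) ^+ 2 - 2) = x ^+ 2 + 2 * d' * y ^+ 2 + 8 * z ->
  2 * k1 * (2 * (2 * r1 + 1)) = x * y + 4 * w ->
  (exists g, x ^+ 2 - 2 * d' * y ^+ 2 = 4 * g) -> (exists h, z ^+ 2 - 2 * d' * w ^+ 2 = 4 * h) ->
  exists k2, k1 = 2 * k2 + 1.
Proof.
move=> [e dE] [f mE] H3 H1 H2 [g G] [h H].
have d4 : exists e, 2 * d' = 4 * e + 2 by exists e; rewrite dE; ring.
have [[x1 xE] [y1 yE]] := even_of_norm_2mod4 d4 G.
have [[z1 zE] [w1 wE]] := even_of_norm_2mod4 d4 H.
have {}H1 : 4 * m' * k1 ^+ 2 - 1 = x1 ^+ 2 + 2 * d' * y1 ^+ 2 + 4 * z1.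
  by move: H1; rewrite xE yE zE => H1; clear -H1; lia.
have {}H2 : k1 * (2 * r1 + 1) = x1 * y1 + 2 * w1 by move: H2; rewrite xE yE wE => H2; clear -H2; lia.
have [[x2 xE2]|[x2 xE2]] := int_parity x1; first by move: H1; rewrite xE2 => H1; clear -H1; lia.
have [b B] := sqr_odd_mod8 x2; have [[y2 yE2]|[y2 yE2]] := int_parity y1.
  by move: H1; rewrite xE2 B yE2 => H1; clear -H1; lia.
have [[k2 kE2]|//] := int_parity k1.
by move: H2; rewrite kE2 xE2 yE2 => H2; clear -H2; lia.
Qed.

(** * Quadratic fields *)

(** The square of the denominator of y is coprime to the numerator, so it divides d. *)
Lemma squarefree_sqr_int (d : nat) (y : rat) (n : int) : squarefree d ->
  d%:R * y ^+ 2 = n%:~R -> exists z : int, y = z%:~R.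
Proof.
move=> sd dy; have q0 : (denq y)%:~R != 0 :> rat by rewrite intr_eq0 denq_neq0.
have E : d%:Z * numq y ^+ 2 = n * denq y ^+ 2.
  apply: (@intr_inj rat); rewrite !expr2 !intrM -!expr2.
  rewrite -dy -{2}(divq_num_den y) -pmulrn; field.
  exact: q0.
have : (`|denq y| ^ 2 %| d * `|numq y| ^ 2)%N.
  by apply/dvdnP; exists `|n|%N; rewrite -!abszX -[d]/`|d%:Z|%N -!abszM E.
rewrite Gauss_dvdl; last by rewrite coprimeXl // coprimeXr // coprime_sym coprime_num_den.
move/sd => d1; exists (numq y); rewrite -{1}(divq_num_den y).
have -> : denq y = 1 by have := denq_gt0 y; move: d1; clear; lia.
by rewrite divr1.
Qed.

Lemma integral_rat_int (y : rat) : integralOver (intr : int -> rat) y -> exists z : int, y = z%:~R.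
Proof.
move=> iy; have Ay : (ratr y : algC) \in Aint.
  have [p pm rp] := iy.
  apply: (@root_monic_Aint (map_poly intr p)).
  - have -> : map_poly intr p = map_poly (ratr : rat -> algC) (map_poly intr p).
      by rewrite -map_poly_comp; apply: eq_map_poly => z /=; rewrite ratr_int.
    by rewrite fmorph_root.
  - exact: monic_map.
  - by apply/polyOverP => i; rewrite coef_map /= intr_int.
have /Cint_rat_Aint/(_ Ay)/intrP [z zE] := Crat_rat y.
by exists z; apply: (fmorph_inj (ratr : rat -> algC)); rewrite rmorph_int.
Qed.

(* A copy of [in_alg] that simplification does not unfold. *)
Definition rat_in (K : algType rat) (x : rat) : K := GRing.in_alg K x.
HB.instance Definition _ (K : algType rat) := GRing.RMorphism.copy (rat_in K) (GRing.in_alg K).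

Section QuadraticField.
Variables (d : nat) (K : splittingFieldType rat) (s : K).
Hypothesis d_sqf : squarefree d.
Hypothesis s_sqr : s ^+ 2 = d%:R.
Hypothesis K_gen : <<1; s>>%VS = fullv.
Hypothesis K_dim : \dim {:K} = 2%N.

Local Notation qK := (rat_in K).

Lemma numfield_char0 : [pchar K] =i pred0.
Proof. by move=> p; rewrite (pchar_lalg K) pchar_num. Qed.

Lemma gen_notin_base : s \notin 1%VS.
Proof.
apply/negP => /(@Fadjoin_idP _ _ 1%AS s) e.
by have := K_dim; rewrite -K_gen e dimv1.
Qed.

Lemma quadratic_coord z : exists x y : rat, z = qK x + qK y * s.
Proof.
have s0 : s != 0 by apply/eqP => e; move: gen_notin_base; rewrite e mem0v.
have cap : (1 :&: <[s]> = 0)%VS.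
  apply/eqP; rewrite -subv0; apply/subvP => w; rewrite memv_cap => /andP [w1 /vlineP [y wE]].
  rewrite memv0 wE; have [->|y0] := eqVneq y 0; first by rewrite scale0r.
  case/negP: gen_notin_base; rewrite -[s](scalerK y0).
  by rewrite memvZ // -wE.
have full : (1 + <[s]> = fullv)%VS.
  apply/eqP; rewrite eqEdim subvf /= dimv_disjoint_sum // dimv1 dim_vline s0.
  by have := K_dim; rewrite dimvf => ->.
have : z \in (1 + <[s]>)%VS by rewrite full memvf.
case/memv_addP => u /vlineP [x ->] [v /vlineP [y ->] ->].
by exists x, y; rewrite /rat_in /= mulr_algl.
Qed.

Lemma quadratic_coord_inj x y x' y' : qK x + qK y * s = qK x' + qK y' * s -> x = x' /\ y = y'.
Proof.
move=> e; have : qK (y - y') * s = qK (x' - x).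
  by rewrite !rmorphB mulrBl /= -[qK y * s](addKr (qK x)) e; ring.
have [/eqP|ny] := eqVneq (y - y') 0.
  rewrite subr_eq0 => /eqP ->; rewrite subrr rmorph0 mul0r => /esym/eqP.
  by rewrite fmorph_eq0 subr_eq0 => /eqP ->.
move=> h; case/negP: gen_notin_base.
have -> : s = qK ((x' - x) / (y - y')).
  rewrite fmorph_div /= -h mulrC mulKf // fmorph_eq0 //.
by rewrite /rat_in in_algE memvZ // mem1v.
Qed.

Lemma quadratic_conj_exists : exists c : {rmorphism K -> K},
  [/\ c s = - s, forall x, c (qK x) = qK x & forall z, galNorm 1 {:K} z = z * c z].
Proof.
have galK : galois 1 {:K}.
  rewrite /galois sub1v normalFieldf andbT; apply/separableP => z _.
  exact: pcharf0_separable numfield_char0 z.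
have cG : #|'Gal({:K} / 1)%g| = 2%N by rewrite -(galois_dim galK) dimv1 K_dim.
have /cards1P [c cE] : #|('Gal({:K} / 1)%g :\ 1%g)%SET| == 1%N.
  by have := cardsD1 1%g ('Gal({:K} / 1)%g); rewrite cG group1; case: #|_| => [|[]].
have /andP [cn1 cG1] : (c != 1%g) && (c \in 'Gal({:K} / 1)%g).
  by have := finset.in_setD1 c ('Gal({:K} / 1)%g) 1%g; rewrite cE finset.set11 => <-.
have cQ x : c (qK x) = qK x by rewrite (fixed_gal _ cG1) ?sub1v // /rat_in in_algE memvZ // mem1v.
have cs : c s = - s.
  have : (c s) ^+ 2 == s ^+ 2 by rewrite -rmorphXn s_sqr rmorph_nat.
  rewrite eqf_sqr => /orP [/eqP e|/eqP //]; case/eqP: cn1; apply/eqP/gal_eqP => z _.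
  by have [x [y ->]] := quadratic_coord z; rewrite gal_id rmorphD rmorphM /= cQ cQ e.
exists c; split=> // z; rewrite /galNorm (big_setD1 1%g) ?group1 //= gal_id.
by rewrite cE big_set1.
Qed.
End QuadraticField.

Section QuadraticIntegers.
Variables (d : nat) (K : splittingFieldType rat) (s : K).
Hypothesis d_sqf : squarefree d.
Hypothesis s_sqr : s ^+ 2 = d%:R.
Hypothesis K_gen : <<1; s>>%VS = fullv.
Hypothesis K_dim : \dim {:K} = 2%N.
Local Notation qK := (rat_in K).

Lemma integral_rat_in (x : rat) : integralOver (intr : int -> K) (qK x) ->
  exists z : int, x = z%:~R.
Proof.
case=> p pm rp; apply: integral_rat_int; exists p => //.
rewrite -(fmorph_root (rat_in K)) -map_poly_comp.
by congr (root _ _) : rp; apply: eq_map_poly => z /=; rewrite rmorph_int.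
Qed.

Let qK_norm x y : qK (x ^+ 2 - d%:R * y ^+ 2) = qK x ^+ 2 - s ^+ 2 * qK y ^+ 2.
Proof. by rewrite s_sqr rmorphB /= !expr2 !rmorphM /= rmorph_nat. Qed.

Lemma galNorm_coord x y : galNorm 1 {:K} (qK x + qK y * s) = qK (x ^+ 2 - d%:R * y ^+ 2).
Proof.
have [c [cs cQ ->]] := quadratic_conj_exists s_sqr K_gen K_dim.
by rewrite rmorphD rmorphM /= cs !cQ qK_norm; ring.
Qed.

(** Trace and norm are rational and integral, hence integers, and squarefreeness of d bounds the
    denominator of the second coordinate. With its converse [integral_half] this describes the
    integers for all d at once, without a case on d modulo 4. *)
Lemma ringOfIntegers_coord z : ringOfIntegers z -> exists a b n : int,
  z = qK (a%:~R / 2) + qK (b%:~R / 2) * s /\ a ^+ 2 - d%:Z * b ^+ 2 = 4 * n.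
Proof.
move=> iz; have [c [cs cQ _]] := quadratic_conj_exists s_sqr K_gen K_dim.
have icz : integralOver (intr : int -> K) (c z).
  have [p pm rp] := iz; exists p => //; rewrite -(fmorph_root c) -map_poly_comp in rp.
  by congr (root _ _) : rp; apply: eq_map_poly => t /=; rewrite rmorph_int.
have [x [y zE]] := quadratic_coord K_gen K_dim z.
have trE : z + c z = qK (2 * x).
  by rewrite zE rmorphD [c (_ * _)]rmorphM /= cs !cQ rmorphM rmorph_nat /=; ring.
have nmE : z * c z = qK (x ^+ 2 - d%:R * y ^+ 2).
  by rewrite zE rmorphD rmorphM /= cs !cQ qK_norm; ring.
have [a aE] : exists a : int, 2 * x = a%:~R.
  by apply: integral_rat_in; rewrite -trE; exact: integral_add.
have [n nE] : exists n : int, x ^+ 2 - d%:R * y ^+ 2 = n%:~R.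
  by apply: integral_rat_in; rewrite -nmE; exact: integral_mul.
have E : d%:R * (2 * y) ^+ 2 = (a ^+ 2 - 4 * n)%:~R.
  by rewrite !expr2 !(intrB, intrM) -aE -nE; ring.
have [b bE] := squarefree_sqr_int d_sqf E; exists a, b, n; split.
  by rewrite -aE -bE zE; congr (qK _ + qK _ * s); field.
apply: (@intr_inj rat); move: E; rewrite bE !expr2 !(intrB, intrM) -!pmulrn => ->.
by ring.
Qed.

Lemma integral_half (a b n : int) : a ^+ 2 - d%:Z * b ^+ 2 = 4 * n ->
  ringOfIntegers (qK (a%:~R / 2) + qK (b%:~R / 2) * s).
Proof.
move=> abn; set z := _ + _.
exists (Poly [:: n; - a; 1]).
  by rewrite monicE lead_coefE (@PolyK _ 0).
rewrite map_Poly_id0 // /root horner_Poly /= mul0r add0r mulr1z mulrNz.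
have nE : n%:~R = (a%:~R ^+ 2 - d%:R * b%:~R ^+ 2) / 4 :> rat.
  have -> : a%:~R ^+ 2 - d%:R * b%:~R ^+ 2 = (4 * n)%:~R :> rat.
    by rewrite -abn !expr2 !(intrB, intrM) -pmulrn.
  by rewrite intrM; field.
have aK t : t%:~R = qK t%:~R by rewrite rmorph_int.
rewrite /= !aK nE.
have aE : qK a%:~R = 2 * qK (a%:~R / 2) by rewrite -[2](rmorph_nat qK) -rmorphM; congr qK; field.
have nE' : qK ((a%:~R ^+ 2 - d%:R * b%:~R ^+ 2) / 4) = qK (a%:~R / 2) ^+ 2 - s ^+ 2 * qK (b%:~R / 2) ^+ 2.
  by rewrite -qK_norm; congr qK; field.
rewrite aE nE' /z; apply/eqP; ring.
Qed.
End QuadraticIntegers.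

(** * The unit of norm one and the integer [alpha] *)

Section NormOneUnit.
Variables (d : nat) (K : splittingFieldType rat) (s eps : K) (m k : nat).
Hypothesis d_sqf : squarefree d.
Hypothesis s_sqr : s ^+ 2 = d%:R.
Hypothesis K_gen : <<1; s>>%VS = fullv.
Hypothesis K_dim : \dim {:K} = 2%N.
Hypothesis m_sqf : squarefree m.
Hypothesis k_gt0 : (0 < k)%N.
Hypothesis eps_norm : galNorm 1 {:K} eps = 1.
Hypothesis eps1_norm : galNorm 1 {:K} (eps + 1) = (m * k ^ 2)%:R.
Local Notation qK := (rat_in K).

Lemma norm_one_coord : exists2 r : int,
  d%:Z * r ^+ 2 = m%:Z * (m%:Z * k%:Z ^+ 2 - 4) &
  eps = qK ((m%:R * k%:R ^+ 2 - 2) / 2) + qK (k%:R * r%:~R / 2) * s.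
Proof.
have [x [y epsE]] := quadratic_coord K_gen K_dim eps.
have qI : injective qK := fmorph_inj _.
have e1 : x ^+ 2 - d%:R * y ^+ 2 = 1.
  by apply: qI; rewrite -(galNorm_coord s_sqr K_gen K_dim) -epsE eps_norm rmorph1.
have e2 : (x + 1) ^+ 2 - d%:R * y ^+ 2 = m%:R * k%:R ^+ 2.
  apply: qI; rewrite -(galNorm_coord s_sqr K_gen K_dim).
  have -> : qK (x + 1) + qK y * s = eps + 1 by rewrite rmorphD rmorph1 epsE /=; ring.
  by rewrite eps1_norm -natrX -natrM rmorph_nat.
have k0 : k%:R != 0 :> rat by rewrite pnatr_eq0 -lt0n.
have xE : x = (m%:R * k%:R ^+ 2 - 2) / 2 by lra.
have E : d%:R * (2 * y / k%:R) ^+ 2 = (m%:Z * (m%:Z * k%:Z ^+ 2 - 4))%:~R :> rat.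
  have dy : d%:R * y ^+ 2 = x ^+ 2 - 1 by lra.
  rewrite !expr2 !(intrM, intrB) -!pmulrn.
  have -> : d%:R * (2 * y / k%:R * (2 * y / k%:R)) = 4 * (d%:R * y ^+ 2) / k%:R ^+ 2 :> rat.
    by field.
  by rewrite dy xE; field.
have [r rE] := squarefree_sqr_int d_sqf E; exists r.
  apply: (@intr_inj rat); move: E; rewrite rE => <-.
  by rewrite !expr2 !intrM -pmulrn.
by rewrite epsE -rE xE; congr (_ + qK _ * s); field.
Qed.

Variable r : int.
Hypothesis rel : d%:Z * r ^+ 2 = m%:Z * (m%:Z * k%:Z ^+ 2 - 4).
Hypothesis epsE : eps = qK ((m%:R * k%:R ^+ 2 - 2) / 2) + qK (k%:R * r%:~R / 2) * s.

Lemma relation_nat : (d * `|r| ^ 2 + 4 * m = m ^ 2 * k ^ 2)%N.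
Proof.
apply/eqP; rewrite -eqz_nat; apply/eqP; rewrite !(PoszD, PoszM).
have -> : `|r|%N%:Z * `|r|%N%:Z = r ^+ 2.
  have [->|->] : `|r|%N%:Z = r \/ `|r|%N%:Z = - r by clear; lia.
    by rewrite expr2.
  by rewrite mulrNN expr2.
by rewrite rel; ring.
Qed.

(** This is (eps + 1) / k. As the conjugate of eps is its inverse, (eps + 1)^2 is eps times the norm
    of eps + 1, whence [alpha_sqr]. *)
Let alpha := qK (m%:R * k%:R / 2) + qK (r%:~R / 2) * s.

Lemma alpha_integral : ringOfIntegers alpha.
Proof.
have h : (m * k)%N%:Z ^+ 2 - d%:Z * r ^+ 2 = 4 * m%:Z by rewrite rel PoszM; ring.
by have := integral_half s_sqr h; rewrite -pmulrn natrM.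
Qed.

Let s_sqrq : s * s = qK d%:R.
Proof. by rewrite -expr2 s_sqr rmorph_nat. Qed.

Let qK_mul x y x' y' : (qK x + qK y * s) * (qK x' + qK y' * s) =
  qK (x * x' + d%:R * y * y') + qK (x * y' + x' * y) * s.
Proof.
transitivity (qK x * qK x' + (s * s) * qK y * qK y' + (qK x * qK y' + qK x' * qK y) * s); first by ring.
by rewrite s_sqrq -!rmorphM -!rmorphD.
Qed.

Let qK_scale t x y : qK t * (qK x + qK y * s) = qK (t * x) + qK (t * y) * s.
Proof. by rewrite !rmorphM /=; ring. Qed.

Let qK_add x y x' y' : (qK x + qK y * s) + (qK x' + qK y' * s) = qK (x + x') + qK (y + y') * s.
Proof. by rewrite !rmorphD /=; ring. Qed.

Let relQ : d%:R * r%:~R ^+ 2 = m%:R * (m%:R * k%:R ^+ 2 - 4) :> rat.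
Proof.
have /(congr1 (intr : int -> rat)) := rel.
by rewrite !expr2 !(intrM, intrB) -!pmulrn.
Qed.

Lemma alpha_sqr : alpha ^+ 2 = m%:R * eps.
Proof.
have mK : m%:R = qK m%:R by rewrite rmorph_nat.
rewrite expr2 qK_mul epsE mK.
rewrite qK_scale; congr (qK _ + qK _ * s); last by field.
have -> : d%:R * (r%:~R / 2) * (r%:~R / 2) = d%:R * r%:~R ^+ 2 / 4 :> rat by field.
by rewrite relQ; field.
Qed.

Hypothesis eps_unit : unitGroup eps.
Hypothesis m_gt0 : (0 < m)%N.

Lemma sum2sq_unit_iff : sum2sq eps <-> sum2sq (m%:R : K).
Proof.
have [e0 _] := eps_unit; have m0 : m%:R != 0 :> K.
  by rewrite ((pcharf0P K).1 (numfield_char0 K)) -lt0n.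
split=> h.
  have -> : m%:R = alpha ^+ 2 * eps^-1 by rewrite alpha_sqr mulfK.
  by apply: sum2sqM (sum2sq_sqr _) (sum2sqV h).
have -> : eps = alpha ^+ 2 * m%:R^-1 by rewrite alpha_sqr mulrC mulKf.
by apply: sum2sqM (sum2sq_sqr _) (sum2sqV h).
Qed.

(** If m = 4 j + 1, then [alpha ^+ 2] = eps + 4 j eps. *)
Lemma unit_square_mod4_1mod4 : (m %% 4 = 1)%N -> unitsSquareMod4 eps.
Proof.
move=> m1; split=> //; have [_ [ie _]] := eps_unit.
exists alpha, (- (m %/ 4)%:R * eps); split; first exact: alpha_integral.
  by apply: integral_mul => //; apply: integral_opp; exact: integral_nat.
have mE : m%:R = 4 * (m %/ 4)%:R + 1 :> K.
  by rewrite {1}(divn_eq m 4) m1 natrD natrM mulrC.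
by rewrite alpha_sqr mE; ring.
Qed.

Lemma unit_square_mod4_data : unitsSquareMod4 eps -> exists x y z w g h : int,
  [/\ 2 * (m%:Z * k%:Z ^+ 2 - 2) = x ^+ 2 + d%:Z * y ^+ 2 + 8 * z, k%:Z * r = x * y + 4 * w,
   x ^+ 2 - d%:Z * y ^+ 2 = 4 * g & z ^+ 2 - d%:Z * w ^+ 2 = 4 * h].
Proof.
case=> _ [a [b [ia ib E]]].
have [x [y [g [aE G]]]] := ringOfIntegers_coord d_sqf s_sqr K_gen K_dim ia.
have [z [w [h [bE H]]]] := ringOfIntegers_coord d_sqf s_sqr K_gen K_dim ib.
have K4 : 4%:R = qK 4 by rewrite rmorph_nat.
have /(quadratic_coord_inj K_gen K_dim) [e1 e2] :
    qK ((m%:R * k%:R ^+ 2 - 2) / 2) + qK (k%:R * r%:~R / 2) * s =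
    qK (x%:~R / 2 * (x%:~R / 2) + d%:R * (y%:~R / 2) * (y%:~R / 2) + 4 * (z%:~R / 2)) +
    qK (x%:~R / 2 * (y%:~R / 2) + x%:~R / 2 * (y%:~R / 2) + 4 * (w%:~R / 2)) * s.
  by rewrite -qK_add -qK_scale -qK_mul -expr2 -K4 -aE -bE -E epsE.
exists x, y, z, w, g, h; split=> //; apply: (@intr_inj rat);
  rewrite ?expr2 !(intrM, intrD, intrB) -!pmulrn; move: e1 e2; rewrite ?expr2; lra.
Qed.
End NormOneUnit.

Lemma two_forms_anisotropic_rat (d m : nat) (X W Y Z : rat) : (d %% 8 = 1)%N -> (m %% 4 = 3)%N ->
  m%:R * (Y ^+ 2 + Z ^+ 2) = X ^+ 2 + d%:R * W ^+ 2 -> X = 0 /\ W = 0.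
Proof.
move=> d8 m4 E.
have den0 q : (denq q)%:~R != 0 :> rat by rewrite intr_eq0 denq_neq0.
pose D := denq X * denq W * denq Y * denq Z.
have D0 : D%:~R != 0 :> rat by rewrite !intrM !mulf_neq0.
have [x xE] : exists x : int, X = x%:~R / D%:~R.
  exists (numq X * (denq W * denq Y * denq Z)); rewrite -{1}(divq_num_den X) !intrM.
  by field; rewrite !den0.
have [w wE] : exists w : int, W = w%:~R / D%:~R.
  exists (numq W * (denq X * denq Y * denq Z)); rewrite -{1}(divq_num_den W) !intrM.
  by field; rewrite !den0.
have [y yE] : exists y : int, Y = y%:~R / D%:~R.
  exists (numq Y * (denq X * denq W * denq Z)); rewrite -{1}(divq_num_den Y) !intrM.
  by field; rewrite !den0.
have [z zE] : exists z : int, Z = z%:~R / D%:~R.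
  exists (numq Z * (denq X * denq W * denq Y)); rewrite -{1}(divq_num_den Z) !intrM.
  by field; rewrite !den0.
have EZ : m%:Z * (y ^+ 2 + z ^+ 2) = x ^+ 2 + d%:Z * w ^+ 2.
  apply: (@intr_inj rat); rewrite !expr2 !(intrM, intrD) -!pmulrn.
  apply: (mulIf (expf_neq0 2 (invr_neq0 D0))).
  have e (u v t : rat) : u * (v * v + t * t) * D%:~R^-1 ^+ 2 = u * ((v / D%:~R) ^+ 2 + (t / D%:~R) ^+ 2) by ring.
  by rewrite e -yE -zE E xE wE; ring.
have absE (t : int) : (`|t| ^ 2)%N%:Z = t ^+ 2.
  have [h|h] : `|t|%N%:Z = t \/ `|t|%N%:Z = - t by clear; lia.
    by rewrite PoszM h expr2.
  by rewrite PoszM h mulrNN expr2.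
have [|x0 w0] := @two_forms_anisotropic d m `|x| `|w| `|y| `|z| d8 m4.
  move: EZ; rewrite -!absE; clear.
  by move: (`|x| ^ 2)%N (`|y| ^ 2)%N (`|z| ^ 2)%N (`|w| ^ 2)%N => a b c e; lia.
have x0' : x = 0 by clear -x0; lia.
have w0' : w = 0 by clear -w0; lia.
by rewrite xE wE x0' w0' !mul0r.
Qed.

Section UnitCriteria.
Variables (R : realType) (d : nat) (K : splittingFieldType rat) (s eps : K) (m k : nat) (r : int).
Hypothesis d_sqf : squarefree d.
Hypothesis s_sqr : s ^+ 2 = d%:R.
Hypothesis K_gen : <<1; s>>%VS = fullv.
Hypothesis K_dim : \dim {:K} = 2%N.
Hypothesis m_sqf : squarefree m.
Hypothesis rel : d%:Z * r ^+ 2 = m%:Z * (m%:Z * k%:Z ^+ 2 - 4).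
Local Notation qK := (rat_in K).
Hypothesis epsE : eps = qK ((m%:R * k%:R ^+ 2 - 2) / 2) + qK (k%:R * r%:~R / 2) * s.
Hypothesis eps_unit : unitGroup eps.

(** If m = a^2 + b^2, the coordinate along s vanishes: x1 y1 + x2 y2 = 0. Lagrange's identity then
    turns m (x1^2 + x2^2) into a value of X^2 + d W^2, so x1^2 + x2^2 = 0; the same anisotropy
    disposes of y1, y2. *)
Lemma not_sum2sq_squarefree_part : (d %% 8 = 1)%N -> (m %% 4 = 3)%N -> ~ sum2sq (m%:R : K).
Proof.
move=> d8 m4 [a [b E]].
have [x1 [y1 aE]] := quadratic_coord K_gen K_dim a.
have [x2 [y2 bE]] := quadratic_coord K_gen K_dim b.
have ss : s * s = qK d%:R by rewrite -expr2 s_sqr rmorph_nat.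
have /(quadratic_coord_inj K_gen K_dim) [e1 e2] :
    qK m%:R + qK 0 * s =
    qK (x1 * x1 + x2 * x2 + d%:R * (y1 * y1 + y2 * y2)) + qK (2 * (x1 * y1 + x2 * y2)) * s.
  rewrite rmorph0 mul0r addr0 rmorph_nat E aE bE !(rmorphD, rmorphM) /= -ss; ring.
have m0 : m%:R != 0 :> rat by rewrite pnatr_eq0; apply/eqP => m0; rewrite m0 in m4.
have [|A0 _] := @two_forms_anisotropic_rat d m (x1 ^+ 2 + x2 ^+ 2) (x1 * y2 - x2 * y1) x1 x2 d8 m4.
  rewrite e1.
  have -> : (x1 ^+ 2 + x2 ^+ 2) ^+ 2 + d%:R * (x1 * y2 - x2 * y1) ^+ 2 =
     (x1 * x1 + x2 * x2 + d%:R * (y1 * y1 + y2 * y2)) * (x1 ^+ 2 + x2 ^+ 2) -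
     d%:R * (x1 * y1 + x2 * y2) ^+ 2 by ring.
  have -> : x1 * y1 + x2 * y2 = 0 by lra.
  by ring.
have xx : x1 * x1 + x2 * x2 = 0 by rewrite -A0; ring.
have [|_ B0] := @two_forms_anisotropic_rat d m 0 (y1 ^+ 2 + y2 ^+ 2) y1 y2 d8 m4.
  by rewrite e1 xx; ring.
by move: m0; rewrite e1 xx -!expr2 B0 mulr0 addr0 eqxx.
Qed.

Lemma sum2sq_unit_criterion : sum2sq eps <-> ~ notSumTwoSquaresCondition d m.
Proof.
have m0 := squarefree_gt0 m_sqf.
rewrite (sum2sq_unit_iff s_sqr rel epsE eps_unit m0); split.
  by move=> sm [d8 m4]; exact: not_sum2sq_squarefree_part d8 m4 sm.
move=> nc; apply: (sum2sq_squarefree_part R (numfield_char0 K) d_sqf m_sqf s_sqr (relation_nat rel)).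
exact: nc.
Qed.

Lemma squareMod4_of_unit : unitsSquareMod4 eps -> squareMod4Condition d m.
Proof.
move=> /(unit_square_mod4_data d_sqf s_sqr K_gen K_dim epsE).
case=> [x [y [z [w [g [h [H1 H2 G H]]]]]]].
have intN (n a b : nat) : (n %% a = b)%N -> exists e : int, n%:Z = a%:Z * e + b%:Z.
  by move=> <-; exists (n %/ a)%N%:Z; rewrite -PoszM -PoszD mulnC -divn_eq.
have G' : exists g, x ^+ 2 - d%:Z * y ^+ 2 = 4 * g by exists g.
have H' : exists h, z ^+ 2 - d%:Z * w ^+ 2 = 4 * h by exists h.
have odd_of (n : nat) : odd n -> exists f : int, n%:Z = 2 * f + 1.
  by move=> on; apply: (intN n 2 1)%N; rewrite modn2 on.
have relN := relation_nat rel.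
have half_odd n : squarefree n -> ~~ odd n -> exists2 n', n = (2 * n')%N & odd n'.
  move=> sn; rewrite -dvdn2 => /dvdnP [n' nE]; exists n'; first by rewrite nE mulnC.
  apply/negPn/negP; rewrite -dvdn2 => n2; have : (2 ^ 2 %| n)%N by rewrite nE dvdn_mul.
  by move/sn.
have [d4|d4|d4] : [\/ (d %% 4 = 1)%N, (d %% 4 = 3)%N | (d %% 4 = 2)%N].
  have : (d %% 4 != 0)%N by apply/negP => /(d_sqf (k := 2)).
  have := ltn_pmod d (isT : 0 < 4)%N; case: (d %% 4)%N => [|[|[|[|]]]] // _ _; 
    by [apply: Or31|apply: Or32|apply: Or33].
- have od : odd d by clear -d4; lia.
  (* For odd d an even m would force d = 3 or 7 modulo 8. *)
  have om : odd m.
    apply/negPn/negP => em; have [m' mE om'] := half_odd m m_sqf em.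
    have /dvdnP [n dE] : (m' %| d)%N.
      apply: squarefree_dvdP => [|p pp pm'].
        by apply: squarefree_dvd m_sqf; rewrite mE dvdn_mull.
      apply: (odd_prime_dvd_disc m_sqf relN pp).
        by case/dvdnP: pm' om' => j ->; rewrite oddM => /andP [].
      by rewrite mE dvdn_mull.
    rewrite mulnC in dE.
    have on : odd n by move: od; rewrite dE oddM => /andP [].
    have [r' [_ rel']] := relation_odd_even relN on om' dE mE.
    by have := mod8_relation om' on rel'; rewrite -dE; clear -d4; lia.
  left; split=> //; case: (eqVneq (m %% 4)%N 1%N) => [//|m1]; exfalso.
  have m3 : (m %% 4 = 3)%N by clear -m1 om; lia.
  exact: unit_square_1mod4 (intN _ _ _ d4) (intN _ _ _ m3) rel H1 H2 G' H'.
- right; left; split=> //; apply/negPn/negP => em; have [m' mE om'] := half_odd m m_sqf em.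
  have rel1 := rel; rewrite mE PoszM in rel1.
  exact: unit_square_3mod4 (intN _ _ _ d4) (odd_of _ om') rel1 H2 G'.
right; right; have [om|em] := boolP (odd m).
  have [f fE] := unit_square_2mod4_odd (intN _ _ _ d4) (odd_of _ om) rel H1 H2 G' H'.
  by left; split=> //; clear -fE; lia.
right; have ed : ~~ odd d by clear -d4; lia.
have [m' mE om'] := half_odd m m_sqf em; have [d' dE od'] := half_odd d d_sqf ed.
have rel' : 2 * d'%:Z * r ^+ 2 = 2 * m'%:Z * (2 * m'%:Z * k%:Z ^+ 2 - 4).
  by move: rel; rewrite mE dE !PoszM.
have [k1 [r1 [kE rE rel2]]] := relation_even_even (odd_of _ od') (odd_of _ om') rel'.
rewrite mE dE !PoszM kE rE in H1 H2 G' H'.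
have k1o := unit_square_2mod4_even (odd_of _ od') (odd_of _ om') rel2 H1 H2 G' H'.
have [/(_ k1o) [j jE] _] := relation_even_even_mod8 (odd_of _ om') rel2.
have : (m' %% 4 = 1 \/ m' %% 4 = 3)%N by clear -om'; lia.
by rewrite mE dE; clear -jE; case=> m'4; [left|right]; lia.
Qed.

Lemma unit_of_squareMod4 : squareMod4Condition d m -> unitsSquareMod4 eps.
Proof.
have relN := relation_nat rel.
have one m1 := unit_square_mod4_1mod4 s_sqr rel epsE eps_unit (m1 : (m %% 4 = 1)%N).
case=> [[_ m1]|]; first exact: one.
case=> [[d3 om]|].
  (* For d = 3 mod 4 an odd m is automatically 1 mod 4, since m = 3 would give d = 1. *)
  apply: one; have od : odd d by move: d3; clear; rewrite /=; lia.
  have h := relation_odd_odd m_sqf relN od om.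
  by move: d3 h om; clear; rewrite /=; lia.
case=> [[_ m1]|H]; first exact: one.
have {}H : (d %% 8 = 2 /\ m %% 8 = 2 \/ d %% 8 = 6 /\ m %% 8 = 6)%N by [].
pose d' := (d %/ 2)%N; pose m' := (m %/ 2)%N.
have dE : d = (2 * d')%N by clear -H; rewrite /d'; lia.
have mE : m = (2 * m')%N by clear -H; rewrite /m'; lia.
have od' : exists f : int, d'%:Z = 2 * f + 1.
  by exists (d' %/ 2)%N%:Z; clear -H; rewrite /d'; lia.
have om' : exists f : int, m'%:Z = 2 * f + 1.
  by exists (m' %/ 2)%N%:Z; clear -H; rewrite /m'; lia.
have rel' : 2 * d'%:Z * r ^+ 2 = 2 * m'%:Z * (2 * m'%:Z * k%:Z ^+ 2 - 4).
  by move: rel; rewrite {1}mE {1}dE {1}mE !PoszM.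
have [k1 [r1 [kE rE rel2]]] := relation_even_even od' om' rel'.
have [_ k1even] := relation_even_even_mod8 om' rel2.
have [k2 kE2] : exists k2, k1 = 2 * k2 + 1.
  have [/k1even [j jE]|//] := int_parity k1.
  by exfalso; clear -jE H; rewrite /d' /m' in jE; lia.
case: od' => e dE'.
(* The square is that of 1 + s, and z, w solve eps = (1 + s)^2 + 4 (z + w s) / 2; both are even
   because d' and k1 are odd, so the second term is integral. *)
pose z := 2 * m'%:Z * k1 ^+ 2 - 1 - d'%:Z; pose w := k1 * (2 * r1 + 1) - 1.
have Hzw : z ^+ 2 - d%:Z * w ^+ 2 = 4 * ((m'%:Z * k1 ^+ 2 - 1 - e) ^+ 2 - d%:Z * (2 * k2 * r1 + k2 + r1) ^+ 2).
  by rewrite /z /w kE2 dE'; ring.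
have H1s : 2%:Z ^+ 2 - d%:Z * 2%:Z ^+ 2 = 4 * (1 - d%:Z) by ring.
split=> //; exists (1 + s), (qK (z%:~R / 2) + qK (w%:~R / 2) * s); split.
- have := integral_half s_sqr H1s.
  have -> : 2%:~R / 2 = 1 :> rat by [].
  by rewrite !rmorph1 mul1r.
- by have := integral_half s_sqr Hzw.

have kQ : k%:R = 2 * k1%:~R :> rat by rewrite -[k%:R]/(k%:Z%:~R) kE intrM.
have rQ : r%:~R = 2 * (2 * r1%:~R + 1) :> rat by rewrite rE !(intrM, intrD).
have mQ : m%:R = 2 * m'%:R :> rat by rewrite mE natrM.
have dQ : d%:R = 2 * d'%:R :> rat by rewrite dE natrM.
have zQ : z%:~R = 2 * m'%:R * k1%:~R ^+ 2 - 1 - d'%:R :> rat.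
  by rewrite /z !expr2 !(intrB, intrM) -!pmulrn.
have wQ : w%:~R = k1%:~R * (2 * r1%:~R + 1) - 1 :> rat by rewrite /w !(intrB, intrM, intrD).
rewrite epsE.
have -> : (1 + s) ^+ 2 = qK (1 + d%:R) + qK 2 * s.
  by rewrite rmorphD rmorph1 !rmorph_nat -s_sqr; ring.
have K4 : 4%:R = qK 4 by rewrite rmorph_nat.
transitivity (qK (1 + d%:R + 4 * (z%:~R / 2)) + qK (2 + 4 * (w%:~R / 2)) * s); last first.
  by rewrite K4 !rmorphD !rmorphM /=; ring.
congr (qK _ + qK _ * s); first by rewrite mQ kQ zQ dQ; field.
by rewrite kQ rQ wQ; field.
Qed.
End UnitCriteria.

(** * Unit groups and indices *)

Local Open Scope classical_set_scope.
Local Open Scope card_scope.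

Section Index.
Variables (K : fieldType).

Lemma card_eq_set2 (T : Type) (a b : T) : a <> b -> [set a; b] #= `I_2.
Proof.
move=> ab; pose f i : T := if i == 0%N then a else b.
have -> : [set a; b] = f @` `I_2.
  apply/seteqP; split=> [x [->|->]|x [i /= i2 <-]].
  - by exists 0%N.
  - by exists 1%N.
  - by rewrite /f; case: ifP; [left|right].
apply: inj_card_eq => i j; rewrite !inE /= => i2 j2; rewrite /f.
by case: i i2 => [|[|]] //; case: j j2 => [|[|]] // _ _ e; case: ab.
Qed.

Definition mulClosed1 (B : set K) :=
  [/\ B 1, forall x, B x -> x != 0, forall x y, B x -> B y -> B (x * y) & forall x, B x -> B x^-1].

Lemma hasIndex2 (A B : set K) (x0 : K) : mulClosed1 B -> B `<=` A -> A x0 -> x0 != 0 -> ~ B x0 ->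
  (forall x, A x -> B x \/ B (x / x0)) -> hasIndex A B 2.
Proof.
move=> [B1 B0 BM BV] BA Ax0 x00 nBx0 cov.
have coset1 x : B x -> [set x * y | y in B] = B.
  move=> Bx; apply/seteqP; split=> [_ [y By <-]|y By]; first exact: BM.
  by exists (x^-1 * y); [apply: BM => //; exact: BV|rewrite mulrA mulfV ?mul1r // B0].
have coset2 x : B (x / x0) -> [set x * y | y in B] = [set x0 * y | y in B].
  move=> Bx; apply/seteqP; split=> [_ [y By <-]|_ [y By <-]].
    by exists (x / x0 * y); [exact: BM|field].
  have x0' : x != 0 by apply: contraTneq (B0 _ Bx) => ->; rewrite mul0r eqxx.
  exists ((x / x0)^-1 * y); first by apply: BM => //; exact: BV.
  by field; rewrite x0' x00.
have E : [set [set x * y | y in B] | x in A] = [set B; [set x0 * y | y in B]].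
  apply/seteqP; split=> [_ [x Ax <-]|_ [->|->]].
  - by have [/coset1|/coset2] := cov x Ax; [left|right].
  - by exists 1; [exact: BA|exact: coset1].
  - by exists x0.
rewrite /hasIndex E; apply: card_eq_set2 => e; apply: nBx0; rewrite e.
by exists 1; rewrite ?mulr1.
Qed.

Lemma not_hasIndex_self2 (B : set K) : mulClosed1 B -> ~ hasIndex B B 2.
Proof.
move=> [B1 B0 BM BV]; rewrite /hasIndex.
have -> : [set [set x * y | y in B] | x in B] = [set B].
  have coset1 x : B x -> [set x * y | y in B] = B.
    move=> Bx; apply/seteqP; split=> [_ [y By <-]|y By]; first exact: BM.
    by exists (x^-1 * y); [apply: BM => //; exact: BV|rewrite mulrA mulfV ?mul1r // B0].
  apply/seteqP; split=> [_ [x Bx <-]|_ ->]; first exact: coset1.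
  by exists 1 => //; exact: coset1.
by rewrite (card_eql card_set1) => /card_eq_II.
Qed.
End Index.

Section UnitIndices.
Variables (R : realType) (K : splittingFieldType rat) (sigma : {rmorphism K -> R}) (eps : K).
Hypothesis eps_fund : isFundamentalUnit sigma eps.
Hypothesis eps_pos : forall tau : {rmorphism K -> R}, 0 < tau eps.

Let E := @unitGroup K.
(** Even powers and all powers of eps: the squares of units and, eps being totally positive, the
    totally positive units. *)
Let Q := [set eps ^ (2 * n) | n in [set: int]].
Let P := [set eps ^ n | n in [set: int]].

Let eps_unit : unitGroup eps. Proof. by case: eps_fund. Qed.
Let eps0 : eps != 0. Proof. by case: eps_unit. Qed.
Let sig1 : 1 < sigma eps. Proof. by case: eps_fund. Qed.

Lemma unitGroupM (x y : K) : unitGroup x -> unitGroup y -> unitGroup (x * y).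
Proof.
move=> [x0 [ix ix']] [y0 [iy iy']]; split; first by rewrite mulf_neq0.
by rewrite invfM; split; exact: integral_mul.
Qed.

Lemma unitGroupV (x : K) : unitGroup x -> unitGroup x^-1.
Proof. by move=> [x0 [ix ix']]; split; [rewrite invr_eq0|rewrite invrK]. Qed.

Lemma unitGroupN (x : K) : unitGroup x -> unitGroup (- x).
Proof.
by move=> [x0 [ix ix']]; split; [rewrite oppr_eq0|rewrite invrN; split; exact: integral_opp].
Qed.

Lemma unitGroup1 : unitGroup (1 : K).
Proof. by split; [exact: oner_neq0|rewrite invr1; split; exact: integral1]. Qed.

Lemma unitGroupX (x : K) (n : int) : unitGroup x -> unitGroup (x ^ n).
Proof.
move=> ux; have pos (j : nat) : unitGroup (x ^+ j).
  by elim: j => [|j IH]; [exact: unitGroup1|rewrite exprS; exact: unitGroupM].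
by case: n => j; [exact: pos|apply: unitGroupV; exact: pos].
Qed.

Let sig_pow (n : int) : 0 < sigma (eps ^ n).
Proof. by rewrite fmorphXz exprz_gt0 // (lt_trans ltr01). Qed.

Let eps_powI (m n : int) : eps ^ m = eps ^ n -> m = n.
Proof.
move=> /(congr1 sigma); rewrite !fmorphXz; apply: ieexprIz.
  exact: lt_trans ltr01 sig1.
by rewrite gt_eqF.
Qed.

Let unit_cases (u : K) : unitGroup u -> exists n : int, u = eps ^ n \/ u = - eps ^ n.
Proof. by case: eps_fund => _ + _; apply. Qed.

Lemma totallyPositiveUnitsE : @totallyPositiveUnits R K = P.
Proof.
apply/seteqP; split=> [u [uu up]|_ [n _ <-]].
  have [n [->|uE]] := unit_cases uu; first by exists n.
  by have := up sigma; rewrite uE rmorphN oppr_gt0 ltNge ltW.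
split; first exact: unitGroupX.
by move=> tau; rewrite fmorphXz exprz_gt0.
Qed.

Lemma unitSquaresE : @unitSquares K = Q.
Proof.
have sq n : (eps ^ n) ^+ 2 = eps ^ (2 * n) by rewrite mulrC -exprz_exp -exprnP.
apply/seteqP; split=> [_ [u uu <-]|_ [n _ <-]].
  by have [n [->|->]] := unit_cases uu; exists n; rewrite ?sqrrN ?sq.
by exists (eps ^ n); [exact: unitGroupX|rewrite sq].
Qed.

Let closedQ : mulClosed1 Q.
Proof.
split=> [|_ [n _ <-]|_ _ [m _ <-] [n _ <-]|_ [n _ <-]].
- by exists 0; rewrite ?mulr0 ?expr0z.
- exact: expfz_neq0.
- by exists (m + n); rewrite // -expfzDr // mulrDr.
- by exists (- n); rewrite // invr_expz mulrN.
Qed.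

Let closedP : mulClosed1 P.
Proof.
split=> [|_ [n _ <-]|_ _ [m _ <-] [n _ <-]|_ [n _ <-]].
- by exists 0; rewrite ?expr0z.
- exact: expfz_neq0.
- by exists (m + n); rewrite // -expfzDr.
- by exists (- n); rewrite // invr_expz.
Qed.

Let QP : Q `<=` P. Proof. by move=> _ [n _ <-]; exists (2 * n). Qed.
Let PE : P `<=` E. Proof. by move=> _ [n _ <-]; exact: unitGroupX. Qed.
Let P_eps : P eps. Proof. by exists 1; rewrite ?expr1z. Qed.

Lemma not_even_power : ~ Q eps.
Proof. by case=> n _; rewrite -[in RHS](expr1z eps) => /eps_powI; lia. Qed.

Lemma hasIndexPQ : hasIndex P Q 2.
Proof.
apply: (hasIndex2 closedQ QP P_eps eps0 not_even_power) => _ [n _ <-].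
have [[a ->]|[a ->]] := int_parity n; first by left; exists a.
by right; exists a; rewrite // expfzDr // expr1z mulfK.
Qed.

Lemma hasIndexEP : hasIndex E P 2.
Proof.
apply: (@hasIndex2 K E P (-1) closedP PE).
- exact: unitGroupN unitGroup1.
- by rewrite oppr_eq0 oner_eq0.
- by case=> n _ /(congr1 sigma) e; have := sig_pow n; rewrite e rmorphN1 oppr_gt0 ltNge ler01.
move=> u uu; have [n [->|->]] := unit_cases uu; first by left; exists n.
by right; exists n; rewrite // invrN invr1 mulrN mulr1 opprK.
Qed.

(** P has only the two classes of 1 and eps modulo squares of units. Stability under these squares
    suffices, so X need not be known to be a group. *)
Lemma intermediate_units (X : set K) : Q `<=` X -> X `<=` P ->
  (forall x v, X x -> unitGroup v -> X (x * v ^+ 2)) -> X = if `[< X eps >] then P else Q.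
Proof.
move=> QX XP XM; have sq n : (eps ^ n) ^+ 2 = eps ^ (2 * n) by rewrite mulrC -exprz_exp -exprnP.
have uX := fun n => unitGroupX n eps_unit.
case: asboolP => Xe; apply/seteqP; split=> //.
  move=> _ [n _ <-]; have [[a ->]|[a ->]] := int_parity n; first by apply: QX; exists a.
  by rewrite addrC expfzDr // expr1z -sq; apply: XM.
move=> x Xx; have [n _ nE] := XP x Xx; move: Xx; rewrite -nE.
have [[a ->]|[a ->]] := int_parity n; first by exists a.
move=> Xx; case: Xe; have := XM _ _ Xx (uX (- a)).
by rewrite sq -expfzDr // (_ : 2 * a + 1 + 2 * - a = 1) ?expr1z //; ring.
Qed.

Let E4P := @unitsSquareMod4 K `&` @totallyPositiveUnits R K.

Lemma squareMod4_positiveE : E4P = if `[< @unitsSquareMod4 K eps >] then P else Q.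
Proof.
have E4Pe : E4P eps <-> @unitsSquareMod4 K eps.
  split=> [[]//|h]; split=> //; rewrite totallyPositiveUnitsE; exact: P_eps.
have -> : `[< @unitsSquareMod4 K eps >] = `[< E4P eps >] by apply: asbool_equiv_eq; apply: iff_sym.
apply: intermediate_units.
- move=> x Qx; split; last by rewrite totallyPositiveUnitsE; exact: QP.
  move: Qx; rewrite -unitSquaresE => -[u uu <-]; split; first by rewrite expr2; exact: unitGroupM.
  case: (uu) => _ [iu _]; exists u, 0; split=> //; first exact: integral0.
  by rewrite mulr0 addr0.
- by move=> x []; rewrite totallyPositiveUnitsE.
move=> x v [[ux [a [b [ia ib xE]]]] px] uv; have uv2 := unitGroupM uv uv.
split; last first.
  rewrite totallyPositiveUnitsE; case: closedP => _ _ PM _; apply: PM; first by rewrite -totallyPositiveUnitsE.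
  by apply: QP; rewrite -unitSquaresE; exists v.
split; first by rewrite expr2; exact: unitGroupM.
case: (uv) => _ [iv _]; exists (a * v), (b * v ^+ 2); split.
- exact: integral_mul.
- by apply: integral_mul => //; rewrite expr2; exact: integral_mul.
by rewrite xE; ring.
Qed.

Lemma sumTwoSquaresE : @unitsSumTwoSquares K = if `[< @unitsSumTwoSquares K eps >] then P else Q.
Proof.
apply: intermediate_units.
- move=> x; rewrite -unitSquaresE => -[u uu <-]; split; first by rewrite expr2; exact: unitGroupM.
  exact: sum2sq_sqr.
- move=> u [uu [a [b uE]]]; have [n [->|uN]] := unit_cases uu; first by exists n.
  (* A unit - eps^n is negative under [sigma], so it is no sum of two squares. *)
  have := sig_pow n; rewrite -[eps ^ n]opprK -uN uE rmorphN oppr_gt0 rmorphD !rmorphXn /= ltNge.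
  by rewrite addr_ge0 // sqr_ge0.
move=> x v [ux sx] uv; split; first by apply: unitGroupM => //; rewrite expr2; exact: unitGroupM.
exact: sum2sqM sx (sum2sq_sqr v).
Qed.

Lemma not_hasIndexPP : ~ hasIndex P P 2. Proof. exact: not_hasIndex_self2. Qed.
Lemma not_hasIndexQQ : ~ hasIndex Q Q 2. Proof. exact: not_hasIndex_self2. Qed.
End UnitIndices.

Theorem theorem3 (R : realType) (d : nat) (K : splittingFieldType rat) (s : K)
    (sigma : {rmorphism K -> R}) (eps : K) (N m : nat)
    (d_gt0 : (0 < d)%N) (d_sqfree : squarefree d)
    (s_sqrt : s ^+ 2 = d%:R) (K_gen : <<1; s>>%VS = fullv)
    (K_quadratic : \dim {:K} = 2%N)
    (sigma_s_gt0 : 0 < sigma s)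
    (eps_fund : isFundamentalUnit sigma eps)
    (eps_norm : galNorm 1 {:K} eps = 1)
    (N_norm : galNorm 1 {:K} (eps + 1) = N%:R)
    (m_sqfree_part : squarefree_part_of N m) :
  let E := @unitGroup K in
  let Esq := @unitSquares K in
  let Epos := @totallyPositiveUnits R K in
  let E4 := @unitsSquareMod4 K in
  let Esum2 := @unitsSumTwoSquares K in
  (* (a) *)
  [/\ hasIndex (E4 `&` Epos) Esq 2 <-> E4 eps,
      hasIndex (E4 `&` Epos) Esq 2 <->
        [/\ Esq `<=` E4 `&` Epos, E4 `&` Epos = Esum2, Esum2 = Epos
          & Epos `<=` E]
        /\ hasIndex (E4 `&` Epos) Esq 2 /\ hasIndex E Epos 2
    & hasIndex (E4 `&` Epos) Esq 2 <-> squareMod4Condition d m]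
  /\
  (* (b) *)
  [/\ hasIndex Epos Esum2 2 <-> ~ Esum2 eps,
      hasIndex Epos Esum2 2 <->
        [/\ Esq = E4 `&` Epos, E4 `&` Epos = Esum2, Esum2 `<=` Epos
          & Epos `<=` E]
        /\ hasIndex Epos Esum2 2 /\ hasIndex E Epos 2
    & hasIndex Epos Esum2 2 <-> notSumTwoSquaresCondition d m]
  /\
  (* (c) *)
  (~ squareMod4Condition d m -> ~ notSumTwoSquaresCondition d m ->
    [/\ hasIndex Esum2 (E4 `&` Epos) 2,
        Esum2 eps /\ ~ E4 eps,
        [/\ Esq = E4 `&` Epos, E4 `&` Epos `<=` Esum2, Esum2 = Epos
          & Epos `<=` E]
      & hasIndex E Epos 2]).
Proof.
move=> E Esq Epos E4 Esum2.
have [m_sqf [mN [k kE]]] := m_sqfree_part.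
have NE : N = (m * k ^ 2)%N by rewrite -kE mulnC divnK.
have [eps_unit _ sig1] := eps_fund; have [eps0 _] := eps_unit.
have m_gt0 := squarefree_gt0 m_sqf.
have k_gt0 : (0 < k)%N.
  (* If k were 0, eps + 1 would have norm 0, so eps = -1, against 1 < [sigma eps]. *)
  rewrite lt0n; apply/eqP => k0; have [c [_ _ cN]] := quadratic_conj_exists s_sqrt K_gen K_quadratic.
  move/eqP: N_norm; rewrite NE k0 muln0 cN mulf_eq0 fmorph_eq0 orbb addr_eq0 => /eqP e.
  by move: sig1; rewrite e rmorphN1; lra.
rewrite NE in N_norm.
have [r rel epsE] := norm_one_coord d_sqfree s_sqrt K_gen K_quadratic k_gt0 eps_norm N_norm.
(* Under any real embedding m eps becomes a nonzero square. *)
have eps_pos (tau : {rmorphism K -> R}) : 0 < tau eps.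
  have asq := alpha_sqr s_sqrt rel epsE.
  have m0 : m%:R != 0 :> K by rewrite ((pcharf0P K).1 (numfield_char0 K)) -lt0n.
  have /(congr1 tau) := asq; rewrite [tau (_ * eps)]rmorphM rmorphXn rmorph_nat /= => tasq.
  have : 0 < m%:R * tau eps.
    rewrite -tasq exprn_even_gt0 //= fmorph_eq0.
    by apply: contra_neq (mulf_neq0 m0 eps0) => a0; rewrite -asq a0 expr0n.
  by rewrite pmulr_rgt0 // ltr0n.
have E4c : E4 eps <-> squareMod4Condition d m.
  split; first exact: squareMod4_of_unit d_sqfree s_sqrt K_gen K_quadratic m_sqf rel epsE.
  exact: unit_of_squareMod4 s_sqrt m_sqf rel epsE eps_unit.
have Esum2c : Esum2 eps <-> ~ notSumTwoSquaresCondition d m.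
  rewrite -(sum2sq_unit_criterion R d_sqfree s_sqrt K_gen K_quadratic m_sqf rel epsE eps_unit).
  by split=> [[]|].
have cond : squareMod4Condition d m -> ~ notSumTwoSquaresCondition d m.
  by rewrite /squareMod4Condition /notSumTwoSquaresCondition /=; clear; lia.
have EposE := totallyPositiveUnitsE eps_fund eps_pos.
have EsqE := unitSquaresE eps_fund.
have E4E := squareMod4_positiveE eps_fund eps_pos.
have Esum2E := sumTwoSquaresE eps_fund eps_pos.
have PQ := hasIndexPQ eps_fund; have EP := hasIndexEP eps_fund eps_pos.
have nPP := not_hasIndexPP eps_fund; have nQQ := not_hasIndexQQ eps_fund.
rewrite -EposE -EsqE -/E -/Esq -/Epos -/E4 -/Esum2 in E4E Esum2E PQ EP nPP nQQ.
have PosE : Epos `<=` E by move=> x [].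
have SqPos : Esq `<=` Epos.
  by rewrite /Esq /Epos EsqE EposE => _ [n _ <-]; exists (2 * n).
have Pe : Epos eps by rewrite /Epos EposE; exists 1; rewrite ?expr1z.
have nSe : ~ Esq eps by rewrite /Esq EsqE; exact: not_even_power eps_fund.
rewrite {}E4E {}Esum2E.
(* Each of the two sets is now [Epos] or [Esq], according to whether it contains eps. Of the four
   cases the second is excluded by [cond]; the others are (a), (c), (b) in this order. *)
case: asboolP => h4; case: asboolP => h2.
- split; first by split; [by []|by split=> [_|[_ []]]|by rewrite -E4c].
  split; last by move/(_ (E4c.1 h4)).
  split; split=> [/nPP //|]; first by move/(_ Pe).
    by case=> _ [/nPP].
  by move/Esum2c: h2.
- by case: h2; apply/Esum2c/cond/E4c.
- split.
    split; split=> [/nQQ //|]; first by move/h4.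
      by case=> _ [/nQQ].
    by move/E4c/h4.
  split; last by [].
  split; split=> [/nPP //|]; first by move/(_ Pe).
    by case=> _ [/nPP].
  by move/Esum2c: h2.
split.
  split; split=> [/nQQ //|]; first by move/h4.
    by case=> _ [/nQQ].
  by move/E4c/h4.
have nc : notSumTwoSquaresCondition d m by apply: contrapT => /Esum2c.
by split; [split; [by []|by split=> [_|[_ []]]|by []]|].
Qed.
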